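(* Let $n\ge 3$ be an integer. For any quadrilateral $R$ in the extended complex plane whose sides are either line segments or circular arcs and whose interior angles are all $\pi/n$, the circle $C$ passing through the two end points $q,q'$ of $\tilde\xi$ and the repelling fixed point $p$ of $\tilde\eta$ is exotic. That is, the corresponding geodesic plane $P$ is closed in $N_R^*$ (meaning that $P^*=P\cap N_R^*$ is closed in $N_R^*$) but $P$ is not closed in $N_R$.
   Context: Reflections in the sides of $R$ generate a discrete group of isometries of $\mathbb{H}^3$ (acting on the sphere at infinity $S^2=\widehat{\mathbb{C}}$), and $\Gamma_R\subset\mathrm{PSL}(2,\mathbb{C})$ is its index 2 subgroup of orientation preserving elements. $\Gamma_R$ is a quasifuchsian group, and $N_R:=\Gamma_R\backslash\mathbb{H}^3$ is the corresponding quasifuchsian orbifold. Denote by $C_i$, $1\le i\le 4$, the circles on which the four sides of $R$ lie, labelled so that $C_1$ and $C_3$ contain opposite sides (and so do $C_2$ and $C_4$); the hyperbolic planes in $\mathbb{H}^3$ bounded by these circles are also denoted $C_i$. Let $\tilde\xi$ be the complete geodesic in $\mathbb{H}^3$ perpendicular to both planes $C_1$ and $C_3$, with end points $q,q'\in S^2$, and let $\tilde\eta$ be the complete geodesic perpendicular to both planes $C_2$ and $C_4$; $\tilde\eta$ also denotes the hyperbolic element of $\Gamma_R$ with this axis given by reflection across $C_2$ followed by reflection across $C_4$; $p$ is its repelling fixed point. The geodesics $\tilde\xi,\tilde\eta$ project to closed geodesics $\xi,\eta$ in $N_R$. For $\Lambda$ the limit set of $\Gamma_R$, the convex core is $\mathrm{core}(N_R)=\Gamma_R\backslash\mathrm{hull}(\Lambda)$,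 and $N_R^*$ denotes its interior. A circle $C\subset S^2$ determines a unique geodesic plane $\tilde P$ in $\mathbb{H}^3$ (the one with boundary at infinity $C$), and the corresponding geodesic plane $P$ in $N_R$ is the image of $\tilde P$; $C$ is called a boundary circle of $P$. A geodesic plane $P$ is exotic if $P^*=P\cap N_R^*$ is nonempty and closed in $N_R^*$ but $P$ is not closed in $N_R$; an exotic circle is a boundary circle of an exotic plane.
   Formalization: Adds that the group is not Fuchsian (for a regular hyperbolic quadrilateral C is the limit circle and P is closed), that R lies on one side of each circle carrying a side, and that the common perpendiculars ξ̃, η̃ of opposite planes exist. *)

(* Defs.v *)
From HB Require Import structures.
From mathcomp Require Import all_boot all_order all_algebra.
From mathcomp Require Import generic_quotient complex.
From mathcomp Require Import all_classical all_reals all_analysis.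

Set Implicit Arguments.
Unset Strict Implicit.
Unset Printing Implicit Defensive.

Import Order.TTheory GRing.Theory Num.Theory.
Import numFieldNormedType.Exports.

Local Open Scope classical_set_scope.
Local Open Scope ring_scope.
Local Open Scope quotient_scope.

(** Hyperbolic space is the upper half-space {(x, y, t) | t > 0}; its sphere at
    infinity is the extended complex plane, (x, y) standing for x + iy. *)

Section Space.
Variable K : realType.

Definition Chat : Type := one_point_compactification (K * K)%type.
HB.instance Definition _ := Topological.on Chat.

Definition upper : set (K * K * K)%type := [set w | 0 < w.2].

Definition H3 : Type := set_type upper.
HB.instance Definition _ := Choice.on H3.
HB.instance Definition _ := Topological.on H3.

(** The one-point compactification of R^3, in which the union of [H3] and
    [Chat] is a closed ball. *)
Definition S3 : Type := one_point_compactification (K * K * K)%type.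
HB.instance Definition _ := Topological.on S3.

Definition H3_in_S3 (w : H3) : S3 := Some (set_val w).
Definition Chat_in_S3 (z : Chat) : S3 :=
  if z is Some u then Some (u, 0) else None.

(** The locus  A |z|^2 + 2 (b1 x + b2 y) + D = 0  in the extended plane: a
    Euclidean line together with infinity if A = 0, a Euclidean circle
    otherwise.  The sign of the equation orients it: its positive side is one
    of the two discs that it bounds. *)
Record circle := Circle {
  cA : K;
  cb : K * K;
  cD : K;
  disc_gt0 : 0 < cb.1 ^+ 2 + cb.2 ^+ 2 - cA * cD
}.

Definition disc (C : circle) : K := (cb C).1 ^+ 2 + (cb C).2 ^+ 2 - cA C * cD C.

Definition cform (C : circle) (w : K * K * K) : K :=
  cA C * (w.1.1 ^+ 2 + w.1.2 ^+ 2 + w.2 ^+ 2)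
  + 2 * ((cb C).1 * w.1.1 + (cb C).2 * w.1.2) + cD C.

(** At infinity the sign is that of the leading coefficient. *)
Definition cform_Chat (C : circle) (z : Chat) : K :=
  if z is Some u then cform C (u, 0) else cA C.

Definition on_circle (C : circle) : set Chat := [set z | cform_Chat C z = 0].
Definition side (C : circle) : set Chat := [set z | 0 < cform_Chat C z].

(** The geodesic plane bounded by [C]. *)
Definition hplane (C : circle) : set H3 := [set w | cform C (set_val w) = 0].

(** Reflection.  If A <> 0, the centre is c = - b / A and the squared radius is
    r2 = disc / A^2, and the formula is  w |-> c + r2 (w - c) / |w - c|^2,  as
    [refl_den C w] = |A w + b|^2 = disc + A * cform C w.  If A = 0 it is the
    Euclidean reflection across the (vertical plane over the) line. *)
Definition refl_den (C : circle) (w : K * K * K) : K :=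
  (cA C * w.1.1 + (cb C).1) ^+ 2 + (cA C * w.1.2 + (cb C).2) ^+ 2
  + (cA C * w.2) ^+ 2.

Definition refl3 (C : circle) (w : K * K * K) : K * K * K :=
  ((disc C * w.1.1 - cform C w * (cb C).1) / refl_den C w,
   (disc C * w.1.2 - cform C w * (cb C).2) / refl_den C w,
   disc C * w.2 / refl_den C w).

Definition refl_Chat (C : circle) (z : Chat) : Chat :=
  match z with
  | Some u => if refl_den C (u, 0) == 0 then None else Some (refl3 C (u, 0)).1
  | None => if cA C == 0 then None
            else Some (- (cb C).1 / cA C, - (cb C).2 / cA C)
  end.

Lemma refl3_upper (C : circle) (w : H3) : refl3 C (set_val w) \in upper.
Proof.
rewrite inE /upper /=.
have : 0 < (set_val w).2 by exact: (set_valP w).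
move: (set_val w) => [[x y] t] /= t0.
have d0 : 0 < disc C := disc_gt0 C.
apply: divr_gt0; first exact: mulr_gt0.
rewrite /refl_den /=.
have [A0|A0] := eqVneq (cA C) 0.
  by move: d0; rewrite /disc A0 !mul0r !add0r subr0 expr0n /= addr0.
by rewrite ltr_wpDl ?addr_ge0 ?sqr_ge0// exprn_even_gt0//= mulf_neq0// gt_eqF.
Qed.

Definition refl_H3 (C : circle) (w : H3) : H3 := SigSub (refl3_upper C w).

(** The complete geodesic with end points [p] and [q]: a vertical half-line, or
    a half-circle of diameter [p, q] in a vertical plane. *)
Definition geodesic (p q : Chat) : set H3 := [set w |
  let: (x, y, t) := set_val w in
  match p, q with
  | Some (p1, p2), Some (q1, q2) =>
      (x - p1) * (q2 - p2) = (y - p2) * (q1 - p1) /\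
      (x - p1) * (x - q1) + (y - p2) * (y - q2) + t ^+ 2 = 0
  | Some (p1, p2), None => x = p1 /\ y = p2
  | None, Some (q1, q2) => x = q1 /\ y = q2
  | None, None => False
  end].

(** A tangent vector to [geodesic p q] at its point [w]; in the first case it is
    the vector of the vertical plane over [p, q] that is orthogonal to the
    radius from the midpoint of [p, q]. *)
Definition geodesic_tangent (p q : Chat) (w : H3) : K * K * K :=
  let: (x, y, t) := set_val w in
  match p, q with
  | Some (p1, p2), Some (q1, q2) =>
      (t * (q1 - p1), t * (q2 - p2),
       - ((x - (p1 + q1) / 2) * (q1 - p1) + (y - (p2 + q2) / 2) * (q2 - p2)))
  | _, _ => (0, 0, 1)
  end.

(** Half the Euclidean gradient of [cform C], normal to [hplane C]. *)
Definition hplane_normal (C : circle) (w : H3) : K * K * K :=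
  let: (x, y, t) := set_val w in
  (cA C * x + (cb C).1, cA C * y + (cb C).2, cA C * t).

(** The upper half-space model is conformal, so hyperbolic orthogonality is
    Euclidean orthogonality. *)
Definition geodesic_perp (p q : Chat) (C : circle) : Prop :=
  exists w : H3, [/\ geodesic p q w, hplane C w &
    exists a : K, geodesic_tangent p q w =
      (a * (hplane_normal C w).1.1, a * (hplane_normal C w).1.2,
       a * (hplane_normal C w).2)].

(** Elements of PSL(2, C), as maps of the sphere at infinity. *)
Definition moebius (a b c d : K[i]) (z : Chat) : Chat :=
  let fin (u : K[i]) : Chat := Some (complex.Re u, complex.Im u) in
  match z with
  | Some (x, y) => let u := (x +i* y)%C in
      if c * u + d == 0 then None else fin ((a * u + b) / (c * u + d))
  | None => if c == 0 then None else fin (a / c)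
  end.

Definition is_moebius (g : Chat -> Chat) : Prop :=
  exists a b c d : K[i], a * d - b * c = 1 /\ g =1 moebius a b c d.

Definition repelling_fixpoint (g : Chat -> Chat) (p : Chat) : Prop :=
  g p = p /\ exists p' : Chat, [/\ p' <> p, g p' = p' &
    forall z, z <> p -> (fun k => iter k g z) @ \oo --> p'].

(** Inward unit normal, at a point [z] of [C], to the positive side of [C].  The
    gradient has norm sqrt (disc C) along [C].  If infinity is on [C], then C
    is a line, and the normal is constant. *)
Definition unit_normal (C : circle) (z : Chat) : K * K :=
  let: (x, y) := (if z is Some u then u else (0, 0)) in
  ((cA C * x + (cb C).1) / Num.sqrt (disc C),
   (cA C * y + (cb C).2) / Num.sqrt (disc C)).

(** Angle at [z] of the sector [side C `&` side C'], i.e. pi minus the angle of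
    the inward normals.  At infinity (two lines) it equals the angle of the same
    sector at the finite point of intersection. *)
Definition sector_angle (C C' : circle) (z : Chat) : K :=
  let N := unit_normal C z in let N' := unit_normal C' z in
  acos (- (N.1 * N'.1 + N.2 * N'.2)).

(** The open set [Q] has at [z] a corner bounded by [C] and [C'] with interior
    angle [theta], and lies on their positive sides there. *)
Definition interior_angle (Q : set Chat) (C C' : circle) (z : Chat) (theta : K) :=
  [/\ on_circle C z, on_circle C' z,
      \forall u \near z, Q u <-> side C u /\ side C' u &
      sector_angle C C' z = theta].

(** [Q] is an (open) quadrilateral whose i-th side is the arc [s i] of the circle
    [C i], from the vertex [v i] to the vertex [v (i + 1)] (indices mod 4), and
    whose interior angles all equal [theta].  The orientations of the circles
    are chosen so that [Q] is locally on their positive sides. *)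
Definition is_quadrilateral (Q : set Chat) (C : 'I_4 -> circle) (theta : K) : Prop :=
  exists (v : 'I_4 -> Chat) (s : 'I_4 -> K -> Chat),
  [/\ open Q, connected Q, closure Q `\` Q = \bigcup_i (s i @` `[0, 1]) &
   forall i,
    [/\ {within `[0, 1], continuous (s i)}, {in `[0, 1] &, injective (s i)},
        s i @` `[0, 1] `<=` on_circle (C i) & s i 0 = v i /\ s i 1 = v (i + 1)] /\
    [/\ s i @` `[0, 1] `&` s (i + 1) @` `[0, 1] = [set v (i + 1)],
        s i @` `[0, 1] `&` s (i + 2) @` `[0, 1] = set0 &
        interior_angle Q (C i) (C (i + 1)) (v (i + 1)) theta]].

End Space.

Arguments H3_in_S3 {K} w.
Arguments Chat_in_S3 {K} z.

Section Orbifold.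
Variables (K : realType) (C : 'I_4 -> circle K).

(** Elements of the group generated by the reflections across the [C i] are
    represented by words; the reflections are involutions, so that no inverses
    are needed. *)
Definition act_H3 (g : seq 'I_4) (w : H3 K) : H3 K :=
  foldr (fun i => refl_H3 (C i)) w g.
Definition act_Chat (g : seq 'I_4) (z : Chat K) : Chat K :=
  foldr (fun i => refl_Chat (C i)) z g.

(** The orientation preserving elements are those in PSL(2, C). *)
Definition Gamma : set (seq 'I_4) := [set g | is_moebius (act_Chat g)].

Definition Gamma_orbit (w : H3 K) : set (H3 K) := [set act_H3 g w | g in Gamma].

Definition limit_set : set (Chat K) := [set z |
  exists w, closure (H3_in_S3 @` Gamma_orbit w) (Chat_in_S3 z)].

(** The intersection of the closed half-spaces whose closures at infinity
    contain the limit set. *)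
Definition hull : set (H3 K) := [set w | forall B : circle K,
  (forall z, limit_set z -> 0 <= cform_Chat B z) -> 0 <= cform B (set_val w)].

(** [Gamma] preserves a round circle. *)
Definition fuchsian : Prop := exists B : circle K, forall g, Gamma g ->
  act_Chat g @` on_circle B = on_circle B.

Definition same_orbit (w w' : H3 K) : bool := `[< Gamma_orbit w = Gamma_orbit w' >].

Lemma same_orbit_refl : reflexive same_orbit.
Proof. by move=> w; apply/asboolP. Qed.
Lemma same_orbit_sym : symmetric same_orbit.
Proof. by move=> w w'; apply/asboolP/asboolP => ->. Qed.
Lemma same_orbit_trans : transitive same_orbit.
Proof. by move=> w' w w'' /asboolP e /asboolP e'; apply/asboolP; rewrite e. Qed.

Definition same_orbit_equiv : equiv_rel (H3 K) :=
  EquivRel same_orbit same_orbit_refl same_orbit_sym same_orbit_trans.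

Definition orbifold : Type := quotient_topology {eq_quot same_orbit_equiv}.
HB.instance Definition _ := Topological.on orbifold.

Definition to_orbifold (w : H3 K) : orbifold := \pi_{eq_quot same_orbit_equiv} w.

Definition convex_core : set orbifold := to_orbifold @` hull.
Definition Nstar : set orbifold := interior convex_core.

Definition image_plane (B : circle K) : set orbifold := to_orbifold @` hplane B.

Definition relatively_closed (T : topologicalType) (Y A : set T) : Prop :=
  exists2 F : set T, closed F & A = F `&` Y.

Definition exotic (B : circle K) : Prop :=
  [/\ image_plane B `&` Nstar !=set0,
      relatively_closed Nstar (image_plane B `&` Nstar) &
      ~ closed (image_plane B)].

End Orbifold.

(* Main.v *)
(** Circles are unit spacelike vectors of Lorentz space, the sides of [R] being the
    simple roots [v i] of a reflection group.  By Tits' argument, a reduced word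
    sends a simple root to a positive one unless the reflection in it shortens the word.
    Hence [lf x lam <= lf (act g x) lam] for all [g] if [x] is in the chamber and
    [lam] is antidominant, i.e. [lf lam (v i) <= 0] for all [i]; so every translate
    of the half-space of [lam] contains the limit set.

    The plane of [q, q', p] has the normal [b = ct g + st p], where the antidominant
    vector [g] is the normal of the plane through the axis of eta that is
    orthogonal to the common perpendicular of the axes of xi and eta.  Powers of
    eta contract [p], so translates of [b] tend to a multiple of [g].  They are
    countably many and none of them is proportional to [g], so that they do not
    cover the plane of [g], and the image of the plane is not closed.  Above [N_R^*],
    the distance to the translates of the plane of [g] is locally bounded below.  The
    reflections across [C_1] and [C_3] preserve the plane of [b], and move any of its
    points between [C_1] and [C_3]; there, in the hull and away from the plane of [g],
    it is bounded, so that discreteness leaves finitely many translates near each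
    point. *)

Require Import Defs.
From mathcomp Require Import all_boot all_order all_algebra.
From mathcomp Require Import generic_quotient complex.
From mathcomp Require Import all_classical all_reals all_analysis.
From mathcomp Require Import ring lra.

Set Implicit Arguments.
Unset Strict Implicit.
Unset Printing Implicit Defensive.

Import Order.TTheory GRing.Theory Num.Theory.
Import numFieldNormedType.Exports.

Local Open Scope classical_set_scope.
Local Open Scope ring_scope.

(** The limit set is never determined. From outside, the hull is controlled only by the inequalities
    of antidominant vectors; from inside, one tetrahedron on four explicit limit points is just
    enough to put an interior point on the plane of [fb]. Discreteness is quantitative and does not
    come from a polyhedron theorem: a positive root has norm 1, which bounds its coefficient sum
    below, so each letter of a reduced word lowers [lf (act w N) N] by a fixed amount, and a bound
    on this pairing bounds the word length. The linear arguments use the whole reflection group;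
    words of even length matter only for the limit set and the orbifold. That the group is not
    Fuchsian enters as [fst_ > 0]: if the axes of xi and eta met, some circle orthogonal to all four
    sides would be invariant. The same number is the constant of separation, as every translate of
    [N] pairs with [fg] to at least [fst_]. *)

Section ReflectionGroup.

(** * Linear reflection groups: positive roots, dominance and growth *)

Variables (K : realType) (V : lmodType K) (I : finType).
Variables (bf : V -> V -> K) (v : I -> V).
Hypothesis bfC : forall x y, bf x y = bf y x.
Hypothesis bfP : forall a x y z, bf (a *: x + y) z = a * bf x z + bf y z.

Lemma bfDl x y z : bf (x + y) z = bf x z + bf y z.
Proof. by rewrite -[x]scale1r bfP mul1r scale1r. Qed.
Lemma bf0l z : bf 0 z = 0.
Proof.
by have := bfDl 0 0 z; rewrite addr0 => /eqP; rewrite -subr_eq0 opprD addNKr oppr_eq0 => /eqP.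
Qed.
Lemma bfZl a x z : bf (a *: x) z = a * bf x z.
Proof. by rewrite -[a *: x]addr0 bfP bf0l addr0. Qed.
Lemma bfNl x z : bf (- x) z = - bf x z.
Proof. by rewrite -scaleN1r bfZl mulN1r. Qed.
Lemma bfBl x y z : bf (x - y) z = bf x z - bf y z.
Proof. by rewrite bfDl bfNl. Qed.
Lemma bfDr x y z : bf z (x + y) = bf z x + bf z y.
Proof. by rewrite bfC bfDl !(bfC z). Qed.
Lemma bfZr a x z : bf z (a *: x) = a * bf z x.
Proof. by rewrite bfC bfZl (bfC z). Qed.
Lemma bfNr x z : bf z (- x) = - bf z x.
Proof. by rewrite bfC bfNl (bfC z). Qed.
Lemma bfBr x y z : bf z (x - y) = bf z x - bf z y.
Proof. by rewrite bfDr bfNr. Qed.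
Lemma bf_suml (F : I -> V) z : bf (\sum_i F i) z = \sum_i bf (F i) z.
Proof.
elim/big_rec2: _ => [|i a b _ <-]; first exact: bf0l.
by rewrite bfDl.
Qed.

Hypothesis vv1 : forall i, bf (v i) (v i) = 1.

Definition reflv (i : I) (x : V) : V := x - (2 * bf x (v i)) *: v i.
Definition actv (w : seq I) (x : V) : V := foldr reflv x w.

Lemma actv_cat w w' x : actv (w ++ w') x = actv w (actv w' x).
Proof. by rewrite /actv foldr_cat. Qed.
Lemma actv_rcons w i x : actv (rcons w i) x = actv w (reflv i x).
Proof. by rewrite -cats1 actv_cat. Qed.

Lemma reflvP i a x y : reflv i (a *: x + y) = a *: reflv i x + reflv i y.
Proof.
rewrite /reflv bfP scalerBr scalerA mulrDr scalerDl mulrCA.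
by rewrite opprD addrACA.
Qed.
Lemma actvP w a x y : actv w (a *: x + y) = a *: actv w x + actv w y.
Proof. by elim: w => //= i w ->; rewrite reflvP. Qed.
Lemma actvD w x y : actv w (x + y) = actv w x + actv w y.
Proof. by rewrite -[x]scale1r actvP !scale1r. Qed.
Lemma actv0 w : actv w 0 = 0.
Proof.
by have := actvD w 0 0; rewrite addr0 => /eqP; rewrite -subr_eq0 opprD addNKr oppr_eq0 => /eqP.
Qed.
Lemma actvZ w a x : actv w (a *: x) = a *: actv w x.
Proof. by rewrite -[a *: x]addr0 actvP actv0 addr0. Qed.
Lemma reflvZ i a x : reflv i (a *: x) = a *: reflv i x.
Proof. exact: (actvZ [:: i]). Qed.
Lemma actvN w x : actv w (- x) = - actv w x.
Proof. by rewrite -scaleN1r actvZ scaleN1r. Qed.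
Lemma actvB w x y : actv w (x - y) = actv w x - actv w y.
Proof. by rewrite actvD actvN. Qed.

Lemma reflv_self i : reflv i (v i) = - v i.
Proof. by rewrite /reflv vv1 mulr1 scaler_nat mulr2n opprD addNKr. Qed.
Lemma reflvK i x : reflv i (reflv i x) = x.
Proof.
rewrite /reflv bfBl bfZl vv1 -addrA -opprD -scalerDl.
have -> : 2 * bf x (v i) + 2 * (bf x (v i) - 2 * bf x (v i) * 1) = 0 by ring.
by rewrite scale0r subr0.
Qed.
Lemma bf_reflv i x y : bf (reflv i x) (reflv i y) = bf x y.
Proof.
rewrite /reflv !(bfBl, bfBr, bfZl, bfZr) vv1 (bfC (v i) y); ring.
Qed.
Lemma bf_actv w x y : bf (actv w x) (actv w y) = bf x y.
Proof. by elim: w => //= i w <-; rewrite bf_reflv. Qed.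
Lemma actv_revK w x : actv (rev w) (actv w x) = x.
Proof. by elim: w => //= i w IH; rewrite rev_cons actv_rcons reflvK. Qed.
Lemma actvK_rev w x : actv w (actv (rev w) x) = x.
Proof. by rewrite -{1}(revK w) actv_revK. Qed.
Lemma bf_actvl w x y : bf (actv w x) y = bf x (actv (rev w) y).
Proof. by rewrite -(bf_actv (rev w)) actv_revK. Qed.

Definition poscone (x : V) : Prop :=
  exists2 c : I -> K, (forall i, 0 <= c i) & x = \sum_i c i *: v i.

Lemma poscone_root i : poscone (v i).
Proof.
exists (fun j => (j == i)%:R) => [j|]; first by case: eqP.
by rewrite (bigD1 i)//= eqxx scale1r big1 ?addr0// => j /negbTE ->; rewrite scale0r.
Qed.
Lemma poscone_comb a b x y :
  0 <= a -> 0 <= b -> poscone x -> poscone y -> poscone (a *: x + b *: y).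
Proof.
move=> a0 b0 [c c0 ->] [d d0 ->]; exists (fun i => a * c i + b * d i).
  by move=> i; rewrite addr_ge0// mulr_ge0.
rewrite !scaler_sumr -big_split; apply: eq_bigr => i _ /=.
by rewrite scalerDl !scalerA.
Qed.
Lemma bf_poscone x y : (forall i, 0 <= bf x (v i)) -> poscone y -> 0 <= bf x y.
Proof.
move=> xv [c c0 ->]; rewrite bfC bf_suml sumr_ge0// => i _.
by rewrite bfZl bfC mulr_ge0.
Qed.

(** Words are compared through their action on [V], so that no presentation of the group has to be
    established. *)
Definition reduced (w : seq I) : Prop :=
  forall w', actv w' =1 actv w -> (size w <= size w')%N.

Lemma reduced_ex w : exists2 w', reduced w' & actv w' =1 actv w.
Proof.
have [m] := ubnP (size w); elim: m w => // m IH w /ltnSE wm.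
have [rw|] := pselect (reduced w); first by exists w.
move/existsNP => [w' /not_implyP[w'w /negP]]; rewrite -ltnNge => ww'.
have [u ru uw'] := IH w' (leq_trans ww' wm).
by exists u => // x; rewrite uw' w'w.
Qed.

Lemma reduced_catl u w : reduced (u ++ w) -> reduced u.
Proof.
move=> uw u' u'u; rewrite -(leq_add2r (size w)) -!size_cat.
by apply: uw => x; rewrite !actv_cat u'u.
Qed.
Lemma reduced_catr u w : reduced (u ++ w) -> reduced w.
Proof.
move=> uw u' u'u; rewrite -(leq_add2l (size u)) -!size_cat.
by apply: uw => x; rewrite !actv_cat u'u.
Qed.

Lemma reduced_rev w : reduced w -> reduced (rev w).
Proof.
move=> rw u uw; rewrite size_rev -(size_rev u); apply: rw => x.
by rewrite -{1}(actv_revK w x) -uw actv_revK.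
Qed.

Lemma reduced_dup u i w : ~ reduced (u ++ [:: i, i & w]).
Proof.
move=> /reduced_catr /(_ w) H.
suff : (size [:: i, i & w] <= size w)%N by rewrite /= ltnNge leqnSn.
by apply: H => x /=; rewrite reflvK.
Qed.

(** The last letter, which acts first, is [t]. *)
Fixpoint altw (s t : I) (k : nat) : seq I :=
  if k is k'.+1 then (if odd k' then s else t) :: altw s t k' else [::].

Lemma size_altw s t k : size (altw s t k) = k.
Proof. by elim: k => //= k ->. Qed.

Lemma altw_add s t m k : exists2 u, altw s t (m + k) = u ++ altw s t k & size u = m.
Proof.
elim: m => [|m [u uE su]]; first by exists [::].
by exists ((if odd (m + k) then s else t) :: u); rewrite /= ?uE ?su.
Qed.

Lemma altw_rcons s t k : altw s t k.+1 = rcons (altw t s k) t.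
Proof. by elim: k => //= k <- /=; case: odd. Qed.

Lemma dihedral_word s t w :
  all [in [:: s; t]] w -> reduced w ->
  w = altw s t (size w) \/ w = altw t s (size w).
Proof.
elim: w => [|i w IH]; first by left.
move=> /= /andP[ist wst] riw.
have cons_alt s' t' : i \in [:: s'; t'] -> w = altw s' t' (size w) ->
    (i :: w = altw s' t' (size w).+1) \/ (i :: w = altw t' s' (size w).+1).
  move=> + ww; move: (size w) ww riw => k -> riw.
  rewrite !inE => /orP[]/eqP iE; subst i.
    case: k riw => [|k]/= riw; first by right.
    left; case: (odd k) riw => //= riw.
    by have := @reduced_dup [::] s' (altw s' t' k).
  case: k riw => [|k]/= riw; first by left.
  left; case: (odd k) riw => //= riw.
  by have := @reduced_dup [::] t' (altw s' t' k).
have [] := IH wst (@reduced_catr [:: i] _ riw).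
  exact: cons_alt.
by move=> /cons_alt; rewrite !inE orbC; rewrite !inE in ist => /(_ ist)[]; [right|left].
Qed.

(** Chebyshev polynomials of the second kind at [c], shifted by one. *)
Fixpoint cheb (c : K) (k : nat) : K :=
  if k is k1.+1 then if k1 is k2.+1 then 2 * c * cheb c k1 - cheb c k2 else 1 else 0.

Lemma chebSS c k : cheb c k.+2 = 2 * c * cheb c k.+1 - cheb c k.
Proof. by []. Qed.

Lemma cheb_sin (x : K) k : cheb (cos x) k * sin x = sin (k%:R * x).
Proof.
suff : cheb (cos x) k * sin x = sin (k%:R * x) /\
       cheb (cos x) k.+1 * sin x = sin (k.+1%:R * x) by case.
elim: k => [|k [IH1 IH2]]; first by rewrite /= !mul0r sin0 !mul1r.
split=> //; rewrite chebSS mulrBl IH1 -(mulrA (2 * cos x)) IH2.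
have -> : k.+2%:R * x = k.+1%:R * x + x by rewrite -[k.+2]addn1 natrD mulrDl mul1r.
have -> : k%:R * x = k.+1%:R * x - x by rewrite -[k.+1]addn1 natrD mulrDl mul1r addrK.
rewrite sinB sinD; ring.
Qed.

Lemma cheb_ge1 c k : 1 <= c -> 0 <= cheb c k.
Proof.
move=> c1; suff : 0 <= cheb c k <= cheb c k.+1 by case/andP.
elim: k => [|k /andP[IH1 IH2]]; first by rewrite /= lexx ler01.
have k1 : 0 <= cheb c k.+1 by exact: le_trans IH2.
rewrite k1 chebSS; have : cheb c k.+1 <= c * cheb c k.+1 by rewrite ler_peMl.
by move: (cheb c k) (cheb c k.+1) IH2 k1 => x y xy y0 ?; lra.
Qed.

(** The recursion of [cheb] is the one obeyed by the coefficients when two reflections alternate on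
    the span of their roots. *)
Lemma altw_act s t c k : bf (v s) (v t) = - c ->
  actv (altw s t k) (v s) =
    cheb c k.+1 *: v (if odd k then t else s) + cheb c k *: v (if odd k then s else t).
Proof.
move=> st; have ts : bf (v t) (v s) = - c by rewrite bfC.
elim: k => [|k IH]; first by rewrite /= scale1r scale0r addr0.
rewrite [altw _ _ _]/= [LHS]/= IH reflvP reflvZ.
rewrite oddS chebSS.
case: (odd k) => /=; rewrite reflv_self /reflv ?st ?ts scalerBr scalerA scalerN -scaleNr
   -addrA addrC -scaleNr -!scalerDl; congr (_ *: _ + _ *: _); ring.
Qed.

Variable n : nat.
Hypothesis n_gt1 : (1 < n)%N.
Hypothesis gram : forall i j, i != j ->
  bf (v i) (v j) = - cos (pi / n%:R) \/ bf (v i) (v j) <= -1.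

Let c := cos (pi / n%:R : K).
Let sn_gt0 : 0 < sin (pi / n%:R : K).
Proof.
apply: sin_gt0_pi; rewrite divr_gt0 ?pi_gt0 ?ltr0n ?(ltnW n_gt1)//=.
by rewrite ltr_pdivrMr ?ltr0n ?(ltnW n_gt1)// ltr_pMr ?pi_gt0// ltr1n.
Qed.
Let c2_lt1 : c ^+ 2 < 1.
Proof. by rewrite -(cos2Dsin2 (pi / n%:R)) ltrDl exprn_gt0. Qed.
Let n_neq0 : (n%:R : K) != 0.
Proof. by rewrite pnatr_eq0 -lt0n ltnW. Qed.

Lemma cheb_ge0 k : (k <= n)%N -> 0 <= cheb c k.
Proof.
move=> kn; rewrite -(pmulr_lge0 _ sn_gt0) cheb_sin mulrCA; apply: sin_ge0_pi.
rewrite mulr_ge0 ?pi_ge0 ?divr_ge0//= ler_piMr ?pi_ge0//.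
by rewrite ler_pdivrMr ?ltr0n ?(ltnW n_gt1)// mul1r ler_nat.
Qed.
Let cheb_n : cheb c n = 0.
Proof.
apply/eqP; rewrite -(mulIr_eq0 _ (mulIf (lt0r_neq0 sn_gt0))) cheb_sin.
by rewrite mulrC divfK// sinpi.
Qed.
Let cheb_Sn : cheb c n.+1 = -1.
Proof.
apply: (mulIf (lt0r_neq0 sn_gt0)); rewrite cheb_sin -addn1 natrD mulrDl mul1r.
by rewrite (mulrC n%:R) divfK// addrC sinDpi mulN1r.
Qed.
Let cheb_pn : cheb c n.-1 = 1.
Proof.
have := cheb_Sn; case: (n) cheb_n n_gt1 => // m /= cm _.
by rewrite cm mulr0 sub0r => /oppr_inj.
Qed.

(** On the two roots both words agree by the values of [cheb] at [n - 1], [n] and [n + 1]. They fix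
    the orthogonal of the roots, which is a complement of their span because the Gram determinant
    [1 - c ^+ 2] is positive. *)
Lemma altw_braid s t : bf (v s) (v t) = - c -> actv (altw s t n) =1 actv (altw t s n).
Proof.
move=> st x; have ts : bf (v t) (v s) = - c by rewrite bfC.
have act_self s' t' : bf (v s') (v t') = - c ->
    actv (altw t' s' n) (v s') = actv (altw s' t' n) (v s').
  move=> st'; have ts' : bf (v t') (v s') = - c by rewrite bfC.
  rewrite (altw_act n st') cheb_Sn cheb_n scale0r addr0 scaleN1r.
  have -> : n = n.-1.+1 by rewrite prednK// ltnW.
  rewrite altw_rcons actv_rcons reflv_self actvN (altw_act _ st').
  rewrite prednK ?(ltnW n_gt1)// cheb_n cheb_pn scale0r add0r scale1r.
  by rewrite -{2}(prednK (ltnW n_gt1)) oddS; case: odd.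
pose d := 1 - c ^+ 2; have d0 : d != 0 by rewrite lt0r_neq0// subr_gt0.
(* Solutions of the 2 by 2 Gram system, so that [y] is orthogonal to both roots. *)
pose a := (bf x (v s) + c * bf x (v t)) / d; pose b := (bf x (v t) + c * bf x (v s)) / d.
pose y := x - a *: v s - b *: v t.
have ys : bf y (v s) = 0.
  by rewrite /y !(bfBl, bfZl) vv1 ts /a /b; move: d0; rewrite /d => d0; field.
have yt : bf y (v t) = 0.
  by rewrite /y !(bfBl, bfZl) vv1 st /a /b; move: d0; rewrite /d => d0; field.
have -> : x = b *: v t + (a *: v s + y).
  by rewrite /y (addrAC x) !subrKC.
rewrite !actvP (act_self _ _ ts) (act_self _ _ st).
suff act_y s' t' k : bf y (v s') = 0 -> bf y (v t') = 0 -> actv (altw s' t' k) y = y.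
  by rewrite !act_y.
move=> ys' yt'; elim: k => //= k ->.
by case: odd; rewrite /reflv ?ys' ?yt' mulr0 scale0r subr0.
Qed.

(** Tits' argument: split [w] as [u ++ w'] with [w'] a word in [s] and the last
    letter [t] of [w], and [u] as short as possible; then [u] sends both simple
    roots [v s] and [v t] to positive roots by induction. *)
Lemma root_pos w s : reduced w ->
  (forall w', actv w' =1 actv (rcons w s) -> (size w <= size w')%N) ->
  poscone (actv w (v s)).
Proof.
have [m] := ubnP (size w); elim: m w s => // m IH w s /ltnSE wm rw rws.
case: (lastP w) wm rw rws => [|w0 t] wm rw rws; first exact: poscone_root.
have ts : t != s.
  apply/eqP => ts; suff /rws : actv w0 =1 actv (rcons (rcons w0 t) s).
    by rewrite size_rcons ltnn.
  by move=> x; rewrite !actv_rcons ts reflvK.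
pose P k := `[< exists u w', [/\ size u = k, (size u + size w' = size (rcons w0 t))%N,
  all [in [:: s; t]] w' & actv (u ++ w') =1 actv (rcons w0 t)] >].
have exP : exists k, P k.
  exists (size w0); apply/asboolP; exists w0, [:: t]; split; rewrite ?size_rcons ?addn1//=.
    by rewrite !inE eqxx orbT.
  by rewrite cats1.
case: (ex_minnP exP) => k /asboolP[u [w' [uk sz w'st uw']]] kmin.
have ruw' : reduced (u ++ w').
  by move=> z zuw'; rewrite size_cat sz; apply: rw => x; rewrite zuw' uw'.
have ru := reduced_catl ruw'; have rw' := reduced_catr ruw'.
have ku : (k <= size w0)%N.
  apply: kmin; apply/asboolP; exists w0, [:: t]; split; rewrite ?size_rcons ?addn1//=.
    by rewrite !inE eqxx orbT.
  by rewrite cats1.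
have um : (size u < m)%N by rewrite uk (leq_ltn_trans ku)// -(size_rcons w0 t).
(* If a word [z] shorter than [u] acted as [u] followed by [r], then moving [r] into the dihedral
   part would give a splitting with left factor [z], against the minimality of [k]. *)
have pos r : r \in [:: s; t] -> poscone (actv u (v r)).
  move=> rst; apply: IH => // z zur; rewrite leqNgt; apply/negP => zu.
  have zw' : actv (z ++ r :: w') =1 actv (rcons w0 t).
    move=> x; rewrite -uw' !actv_cat /= zur actv_rcons reflvK//.
  have := rw _ zw'; rewrite -sz size_cat /= addnS -addSn leq_add2r => uz.
  have : (k <= size z)%N.
    apply: kmin; apply/asboolP; exists z, (r :: w'); split => //=; last by rewrite rst.
    by rewrite addnS -addSn -sz; congr (_ + _)%N; apply/eqP; rewrite eqn_leq zu uz.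
  by rewrite leqNgt -uk zu.
have act_s : actv (rcons w0 t) (v s) = actv u (actv w' (v s)) by rewrite -uw' actv_cat.
rewrite act_s.
have short z : actv z =1 actv (rcons w' s) -> (size w' <= size z)%N.
  move=> zw'; rewrite -(leq_add2l (size u)) sz -size_cat; apply: rws => x.
  by rewrite actv_cat zw' (actv_rcons w') (actv_rcons (rcons w0 t)) -uw' actv_cat.
(* The other alternation ends in [s], and appending [s] would shorten it, against [short]. *)
have w'E : w' = altw s t (size w').
  have [//|w'E] := dihedral_word w'st rw'.
  case: (size w') w'E short => [->//|j] ->; rewrite altw_rcons => short.
  suff /short : actv (altw s t j) =1 actv (rcons (rcons (altw s t j) s) s).
    by rewrite size_altw ltnn.
  by move=> x; rewrite !actv_rcons reflvK.
have pos_alt a b r r' : 0 <= a -> 0 <= b -> r \in [:: s; t] -> r' \in [:: s; t] ->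
    poscone (actv u (a *: v r + b *: v r')).
  by move=> a0 b0 /pos r1 /pos r2; rewrite actvD !actvZ; exact: poscone_comb.
have inst r (e : bool) : (if e then r else s) \in [:: s; r].
  by rewrite !inE; case: e; rewrite eqxx ?orbT.
have inst' r (e : bool) : (if e then s else r) \in [:: s; r].
  by rewrite !inE; case: e; rewrite eqxx ?orbT.
rewrite eq_sym in ts.
have [st|st] := gram ts; rewrite w'E.
  (* Otherwise the last [n] letters can be replaced, by the braid relation, with a word ending in
     [s], and appending [s] would shorten [w']. Below length [n] the coefficients are quotients of
     sines, hence nonnegative. *)
  have w'n : (size w' < n)%N.
    rewrite ltnNge; apply/negP => nw'.
    have [u0 u0E su0] := altw_add s t (size w' - n) n.
    rewrite subnK// -w'E in u0E.
    suff : actv (u0 ++ altw s t n.-1) =1 actv (rcons w' s).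
      move=> /short; rewrite size_cat size_altw su0 leqNgt -ltnS -addnS.
      by rewrite prednK ?subnK ?leqnn// ltnW.
    move=> x; rewrite actv_rcons {1}u0E !actv_cat (altw_braid st).
    by have := altw_rcons t s n.-1; rewrite prednK ?(ltnW n_gt1)// => ->; rewrite actv_rcons reflvK.
  by rewrite (altw_act _ st); apply: pos_alt => //; apply: cheb_ge0 => //; exact: ltnW.
have st' : bf (v s) (v t) = - - bf (v s) (v t) by rewrite opprK.
rewrite (altw_act _ st'); apply: pos_alt => //; apply: cheb_ge1; lra.
Qed.

Lemma reduced_rcons_pos w s : reduced (rcons w s) -> poscone (actv w (v s)).
Proof.
move=> rws; apply: root_pos; first by rewrite -cats1 in rws; exact: reduced_catl rws.
by move=> w' /rws; rewrite size_rcons => /ltnW.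
Qed.

(** After the word is moved to [lam], each letter [s] subtracts a multiple of the positive root
    [actv u (v s)] by the nonpositive factor [2 * bf lam (v s)]. As positive roots pair
    nonnegatively with [x], the pairing can only grow. *)
Lemma bf_act_antidominant w x lam : (forall i, 0 <= bf x (v i)) ->
  (forall i, bf lam (v i) <= 0) -> bf x lam <= bf (actv w x) lam.
Proof.
move=> xv lv; rewrite bf_actvl; have [u ru /(_ lam) <-] := reduced_ex (rev w).
elim/last_ind: u ru => // u s IH rus.
have ru : reduced u by rewrite -cats1 in rus; exact: reduced_catl rus.
rewrite (le_trans (IH ru))// actv_rcons actvB actvZ bfBr bfZr lerBrDr gerDl.
by rewrite mulr_le0_ge0 ?bf_poscone ?pmulr_rle0//; exact: reduced_rcons_pos.
Qed.

(** Each letter subtracts [2 * bf x0 (v s)] times the pairing of [x0] with a positive root. As that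
    root has norm 1, its coefficient sum [S] satisfies [1 <= S ^+ 2 * M]; since [1 <= M], this gives
    [M^-1 <= S], and the pairing is at least [m / M]. *)
Lemma bf_act_growth x0 m M w : 0 < m -> 1 <= M -> (forall i, m <= bf x0 (v i)) ->
  (forall i j, bf (v i) (v j) <= M) -> reduced w ->
  bf (actv w x0) x0 <= bf x0 x0 - 2 * m * (m / M) * (size w)%:R.
Proof.
move=> m0 M1 xv vM.
have M0 : 0 < M by lra.
elim/last_ind: w => [|w s IH] rws; first by rewrite mulr0 subr0.
have rw : reduced w by rewrite -cats1 in rws; exact: reduced_catl rws.
rewrite actv_rcons actvB actvZ bfBl bfZl size_rcons -[(size w).+1]addn1.
rewrite natrD (mulrDr (2 * m * _)) mulr1 opprD addrA.
apply: lerB; first exact: IH.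
apply: ler_pM; rewrite ?mulr_ge0 ?invr_ge0 ?ler_wpM2l ?(ltW m0) ?(ltW M0)//.
have [a a0 aE] := reduced_rcons_pos rws.
have : bf (actv w (v s)) (actv w (v s)) = 1 by rewrite bf_actv.
rewrite aE => n1; rewrite bf_suml.
pose S := \sum_i a i.
have S0 : 0 <= S by rewrite sumr_ge0.
have S2 : 1 <= S * (S * M).
  rewrite -n1 bf_suml /S mulr_suml; apply: ler_sum => i _.
  rewrite bfZl ler_wpM2l// bfC bf_suml mulr_suml; apply: ler_sum => j _.
  by rewrite bfZl ler_wpM2l.
have S1 : M^-1 <= S.
  rewrite -div1r ler_pdivrMr// leNgt; apply/negP => SM.
  suff : S * (S * M) < 1 by lra.
  have [->|S00] := eqVneq S 0; first by rewrite mul0r ltr01.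
  have Sp : 0 < S by rewrite lt_neqAle eq_sym S00.
  have : S <= S * M by rewrite ler_peMr.
  nra.
apply: (@le_trans _ _ (S * m)); first by rewrite mulrC ler_wpM2r// ltW.
by rewrite /S mulr_suml; apply: ler_sum => i _; rewrite bfZl ler_wpM2l// bfC.
Qed.

Fixpoint words (N : nat) : seq (seq I) :=
  if N is N'.+1 then [::] :: [seq i :: w | i <- enum I, w <- words N'] else [:: [::]].

Lemma mem_words N w : (size w <= N)%N -> w \in words N.
Proof.
elim: N w => [|N IH] [|i w] //= wN; rewrite inE; apply/orP; right.
by apply/allpairsP; exists (i, w); rewrite mem_enum IH.
Qed.

Lemma seq_argmax (T : eqType) (f : T -> K) (x : T) (s : seq T) : x \in s ->
  exists2 y, y \in s & forall z, z \in s -> f z <= f y.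
Proof.
elim: s x => // a s IH x _; case: s IH => [_|b s IH].
  by exists a => [|z]; rewrite inE ?eqxx// => /eqP ->.
have [y ys ymax] := IH b (mem_head _ _); have [fya|fay] := leP (f y) (f a).
  exists a; rewrite ?mem_head// => z; rewrite inE => /orP[/eqP -> //|/ymax zy].
  exact: le_trans fya.
exists y; first by rewrite inE ys orbT.
by move=> z; rewrite inE => /orP[/eqP ->|/ymax//]; exact: ltW.
Qed.

(** Where the pairing with [x0] is maximal, no reflection in [J] can increase it, which is the
    asserted inequality. The maximum exists because [prop] confines the search to finitely many
    words. *)
Lemma fold_chamber (J : pred I) x0 y : (forall i, 0 < bf x0 (v i)) ->
  (forall C, exists N, forall w, reduced w -> C <= bf (actv w y) x0 -> (size w <= N)%N) ->
  exists2 w, all J w & forall j, J j -> 0 <= bf (actv w y) (v j).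
Proof.
move=> xv prop; have [N Nle] := prop (bf y x0).
(* A reduced form of a word in [J] might contain other letters, so only its effect on [y] is
   compared. *)
pose P u := `[< exists2 w, all J w & actv w y = actv u y >].
have Pnil : [::] \in [seq u <- words N | P u].
  by rewrite mem_filter mem_words// andbT; apply/asboolP; exists [::].
have [u] := @seq_argmax _ (fun u => bf (actv u y) x0) _ _ Pnil.
rewrite mem_filter => /andP[/asboolP[w wJ wu] _] umax; exists w => // j Jj.
rewrite leNgt; apply/negP => wj.
have lt_u : bf (actv u y) x0 < bf (actv (j :: w) y) x0.
  by rewrite -wu /= [reflv _ _]/reflv bfBl bfZl ltrDl oppr_gt0 pmulr_llt0 ?pmulr_rlt0// bfC.
have [z rz zE] := reduced_ex (j :: w).
have : z \in [seq u <- words N | P u].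
  rewrite mem_filter; apply/andP; split.
    by apply/asboolP; exists (j :: w); rewrite /= ?Jj//; rewrite zE.
  apply: mem_words; apply: Nle => //; rewrite zE; apply: le_trans (ltW lt_u).
  exact: umax Pnil.
by move/umax; rewrite zE leNgt lt_u.
Qed.

End ReflectionGroup.

(** * The Lorentz model: circles, points and reflections as vectors and linear maps *)

Section Lorentz.
Variable K : realType.
Notation vec := (K * K * K * K)%type.

(** A circle [A |z|^2 + 2 b z + D = 0] is encoded by the vector [(A, b, D)], of
    positive norm, and a point of [H3] by a vector of negative norm with [A < 0],
    in such a way that [cform] becomes the Lorentz form. *)
Definition lf (x y : vec) : K :=
  x.1.1.2 * y.1.1.2 + x.1.2 * y.1.2 - (x.1.1.1 * y.2 + x.2 * y.1.1.1) / 2.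

Definition cvec (C : circle K) : vec := (cA C, (cb C).1, (cb C).2, cD C).
Definition pvec (w : K * K * K) : vec :=
  (- 2, 2 * w.1.1, 2 * w.1.2, - 2 * (w.1.1 ^+ 2 + w.1.2 ^+ 2 + w.2 ^+ 2)).
Definition cpvec (z : Chat K) : vec :=
  if z is Some u then pvec (u, 0) else (0, 0, 0, -2).
Definition ftl (x : vec) : Prop := x.1.1.1 < 0 /\ lf x x < 0.

Lemma lfC x y : lf x y = lf y x.
Proof. rewrite /lf; ring. Qed.
Lemma lfP a x y z : lf (a *: x + y) z = a * lf x z + lf y z.
Proof. rewrite /lf /= /GRing.scale /=; lra. Qed.

Lemma vecZE (a : K) (x : vec) : a *: x = (a * x.1.1.1, a * x.1.1.2, a * x.1.2, a * x.2).
Proof. by []. Qed.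

Lemma vecBE (x y : vec) :
  x - y = (x.1.1.1 - y.1.1.1, x.1.1.2 - y.1.1.2, x.1.2 - y.1.2, x.2 - y.2).
Proof. by []. Qed.
Lemma vecDE (x y : vec) :
  x + y = (x.1.1.1 + y.1.1.1, x.1.1.2 + y.1.1.2, x.1.2 + y.1.2, x.2 + y.2).
Proof. by []. Qed.

Let lfZl := bfZl lfP.
Let lfZr := bfZr lfC lfP.
Lemma lf_cform C w : lf (pvec w) (cvec C) = cform C w.
Proof. rewrite /lf /cform /pvec /cvec /=; lra. Qed.
Lemma lf_cform_Chat C z : lf (cpvec z) (cvec C) = cform_Chat C z.
Proof. by case: z => [u|]; rewrite /= ?lf_cform// /lf /=; lra. Qed.
Lemma lf_disc C : lf (cvec C) (cvec C) = disc C.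
Proof. rewrite /lf /disc /=; lra. Qed.
Lemma lf_pvec w : lf (pvec w) (pvec w) = - 4 * w.2 ^+ 2.
Proof. rewrite /lf /=; lra. Qed.

Lemma H3_gt0 (w : H3 K) : 0 < (set_val w).2.
Proof. exact: (set_valP w). Qed.

Lemma ftl_pvec (w : H3 K) : ftl (pvec (set_val w)).
Proof.
split; first by rewrite /=; lra.
by rewrite lf_pvec pmulr_llt0 ?exprn_gt0 ?H3_gt0//; lra.
Qed.

Lemma ftlZ a x : 0 < a -> ftl x -> ftl (a *: x).
Proof.
move=> a0 [x0 xx]; split; first by rewrite /= /GRing.scale /= pmulr_rlt0.
by rewrite lfZl lfZr !pmulr_rlt0.
Qed.

(** The point of [upper] on the ray spanned by [x]. *)
Definition ovec (x : vec) : K * K * K :=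
  (- x.1.1.2 / x.1.1.1, - x.1.2 / x.1.1.1, - Num.sqrt (- lf x x) / x.1.1.1).

Lemma upper1 : ((0, 0, 1) : K * K * K) \in @upper K.
Proof. by rewrite inE /upper /= ltr01. Qed.
(** The value outside the future cone is the arbitrary point (0, 0, 1); it makes [hpt] total, so
    that limits can be stated for all vectors. *)
Definition hpt (x : vec) : H3 K := insubd (SigSub upper1 : H3 K) (ovec x).

Lemma ovec_upper x : ftl x -> ovec x \in @upper K.
Proof.
move=> [x0 xx]; rewrite inE /upper /= mulNr -mulrN -invrN.
by rewrite divr_gt0 ?oppr_gt0// sqrtr_gt0 oppr_gt0.
Qed.
Lemma val_hpt x : ftl x -> set_val (hpt x) = ovec x.
Proof. by move=> /ovec_upper xu; rewrite set_valE /hpt insubdK. Qed.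

Lemma pvec_ovec x : ftl x -> pvec (ovec x) = (- 2 / x.1.1.1) *: x.
Proof.
case: x => [[[A b1] b2] D] [/= A0 xx]; have An0 : A != 0 by rewrite ltr0_neq0.
rewrite vecZE /pvec /ovec /= !expr_div_n !sqrrN sqr_sqrtr; last first.
  by rewrite oppr_ge0 ltW.
by rewrite /lf /=; congr (_, _, _, _); field.
Qed.
Lemma pvec_hpt x : ftl x -> exists2 a, 0 < a & pvec (set_val (hpt x)) = a *: x.
Proof.
move=> xf; rewrite val_hpt// pvec_ovec//; exists (-2 / x.1.1.1) => //.
by rewrite mulNr -mulrN -invrN divr_gt0// oppr_gt0; case: xf.
Qed.

Lemma ovecZ a x : 0 < a -> ovec (a *: x) = ovec x.
Proof.
move=> a0; rewrite /ovec lfZl lfZr vecZE /=.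
have an0 : a != 0 by rewrite lt0r_neq0.
rewrite -!mulrN mulrA -expr2 sqrtrM ?sqr_ge0// sqrtr_sqr gtr0_norm//.
have E u w : a * u / (a * w) = u / w by rewrite invfM mulrACA divff// mul1r.
by rewrite -!mulrN !E.
Qed.
Lemma hptZ a x : 0 < a -> hpt (a *: x) = hpt x.
Proof. by move=> a0; rewrite /hpt ovecZ. Qed.
Lemma hpt_pvec (w : H3 K) : hpt (pvec (set_val w)) = w.
Proof.
apply: val_inj; rewrite -!set_valE val_hpt; last exact: ftl_pvec.
have := H3_gt0 w; case: (set_val w) => [[x y] t] /= t0.
rewrite /ovec lf_pvec /= mulNr opprK (_ : 4 * t ^+ 2 = (2 * t) ^+ 2); last by ring.
by rewrite sqrtr_sqr gtr0_norm ?mulr_gt0//; congr (_, _, _); field.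
Qed.

(** After rescaling to points of the half-space the pairing is -2 times a sum of squares. *)
Lemma lf_ftl_lt0 x y : ftl x -> ftl y -> lf x y < 0.
Proof.
move=> xf yf; have [a a0 xE] := pvec_hpt xf; have [b b0 yE] := pvec_hpt yf.
rewrite -(pmulr_rlt0 _ a0) -(pmulr_rlt0 _ b0) -lfZl -lfZr -xE -yE.
have := H3_gt0 (hpt x); have := H3_gt0 (hpt y).
case: (set_val (hpt x)) => [[x1 x2] t]; case: (set_val (hpt y)) => [[y1 y2] s] /= s0 t0.
have -> : lf (pvec (x1, x2, t)) (pvec (y1, y2, s)) =
  - 2 * ((x1 - y1) ^+ 2 + (x2 - y2) ^+ 2 + t ^+ 2 + s ^+ 2) by rewrite /lf /=; lra.
suff : 0 < (x1 - y1) ^+ 2 + (x2 - y2) ^+ 2 + t ^+ 2 + s ^+ 2 by lra.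
by rewrite ltr_wpDl ?exprn_gt0// !addr_ge0 ?sqr_ge0.
Qed.

(** * Reflections *)

Variable C : 'I_4 -> circle K.

Definition nv (i : 'I_4) : vec := (Num.sqrt (disc (C i)))^-1 *: cvec (C i).

Lemma disc_pos (B : circle K) : 0 < disc B. Proof. exact: disc_gt0. Qed.
Lemma sqrt_disc_gt0 (B : circle K) : 0 < Num.sqrt (disc B).
Proof. by rewrite sqrtr_gt0 disc_pos. Qed.

Lemma lf_nv i : lf (nv i) (nv i) = 1.
Proof.
rewrite /nv lfZl lfZr lf_disc mulrA -invfM -expr2 sqr_sqrtr ?ltW ?disc_pos//.
by rewrite mulVf// lt0r_neq0// disc_pos.
Qed.

Lemma reflv_nvE i x :
  reflv lf nv i x = x - (2 * lf x (cvec (C i)) / disc (C i)) *: cvec (C i).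
Proof.
rewrite /reflv /nv lfZr scalerA; congr (_ - _ *: _).
have d0 := disc_pos (C i); have s0 := sqrt_disc_gt0 (C i).
rewrite -{3}(sqr_sqrtr (ltW d0)) expr2 invfM; ring.
Qed.

Lemma refl_den_gt0 (B : circle K) (w : H3 K) : 0 < refl_den B (set_val w).
Proof.
have := refl3_upper B w; rewrite inE /upper /= => h.
have w0 := H3_gt0 w; have d0 := disc_pos B.
have den0 : 0 <= refl_den B (set_val w) by rewrite /refl_den !addr_ge0 ?sqr_ge0.
rewrite lt_neqAle den0 andbT eq_sym; apply/eqP => r0.
by move: h; rewrite r0 invr0 mulr0 ltxx.
Qed.

Lemma refl_denE (B : circle K) w : refl_den B w = disc B + cA B * cform B w.
Proof. rewrite /refl_den /disc /cform; ring. Qed.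

Lemma pvec_refl3 (B : circle K) w : refl_den B w != 0 ->
  pvec (refl3 B w) =
  (disc B / refl_den B w) *: (pvec w - (2 * cform B w / disc B) *: cvec B).
Proof.
case: w => [[x y] t]; have dn0 := lt0r_neq0 (disc_pos B).
rewrite /refl3; have := refl_denE B (x, y, t).
set r := refl_den _ _; set f := cform _ _ => rE rn0.
(* The squared norm of the numerator is divisible by [r]. This cancels one of the two denominators,
   so that inversion becomes linear up to a scalar. *)
have sq : (disc B * x - f * (cb B).1) ^+ 2 + (disc B * y - f * (cb B).2) ^+ 2
    + (disc B * t) ^+ 2 = r * (disc B * (x ^+ 2 + y ^+ 2 + t ^+ 2) + f * cD B).
  by rewrite rE /f /cform /disc /=; ring.
rewrite !vecZE vecBE /pvec /cvec /=; congr (_, _, _, _).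
- by rewrite rE; field; rewrite -rE dn0 rn0.
- by field; rewrite dn0 rn0.
- by field; rewrite dn0 rn0.
- by rewrite !expr_div_n -!mulrDl sq; field; rewrite dn0 rn0.
Qed.

Lemma pvec_refl i (w : H3 K) : exists2 a, 0 < a &
  pvec (set_val (refl_H3 (C i) w)) = a *: reflv lf nv i (pvec (set_val w)).
Proof.
have r0 := refl_den_gt0 (C i) w; exists (disc (C i) / refl_den (C i) (set_val w)).
  by rewrite divr_gt0// disc_pos.
by rewrite reflv_nvE lf_cform; apply: pvec_refl3; rewrite lt0r_neq0.
Qed.

End Lorentz.

(** * Continuity of the model, up to the sphere at infinity *)

Section Topology.
Variable K : realType.
Notation vec := (K * K * K * K)%type.

Lemma cvg_fstr (T : Type) (F : set_system T) (U V : topologicalType)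
  (f : T -> U * V) (l : U * V) : f @ F --> l -> (f x).1 @[x --> F] --> l.1.
Proof. by case: l => a b fl; apply: cvg_comp fl _; exact: cvg_fst. Qed.
Lemma cvg_sndr (T : Type) (F : set_system T) (U V : topologicalType)
  (f : T -> U * V) (l : U * V) : f @ F --> l -> (f x).2 @[x --> F] --> l.2.
Proof. by case: l => a b fl; apply: cvg_comp fl _; exact: cvg_snd. Qed.
Lemma cvg_pairr {T : Type} {F : set_system T} {FF : Filter F} (U V : topologicalType)
  (f : T -> U) (g : T -> V) (l : U) (m : V) :
  f @ F --> l -> g @ F --> m -> (f x, g x) @[x --> F] --> (l, m).
Proof. exact: cvg_pair. Qed.

Lemma cvg_lf {T : Type} {F : set_system T} {FF : Filter F} (f g : T -> vec) (x y : vec) :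
  f @ F --> x -> g @ F --> y -> lf (f z) (g z) @[z --> F] --> lf x y.
Proof.
move=> fx gy; rewrite /lf.
have [fx1 gy1] := (cvg_fstr fx, cvg_fstr gy).
have [fx2 gy2] := (cvg_fstr fx1, cvg_fstr gy1).
have [fA gA] := (cvg_fstr fx2, cvg_fstr gy2); have [fD gD] := (cvg_sndr fx, cvg_sndr gy).
have [f1 g1] := (cvg_sndr fx2, cvg_sndr gy2); have [f2 g2] := (cvg_sndr fx1, cvg_sndr gy1).
apply: cvgB; first by apply: cvgD; exact: cvgM.
by apply: cvgM; [apply: cvgD; exact: cvgM|exact: cvg_cst].
Qed.

Lemma cvg_ovec (x : vec) : x.1.1.1 != 0 -> ovec y @[y --> x] --> ovec x.
Proof.
move=> x0; rewrite /ovec.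
have h : id @ x --> x by exact: cvg_id.
have h1 := cvg_fstr h; have h2 := cvg_fstr h1.
have iA : y.1.1.1^-1 @[y --> x] --> x.1.1.1^-1 by exact: (cvgV x0 (cvg_fstr h2)).
have sq : Num.sqrt (- lf y y) @[y --> x] --> Num.sqrt (- lf x x).
  by apply: (cvg_comp _ _ (cvgN (cvg_lf h h))); exact: sqrt_continuous.
have frac (f : vec -> K) (l : K) : f @ x --> l -> (- f y / y.1.1.1) @[y --> x] --> - l / x.1.1.1.
  by move=> fl; exact: (cvgM (cvgN fl) iA).
exact: (cvg_pairr (cvg_pairr (frac _ _ (cvg_sndr h2)) (frac _ _ (cvg_sndr h1))) (frac _ _ sq)).
Qed.

Lemma near_ftl (x : vec) : ftl x -> \forall y \near x, ftl y.
Proof.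
move=> [x0 xx].
have h : id @ x --> x by exact: cvg_id.
have h1 := cvg_fstr h; have h2 := cvg_fstr h1; have hA := cvg_fstr h2.
have hl : lf y y @[y --> x] --> lf x x by exact: (cvg_lf h h).
have nA : \forall y \near x, y.1.1.1 < 0 by exact: (cvgr_lt _ hA _ x0).
have nl : \forall y \near x, lf y y < 0 by exact: (cvgr_lt _ hl _ xx).
by near=> y; split; near: y.
Unshelve. all: by end_near. Qed.

Lemma nbhs_H3 (w : H3 K) (U : set (H3 K)) : nbhs w U <->
  exists2 V, nbhs (set_val w) V & forall w', V (set_val w') -> U w'.
Proof.
split.
  case=> _ [] [B oB <-] /= Bw BU; exists B; first exact: open_nbhs_nbhs.
  by move=> w' Bw'; exact: BU.
case=> V Vw VU.
apply: (filterS VU); exact: (@initial_continuous _ _ (@set_val _ (@upper K)) w V Vw).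
Qed.

Lemma cvg_H3 {T : Type} {F : set_system T} {FF : Filter F} (f : T -> H3 K) (w : H3 K) :
  (set_val (f x) @[x --> F] --> set_val w) -> f @ F --> w.
Proof.
move=> fw U /nbhs_H3[V Vw VU].
by apply: (@filterS _ F _ _ _ _ (fw V Vw)) => x /= /VU.
Qed.

Lemma cvg_hpt (x : vec) : ftl x -> hpt y @[y --> x] --> hpt x.
Proof.
move=> xf; apply: cvg_H3; rewrite val_hpt//; apply: cvg_trans (cvg_ovec (ltr0_neq0 xf.1)).
apply: near_eq_cvg; apply: filterS (near_ftl xf) => y yf.
by rewrite val_hpt.
Qed.

Lemma cvg_set_val (w : H3 K) : set_val w' @[w' --> w] --> set_val w.
Proof. exact: (@initial_continuous _ _ (@set_val _ (@upper K))). Qed.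

Lemma cvg_pvec (w : K * K * K) : pvec w' @[w' --> w] --> pvec w.
Proof.
have h : id @ w --> w by exact: cvg_id.
have h1 := cvg_fstr h; have h2 := cvg_sndr h.
have h11 := cvg_fstr h1; have h12 := cvg_sndr h1.
have c2 (c : K) : (fun=> c) @ w --> c by exact: cvg_cst.
exact: (cvg_pairr (cvg_pairr (cvg_pairr (c2 _) (cvgM (c2 2) h11)) (cvgM (c2 2) h12))
  (cvgM (c2 (-2)) (cvgD (cvgD (cvgM h11 h11) (cvgM h12 h12)) (cvgM h2 h2)))).
Qed.

Lemma cvg_pvec_H3 (w : H3 K) : pvec (set_val w') @[w' --> w] --> pvec (set_val w).
Proof. by apply: (cvg_comp _ _ (@cvg_set_val w)); exact: cvg_pvec. Qed.

Lemma cvg_lf_H3 (w : H3 K) (x : vec) :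
  lf (pvec (set_val w')) x @[w' --> w] --> lf (pvec (set_val w)) x.
Proof. exact: (cvg_lf (@cvg_pvec_H3 w) (cvg_cst x)). Qed.

Lemma cvg_scale_vec {T : Type} {F : set_system T} {FF : Filter F} (f : T -> K) (g : T -> vec)
  (a : K) (x : vec) : f @ F --> a -> g @ F --> x -> f z *: g z @[z --> F] --> a *: x.
Proof. by move=> fa gx; exact: (cvgZ fa gx). Qed.

Lemma box_compact (M : K) : compact [set w : K * K * K | [/\ `|w.1.1| <= M, `|w.1.2| <= M & `|w.2| <= M]].
Proof.
have : compact ((`[- M, M] `*` `[- M, M]) `*` `[- M, M] : set (K * K * K)).
  by do 2!(apply: compact_setX; last exact: segment_compact); exact: segment_compact.
congr compact; apply/seteqP; split=> -[[x y] t] /=.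
  by rewrite !in_itv /= -!ler_norml => -[[]].
by rewrite !in_itv /= -!ler_norml => -[].
Qed.

Lemma compact_coord_bound (W : set (K * K * K)) : compact W ->
  exists2 M, 0 < M & forall w, W w -> [/\ `|w.1.1| <= M, `|w.1.2| <= M & `|w.2| <= M].
Proof.
move=> /compact_bounded/ex_strict_bound_gt0[M M0 WM]; exists M => // w /WM/ltW.
by rewrite !prod_normE /= !ge_max => /andP[/andP[-> ->] ->].
Qed.

(** The slack [k * t] vanishes at infinity. *)
Lemma closure_lf_ge0 (S : set (H3 K)) (x : vec) (k : K) (z : Chat K) :
  (forall w, S w -> - (k * (set_val w).2) <= lf (pvec (set_val w)) x) ->
  closure (H3_in_S3 @` S) (Chat_in_S3 z) -> 0 <= lf (cpvec z) x.
Proof.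
move=> Sx clz; pose f w := lf (pvec w) x + k * w.2.
have f_ge0 w : S w -> 0 <= f (set_val w) by move=> /Sx; rewrite /f; lra.
have clf : forall B, nbhs (Chat_in_S3 z) B -> exists2 w, S w & B (H3_in_S3 w).
  by move=> B /clz[_ [[w Sw <-] Bw]]; exists w.
rewrite leNgt; apply/negP => z_lt0; case: z z_lt0 clf {clz} => [u|]/= u0 clf.
  have fu : f (u, 0) < 0 by rewrite /f /= mulr0 addr0.
  have fc : f w @[w --> (u, 0)] --> f (u, 0).
    apply: cvgD; first exact: (cvg_lf (@cvg_pvec (u, 0)) (cvg_cst x)).
    by apply: cvgM; [exact: cvg_cst|apply: (@cvg_sndr _ _ _ _ id); exact: cvg_id].
  have [] := clf [set Some w | w in [set w | f w < 0]].
    by apply: one_point_compactification_some_nbhs; exact: (cvgr_lt _ fc _ fu).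
  move=> w Sw [w' fw' [ww']]; have := f_ge0 w Sw.
  by rewrite -ww' leNgt fw'.
rewrite /f in f_ge0; clear f Sx.
move: x u0 f_ge0 => [[[A b1] b2] D]; rewrite /lf /= => A0' f_ge0.
have A0 : A < 0 by lra.
pose L := 2 * `|b1| + 2 * `|b2| + `|D| + `|k|.
have L0 : 0 <= L by rewrite !addr_ge0 ?mulr_ge0.
(* With this choice [A * m ^+ 2 + L * m] is negative for every [m > M]: outside the cube of
   half-side [M] the quadratic term dominates all others, the slack included. *)
pose M := 1 - L / A.
have M1 : 1 <= M by rewrite /M lerBrDr gerDl mulr_ge0_le0// invr_le0 ltW.
have AM : A * M = A - L by rewrite /M; field; rewrite ltr0_neq0.
have [] := clf [set x : S3 K | x = None \/
    exists2 w, ~ [/\ `|w.1.1| <= M, `|w.1.2| <= M & `|w.2| <= M] & x = Some w].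
  exists [set w | [/\ `|w.1.1| <= M, `|w.1.2| <= M & `|w.2| <= M]].
    split; first exact: box_compact.
    apply: compact_closed; last exact: box_compact.
    exact: norm_hausdorff.
  by move=> [w|] /=; [move=> [[w' W' [<-]]|//]; right; exists w'|left].
move=> w Sw [//|[w' w'M [ww']]]; have := f_ge0 w Sw; rewrite ww' leNgt => /negP; apply.
move: w' w'M {ww'} => [[x y] t] /= xM; rewrite /lf /=.
pose m := Num.max (Num.max `|x| `|y|) `|t|.
have [xm ym tm] : [/\ `|x| <= m, `|y| <= m & `|t| <= m].
  by rewrite /m !le_max !lexx !orbT.
have Mm : M < m.
  rewrite ltNge; apply/negP => mM; apply: xM.
  by split; [move: xm|move: ym|move: tm] => /le_trans; apply.
have m2 : m ^+ 2 <= x ^+ 2 + y ^+ 2 + t ^+ 2.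
  rewrite -(real_normK (num_real x)) -(real_normK (num_real y)) -(real_normK (num_real t)).
  rewrite {1}/m; case: (leP `|t|) => _; first case: (leP `|x|) => _.
  - by rewrite addrAC lerDr addr_ge0 ?sqr_ge0.
  - by rewrite -addrA lerDl addr_ge0 ?sqr_ge0.
  - by rewrite lerDr addr_ge0 ?sqr_ge0.
have Am : A * (x ^+ 2 + y ^+ 2 + t ^+ 2) <= A * m ^+ 2 by rewrite ler_wnM2l// ltW.
have m1 : 1 <= m by lra.
have bx : b1 * x <= `|b1| * m by rewrite (le_trans (ler_norm _))// normrM ler_wpM2l.
have by_ : b2 * y <= `|b2| * m by rewrite (le_trans (ler_norm _))// normrM ler_wpM2l.
have kt : k * t <= `|k| * m by rewrite (le_trans (ler_norm _))// normrM ler_wpM2l.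
have Dm : D <= `|D| * m by rewrite (le_trans (ler_norm _))// ler_peMr.
have : A * m ^+ 2 + L * m < 0.
  have -> : A * m ^+ 2 + L * m = m * (A * (m - M)) + m * (A * M + L) by ring.
  rewrite AM subrK -mulrDr pmulr_rlt0; last by lra.
  by have : A * (m - M) < 0; [rewrite nmulr_rlt0// subr_gt0|lra].
rewrite /L !mulrDl; lra.
Qed.

(** Extends [hpt] continuously to null vectors from inside the cone. At infinity, the squared norm
    of the point is [y.2 / y.1.1.1], where the numerator tends to -2 and the denominator to 0, so
    that the point leaves every compact set. *)
Lemma cvg_S3 (z : Chat K) :
  H3_in_S3 (hpt y) @[y --> within (@ftl K) (nbhs (cpvec z))] --> Chat_in_S3 z.
Proof.
have h : id @ cpvec z --> cpvec z by exact: cvg_id.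
have h1 := cvg_fstr h; have h2 := cvg_fstr h1; have hA := cvg_fstr h2; have hD := cvg_sndr h.
case: z h h1 h2 hA hD => [u|] h h1 h2 hA hD /=.
  move=> B Bu; change (\forall y \near pvec (u, 0), ftl y -> B (H3_in_S3 (hpt y))).
  have oc := @cvg_ovec (pvec (u, 0)).
  have oE : ovec (pvec (u, 0)) = (u, 0).
    rewrite /ovec lf_pvec /= expr0n mulr0 oppr0 sqrtr0; case: (u) => x y /=.
    by congr (_, _, _); field.
  rewrite oE /= in oc.
  have n20 : -2 != 0 :> K by rewrite ltr0_neq0//; lra.
  apply: (@filterS _ (nbhs (pvec (u, 0))) _ _ _ _ (oc n20 (fun w => B (Some w)) Bu)) => y By yf.
  by rewrite /H3_in_S3 val_hpt.
move=> B [W [cW _] WB]; have [M M0 WM] := compact_coord_bound cW.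
have M20 : 0 < 3 * M ^+ 2 by rewrite mulr_gt0 ?exprn_gt0.
have nA : \forall y \near cpvec None, - (3 * M ^+ 2)^-1 < y.1.1.1.
  by apply: (cvgr_gt _ hA); rewrite /= oppr_lt0 invr_gt0.
have lt21 : -2 < -1 :> K by lra.
have nD : \forall y \near (cpvec None : vec), y.2 < -1.
  by have /= nD' := @cvgr_lt _ _ _ (nbhs_filter (cpvec None : vec)) _ _ hD _ lt21; apply: filterS nD'.
change (\forall y \near cpvec None, ftl y -> B (H3_in_S3 (hpt y))).
near=> y => yf.
have yA : - (3 * M ^+ 2)^-1 < y.1.1.1 by near: y.
have yD : y.2 < -1 by near: y; exact: nD.
apply: WB; left.
exists (ovec y); last by rewrite /H3_in_S3 val_hpt.
move=> /WM[]; have := pvec_ovec yf; case: (ovec y) => [[a b] t] /=.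
have y0 : y.1.1.1 < 0 by case: yf.
rewrite vecZE /pvec /= => -[_ _ _ E] aM bM tM.
have sqM c : `|c| <= M -> c ^+ 2 <= M ^+ 2.
  by move=> cM; rewrite -(real_normK (num_real c)) lerXn2r ?nnegrE// ltW.
have : y.2 / y.1.1.1 <= 3 * M ^+ 2.
  have -> : y.2 / y.1.1.1 = a ^+ 2 + b ^+ 2 + t ^+ 2.
    have : -2 * (y.2 / y.1.1.1) = -2 * (a ^+ 2 + b ^+ 2 + t ^+ 2) by rewrite E; ring.
    lra.
  have := sqM _ aM; have := sqM _ bM; have := sqM _ tM; lra.
rewrite ler_ndivrMr// => H.
have : -1 < 3 * M ^+ 2 * y.1.1.1.
  by rewrite -(ltr_pM2l M20) mulrN mulfV ?lt0r_neq0// in yA.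
lra.
Unshelve. all: by end_near. Qed.

End Topology.

(** * Products of two reflections are Moebius maps *)

Section Moebius.
Variable K : realType.
Implicit Types (a b c d : K[i]) (z : Chat K).

Definition toChat (u : K[i]) : Chat K := Some (complex.Re u, complex.Im u).

Lemma moebius_fin a b c d u : moebius a b c d (toChat u) =
  if c * u + d == 0 then None else toChat ((a * u + b) / (c * u + d)).
Proof. by case: u. Qed.

Lemma Chat_case (P : Chat K -> Prop) : P None -> (forall u, P (toChat u)) -> forall z, P z.
Proof. by move=> P0 P1 [[x y]|]; [exact: (P1 (x +i* y)%C)|]. Qed.

Lemma moebius_comp a b c d a' b' c' d' z : a * d - b * c != 0 -> a' * d' - b' * c' != 0 ->
  moebius a b c d (moebius a' b' c' d' z) =
  moebius (a * a' + b * c') (a * b' + b * d') (c * a' + d * c') (c * b' + d * d') z.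
Proof.
move=> det det'; elim/Chat_case: z => [|u].
  rewrite [moebius a' _ _ _ _]/=; have [c0|c0] := eqVneq c' 0.
    rewrite c0 !mulr0 !addr0 subr0 mulf_eq0 in det' *; move: det'.
    rewrite negb_or => /andP[a'0 _].
    rewrite /= mulf_eq0 (negPf a'0) orbF; case: eqVneq => // c1.
    by rewrite invfM mulrACA divff// mulr1.
  rewrite -/(toChat _) moebius_fin /=.
  have -> : c * (a' / c') + d = (c * a' + d * c') / c' by field.
  have -> : a * (a' / c') + b = (a * a' + b * c') / c' by field.
  rewrite mulf_eq0 invr_eq0 (negPf c0) orbF; case: eqVneq => // e0.
  by rewrite -/(toChat _); congr toChat; field; rewrite e0.
rewrite !moebius_fin; have -> : (c * a' + d * c') * u + (c * b' + d * d') =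
  c * (a' * u + b') + d * (c' * u + d') by ring.
have -> : (a * a' + b * c') * u + (a * b' + b * d') =
  a * (a' * u + b') + b * (c' * u + d') by ring.
have [e0|e0] := eqVneq (c' * u + d') 0; last first.
  rewrite moebius_fin.
  set p := a' * u + b'; set q := c' * u + d' in e0 *.
  have -> : c * (p / q) + d = (c * p + d * q) / q by field.
  have -> : a * (p / q) + b = (a * p + b * q) / q by field.
  rewrite mulf_eq0 invr_eq0 (negPf e0) orbF; case: eqVneq => // f0.
  by congr toChat; field; rewrite f0.
have p0 : a' * u + b' != 0.
  apply: contra det' => /eqP p0; apply/eqP.
  have -> : a' * d' - b' * c' = a' * (c' * u + d') - c' * (a' * u + b') by ring.
  by rewrite e0 p0 !mulr0 subr0.
rewrite e0 !mulr0 !addr0 /= mulf_eq0 (negPf p0) orbF; case: eqVneq => // c0.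
by rewrite invfM mulrACA divff// mulr1.
Qed.

Lemma moebiusZ k a b c d z : k != 0 ->
  moebius (k * a) (k * b) (k * c) (k * d) z = moebius a b c d z.
Proof.
move=> k0; elim/Chat_case: z => [|u].
  by rewrite /= mulf_eq0 (negPf k0) /= invfM mulrACA divff// mul1r.
by rewrite !moebius_fin -!mulrA -!mulrDr mulf_eq0 (negPf k0) /= invfM mulrACA divff// mul1r.
Qed.

Lemma moebius1 z : moebius 1 0 0 1 z = z.
Proof.
elim/Chat_case: z => [|u]; first by rewrite /= eqxx.
by rewrite moebius_fin mul0r add0r oner_eq0 mul1r addr0 divr1.
Qed.

Lemma is_moebius_comp (g h : Chat K -> Chat K) :
  is_moebius g -> is_moebius h -> is_moebius (g \o h).
Proof.
move=> [a [b [c [d [det gE]]]]] [a' [b' [c' [d' [det' hE]]]]].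
exists (a * a' + b * c'), (a * b' + b * d'), (c * a' + d * c'), (c * b' + d * d'); split.
  by rewrite -[RHS]mulr1 -{1}det -det'; ring.
by move=> z; rewrite /= gE hE moebius_comp// ?det ?det' oner_neq0.
Qed.

Lemma is_moebius_id (g : Chat K -> Chat K) : g =1 id -> is_moebius g.
Proof.
by move=> gE; exists 1, 0, 0, 1; split=> [|z]; rewrite ?mulr1 ?mul0r ?subr0// gE moebius1.
Qed.

Lemma is_moebius_inv (g h : Chat K -> Chat K) : cancel g h -> is_moebius g -> is_moebius h.
Proof.
move=> gK [a [b [c [d [det gE]]]]]; exists d, (- b), (- c), a; split.
  by rewrite -det; ring.
move=> z; rewrite -[in LHS](moebius1 z); have det0 : a * d - b * c != 0 by rewrite det oner_neq0.
have det1 : d * a - (- b) * (- c) != 0 by rewrite mulrNN mulrC det0.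
have := moebius_comp z det0 det1.
have -> : a * d + b * (- c) = 1 by rewrite mulrN.
have -> : a * (- b) + b * a = 0 by ring.
have -> : c * d + d * (- c) = 0 by ring.
have -> : c * (- b) + d * a = 1 by rewrite -det; ring.
by move=> <-; rewrite -gE gK.
Qed.

Definition cj (z : Chat K) : Chat K := if z is Some (x, y) then Some (x, - y) else None.

Lemma cjK : involutive cj.
Proof. by case=> [[x y]|] //=; rewrite opprK. Qed.
Lemma cj_toChat u : cj (toChat u) = toChat (conjc u).
Proof. by case: u. Qed.
Lemma cj_moebius a b c d z :
  cj (moebius a b c d z) = moebius (conjc a) (conjc b) (conjc c) (conjc d) (cj z).
Proof.
elim/Chat_case: z => [|u].
  rewrite /= conjc_eq0; case: eqVneq => // _.
  by rewrite -/(toChat _) -/(toChat _) -/(cj (toChat _)) cj_toChat fmorph_div.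
rewrite cj_toChat !moebius_fin -!rmorphM -!rmorphD conjc_eq0; case: eqVneq => // _.
by rewrite cj_toChat fmorph_div.
Qed.

Lemma refl_moebius (C : circle K) z :
  refl_Chat C z = moebius (- ((cb C).1 +i* (cb C).2)%C) (- ((cD C)%:C)%C) ((cA C)%:C)%C
    ((cb C).1 -i* (cb C).2)%C (cj z).
Proof.
have div_eq (p q t : K[i]) : q != 0 -> t * q = p -> p / q = t.
  by move=> q0 <-; rewrite mulfK.
case: z => [[x y]|].
  rewrite [cj _]/= -[Some (x, - y)]/(toChat (x -i* y)%C) moebius_fin /=.
  set A := cA C; set D := cD C; set b1 := (cb C).1; set b2 := (cb C).2.
  have qE : ((A%:C) * (x -i* y) + (b1 -i* b2) = (A * x + b1) -i* (A * y + b2))%C.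
    by apply/eqP; rewrite eq_complex /=; apply/andP; split; apply/eqP; ring.
  have rE : refl_den C (x, y, 0) = (A * x + b1) ^+ 2 + (A * y + b2) ^+ 2.
    by rewrite /refl_den /= mulr0 expr0n addr0.
  rewrite qE eq_complex /= oppr_eq0 rE paddr_eq0 ?sqr_ge0// !sqrf_eq0.
  case: ifPn => // q0.
  have r0 : (A * x + b1) ^+ 2 + (A * y + b2) ^+ 2 != 0.
    by rewrite paddr_eq0 ?sqr_ge0// !sqrf_eq0.
  rewrite (div_eq _ _ ((disc C * x - cform C (x, y, 0) * b1) / ((A * x + b1) ^+ 2 + (A * y + b2) ^+ 2)
     +i* ((disc C * y - cform C (x, y, 0) * b2) / ((A * x + b1) ^+ 2 + (A * y + b2) ^+ 2)))%C).
  - by [].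
  - by rewrite eq_complex /= oppr_eq0.
  - apply/eqP; rewrite eq_complex /disc /cform /= -/A -/b1 -/b2 -/D.
    by apply/andP; split; apply/eqP; field.
have mN (a b c d : K[i]) : moebius a b c d None = if c == 0 then None else toChat (a / c) by [].
have AC : (((cA C)%:C)%C == 0 :> K[i]) = (cA C == 0) by rewrite eq_complex /= eqxx andbT.
rewrite [cj _]/= mN AC [LHS]/=; case: eqVneq => // A0.
rewrite (div_eq _ _ ((- (cb C).1 / cA C) +i* (- (cb C).2 / cA C))%C)//.
  by rewrite AC.
by apply/eqP; rewrite eq_complex /=; apply/andP; split; apply/eqP; field.
Qed.

(** The two conjugations cancel. Each determinant is minus a discriminant, so their product is a
    positive real number, and division by its real square root [k] normalises the matrix. *)
Lemma refl_moebius_comp (C C' : circle K) :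
  is_moebius (refl_Chat C \o refl_Chat C').
Proof.
set b := ((cb C).1 +i* (cb C).2)%C; set b' := ((cb C').1 +i* (cb C').2)%C.
set A := ((cA C)%:C)%C; set A' := ((cA C')%:C)%C; set D := ((cD C)%:C)%C; set D' := ((cD C')%:C)%C.
pose k : K[i] := ((Num.sqrt (disc C * disc C'))%:C)%C.
have d0 : 0 < disc C * disc C' by rewrite mulr_gt0// disc_pos.
have k0 : k != 0 by rewrite eq_complex /= eqxx andbT lt0r_neq0// sqrtr_gt0.
have kk : k * k = ((disc C * disc C')%:C)%C.
  apply/eqP; rewrite eq_complex /= !mulr0 !mul0r !addr0 subr0 eqxx andbT -expr2.
  by rewrite sqr_sqrtr// ltW.
have detE (E : circle K) :
    (- ((cb E).1 +i* (cb E).2) * ((cb E).1 -i* (cb E).2) - (- (cD E)%:C) * (cA E)%:C = (- disc E)%:C)%C.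
  by apply/eqP; rewrite eq_complex /disc /=; apply/andP; split; apply/eqP; ring.
have detE' (E : circle K) :
    (conjc (- ((cb E).1 +i* (cb E).2)) * conjc ((cb E).1 -i* (cb E).2)
      - conjc (- (cD E)%:C) * conjc (cA E)%:C = (- disc E)%:C)%C.
  by apply/eqP; rewrite eq_complex /disc /=; apply/andP; split; apply/eqP; ring.
have nz (E : circle K) : ((- disc E)%:C)%C != 0 :> K[i].
  by rewrite eq_complex /= eqxx andbT oppr_eq0 lt0r_neq0// disc_pos.
set a1 := - b; set b1 := - D; set c1 := A; set d1 := ((cb C).1 -i* (cb C).2)%C.
set a2 := conjc (- b'); set b2 := conjc (- D'); set c2 := conjc A';
set d2 := conjc ((cb C').1 -i* (cb C').2)%C.
have det1 : a1 * d1 - b1 * c1 = ((- disc C)%:C)%C by exact: detE.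
have det2 : a2 * d2 - b2 * c2 = ((- disc C')%:C)%C by exact: detE'.
exists (k^-1 * (a1 * a2 + b1 * c2)), (k^-1 * (a1 * b2 + b1 * d2)),
  (k^-1 * (c1 * a2 + d1 * c2)), (k^-1 * (c1 * b2 + d1 * d2)); split; last first.
  move=> z; rewrite moebiusZ ?invr_eq0// -moebius_comp ?det1 ?det2//.
  rewrite /= refl_moebius; congr moebius; rewrite refl_moebius cj_moebius cjK.
  by [].
have -> : forall x y z t : K[i], k^-1 * x * (k^-1 * t) - k^-1 * y * (k^-1 * z) =
   (k * k)^-1 * (x * t - y * z) by move=> x y z t; rewrite invfM; ring.
have -> : (a1 * a2 + b1 * c2) * (c1 * b2 + d1 * d2) - (a1 * b2 + b1 * d2) * (c1 * a2 + d1 * c2) =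
  (a1 * d1 - b1 * c1) * (a2 * d2 - b2 * c2) by ring.
have -> : (a1 * d1 - b1 * c1) * (a2 * d2 - b2 * c2) = k * k.
  rewrite det1 det2 kk; apply/eqP; rewrite eq_complex /=.
  by apply/andP; split; apply/eqP; ring.
by rewrite mulVf// mulf_eq0 negb_or k0.
Qed.

End Moebius.

(** * The group acting on space and at infinity, and the quotient *)

Section Action.
Variables (K : realType) (C : 'I_4 -> circle K).
Notation vec := (K * K * K * K)%type.
Notation act := (actv (@lf K) (nv C)).
Let lfZl := bfZl (@lfP K).
Let actZ := actvZ (nv C) (@lfP K).
Let act_revK := actv_revK (@lfP K) (lf_nv C).
Let lf_act := bf_actv (@lfC K) (@lfP K) (lf_nv C).

Lemma pvec_act g (w : H3 K) : exists2 a, 0 < a &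
  pvec (set_val (act_H3 C g w)) = a *: act g (pvec (set_val w)).
Proof.
elim: g => [|i g [a a0 IH]]; first by exists 1; rewrite ?scale1r.
have [b b0 E] := pvec_refl C i (act_H3 C g w).
exists (b * a); first exact: mulr_gt0.
by rewrite /= E IH (reflvZ (nv C) (@lfP K)) scalerA.
Qed.

Lemma hpt_eq (w : H3 K) a x : 0 < a -> pvec (set_val w) = a *: x -> w = hpt x.
Proof. by move=> a0 wx; rewrite -(hpt_pvec w) wx hptZ. Qed.

Lemma act_H3E g w : act_H3 C g w = hpt (act g (pvec (set_val w))).
Proof. by have [a a0 /(hpt_eq a0)] := pvec_act g w. Qed.

Lemma ftl_act g (x : vec) : ftl x -> ftl (act g x).
Proof.
move=> xf; have [a a0 xE] := pvec_hpt xf; have [b b0 E] := pvec_act g (hpt x).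
have -> : act g x = (b * a)^-1 *: pvec (set_val (act_H3 C g (hpt x))).
  by rewrite E xE actZ (scalerA b) scalerA mulVf ?scale1r// lt0r_neq0// mulr_gt0.
by apply: ftlZ; [rewrite invr_gt0 mulr_gt0|exact: ftl_pvec].
Qed.

Lemma act_hpt g (x : vec) : ftl x -> act_H3 C g (hpt x) = hpt (act g x).
Proof. by move=> xf; rewrite act_H3E; have [a a0 ->] := pvec_hpt xf; rewrite actZ hptZ. Qed.

Lemma act_H3_cat g h w : act_H3 C (g ++ h) w = act_H3 C g (act_H3 C h w).
Proof. by rewrite /act_H3 foldr_cat. Qed.
Lemma act_H3_revK g w : act_H3 C (rev g) (act_H3 C g w) = w.
Proof.
by rewrite (act_H3E g) act_hpt ?act_revK ?hpt_pvec//; apply/ftl_act/ftl_pvec.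
Qed.
Lemma cvg_act_H3 g (w : H3 K) : act_H3 C g w' @[w' --> w] --> act_H3 C g w.
Proof.
have -> : act_H3 C g = fun w => hpt (act g (pvec (set_val w))).
  by apply/funext => w'; exact: act_H3E.
have ac : act g (pvec (set_val w')) @[w' --> w] --> act g (pvec (set_val w)).
  elim: g => [|i g IH]; first exact: cvg_pvec_H3.
  exact: (cvgB IH (cvg_scale_vec (cvgM (cvg_cst (2 : K)) (cvg_lf IH (cvg_cst (nv C i))))
    (cvg_cst (nv C i)))).
by apply: (cvg_comp _ _ ac); apply: cvg_hpt; apply/ftl_act/ftl_pvec.
Qed.

Lemma hplane_act B g w : hplane B (act_H3 C g w) <-> lf (act g (pvec (set_val w))) (cvec B) = 0.
Proof.
rewrite /hplane /= -lf_cform; have [a a0 ->] := pvec_act g w; rewrite lfZl.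
split; last by move=> ->; rewrite mulr0.
by move/eqP; rewrite mulf_eq0 (gt_eqF a0) => /eqP.
Qed.

(** * The action at infinity *)

Lemma cpvec_inj a (z z' : Chat K) : 0 < a -> cpvec z = a *: cpvec z' -> z = z'.
Proof.
move=> a0; case: z z' => [[x y]|] [[x' y']|] //=; rewrite vecZE /pvec /= => -[].
- move=> E; have -> : a = 1 by lra.
  by rewrite !mul1r => ? ? _; congr (Some (_, _)); lra.
- by move=> *; exfalso; lra.
- by move=> *; exfalso; lra.
Qed.

Lemma cpvec_refl i (z : Chat K) : exists2 a, 0 < a &
  cpvec (refl_Chat (C i) z) = a *: reflv (@lf K) (nv C) i (cpvec z).
Proof.
have d0 := disc_pos (C i); have dn0 := lt0r_neq0 d0; rewrite reflv_nvE.
rewrite lf_cform_Chat; case: z => [[x y]|]; last first.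
  rewrite /refl_Chat /=; have [A0|A0] := eqVneq (cA (C i)) 0.
    by exists 1; rewrite // scale1r A0 mulr0 mul0r scale0r subr0.
  have sA : 0 < cA (C i) ^+ 2 by rewrite exprn_even_gt0.
  exists (disc (C i) / cA (C i) ^+ 2); first by rewrite divr_gt0.
  rewrite vecZE vecBE !vecZE /pvec /cvec /=.
  by congr (_, _, _, _); move: dn0; rewrite /disc /= => dn0; field; rewrite A0 dn0.
rewrite /refl_Chat; case: ifPn => [/eqP r0|r0]; last first.
  exists (disc (C i) / refl_den (C i) (x, y, 0)).
    by rewrite divr_gt0// lt_neqAle eq_sym r0 /refl_den !addr_ge0 ?sqr_ge0.
  rewrite -[cform_Chat _ _]/(cform (C i) (x, y, 0)) -pvec_refl3//.
  by rewrite /cpvec; congr pvec; rewrite /refl3 /= mulr0 mul0r.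
(* The remaining case: the point is the centre of the circle and goes to infinity. *)
have := r0; rewrite /refl_den /= mulr0 expr0n addr0 => /eqP.
rewrite paddr_eq0 ?sqr_ge0// !sqrf_eq0 => /andP[/eqP e1 /eqP e2].
have dE : disc (C i) = (cb (C i)).1 ^+ 2 + (cb (C i)).2 ^+ 2 - cA (C i) * cD (C i) by [].
have b1E : (cb (C i)).1 = - cA (C i) * x by move: e1; lra.
have b2E : (cb (C i)).2 = - cA (C i) * y by move: e2; lra.
have A0 : cA (C i) != 0.
  apply: contraL d0 => /eqP A0; rewrite dE b1E b2E A0.
  by rewrite !(oppr0, mul0r, mulr0, expr0n, addr0, subr0) ltxx.
have sA : 0 < cA (C i) ^+ 2 by rewrite exprn_even_gt0.
exists (cA (C i) ^+ 2 / disc (C i)); first by rewrite divr_gt0.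
have DE : cD (C i) = cA (C i) * (x ^+ 2 + y ^+ 2) - disc (C i) / cA (C i).
  apply: (mulfI A0); rewrite mulrBr (mulrC _ (disc _ / _)) divfK//.
  by rewrite dE b1E b2E; ring.
rewrite vecZE vecBE !vecZE /pvec /cvec /= /cform /= b1E b2E DE.
by congr (_, _, _, _); field; rewrite A0 dn0.
Qed.

Lemma refl_ChatK i : involutive (refl_Chat (C i)).
Proof.
move=> z; have [a a0 E] := cpvec_refl i (refl_Chat (C i) z); have [b b0 E'] := cpvec_refl i z.
apply: (@cpvec_inj (a * b)); first exact: mulr_gt0.
by rewrite E E' (reflvZ (nv C) (@lfP K)) (reflvK (@lfP K) (lf_nv C)) scalerA.
Qed.

Lemma act_Chat_cat g h z : act_Chat C (g ++ h) z = act_Chat C g (act_Chat C h z).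
Proof. by rewrite /act_Chat foldr_cat. Qed.
Lemma act_Chat_revK g : cancel (act_Chat C g) (act_Chat C (rev g)).
Proof.
elim: g => //= i g IH z; rewrite rev_cons -cats1 act_Chat_cat /=.
by rewrite refl_ChatK IH.
Qed.

Lemma cpvec_act g (z : Chat K) : exists2 a, 0 < a &
  cpvec (act_Chat C g z) = a *: act g (cpvec z).
Proof.
elim: g => [|i g [a a0 IH]]; first by exists 1; rewrite ?scale1r.
have [b b0 E] := cpvec_refl i (act_Chat C g z).
exists (b * a); first exact: mulr_gt0.
by rewrite /= E IH (reflvZ (nv C) (@lfP K)) scalerA.
Qed.

(** A vector orthogonal to all the roots is fixed by every reflection. *)
Lemma fuchsian_orth (B : circle K) : (forall i, lf (cvec B) (nv C i) = 0) -> fuchsian C.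
Proof.
move=> Bv; exists B => g _.
have actB h : act h (cvec B) = cvec B.
  by elim: h => //= i h ->; rewrite /reflv Bv mulr0 scale0r subr0.
have stab h z : on_circle B z -> on_circle B (act_Chat C h z).
  rewrite /on_circle /= -!lf_cform_Chat => zB; have [a _ ->] := cpvec_act h z.
  by rewrite lfZl -[cvec B](actB h) lf_act zB mulr0.
apply/seteqP; split=> [_ [z zB <-]|z zB]; first exact: stab.
exists (act_Chat C (rev g) z); first exact: stab.
by rewrite -{1}(revK g) act_Chat_revK.
Qed.

(** * The group [Gamma] and its orbits *)

Lemma Gamma_nil : Gamma C [::].
Proof. exact: is_moebius_id. Qed.

Lemma Gamma_cat g h : Gamma C g -> Gamma C h -> Gamma C (g ++ h).
Proof.
move=> gG hG; rewrite /Gamma /=.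
have -> : act_Chat C (g ++ h) = act_Chat C g \o act_Chat C h.
  by apply/funext => z; rewrite act_Chat_cat.
exact: is_moebius_comp.
Qed.

Lemma Gamma_rev g : Gamma C g -> Gamma C (rev g).
Proof. by move=> gG; apply: is_moebius_inv gG; exact: act_Chat_revK. Qed.

Lemma Gamma_even g : ~~ odd (size g) -> Gamma C g.
Proof.
have [m] := ubnP (size g); elim: m g => // m IH [|i [|j g]] //= gm godd.
  exact: Gamma_nil.
rewrite negbK in godd; apply: (@Gamma_cat [:: i; j]).
  exact: refl_moebius_comp.
by apply: IH godd; rewrite -ltnS ltnW.
Qed.

Lemma Gamma_orbitP w w' :
  Gamma_orbit C w = Gamma_orbit C w' <-> exists2 g, Gamma C g & w' = act_H3 C g w.
Proof.
split=> [E|[g gG ->]].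
  have : Gamma_orbit C w' w' by exists [::] => //; exact: Gamma_nil.
  by rewrite -E => -[g gG <-]; exists g.
apply/seteqP; split=> _ [h hG <-].
  exists (h ++ rev g); first exact: Gamma_cat (Gamma_rev gG).
  by rewrite act_H3_cat act_H3_revK.
by exists (h ++ g); [exact: Gamma_cat|rewrite act_H3_cat].
Qed.

Lemma to_orbifold_eq w w' :
  to_orbifold C w = to_orbifold C w' <-> exists2 g, Gamma C g & w' = act_H3 C g w.
Proof.
have eqP' : reflect (to_orbifold C w = to_orbifold C w') (same_orbit C w w').
  have := @eqmodP _ (same_orbit_equiv C) w w'; exact.
rewrite -Gamma_orbitP; split=> [/eqP'/asboolP//|E].
by apply/eqP'/asboolP.
Qed.

Lemma to_orbifold_continuous : continuous (to_orbifold C).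
Proof. exact: pi_continuous. Qed.

Lemma to_orbifold_surj (x : orbifold C) : exists w, x = to_orbifold C w.
Proof. by exists (repr x); rewrite /to_orbifold reprK. Qed.

Lemma to_orbifold_open (U : set (H3 K)) : open U -> open (to_orbifold C @` U).
Proof.
move=> oU; rewrite /open /= /quotient_open.
have -> : to_orbifold C @^-1` (to_orbifold C @` U) =
    \bigcup_(g in Gamma C) (act_H3 C g @^-1` U).
  apply/seteqP; split=> w /=.
    move=> [w' Uw' /esym/to_orbifold_eq[g gG w'E]]; exists g => //=.
    by rewrite -w'E.
  by move=> [g gG gU]; exists (act_H3 C g w) => //; apply/esym/to_orbifold_eq; exists g.
apply: bigcup_open => g _; apply: open_comp oU => w _; exact: cvg_act_H3.
Qed.

End Action.

(** * The four normals in an orthonormal frame *)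

Section Frame.

Lemma ord4_ind (P : 'I_4 -> Prop) : P 0 -> P 1 -> P 2 -> P 3 -> forall i, P i.
Proof.
move=> P0 P1 P2 P3 [[|[|[|[|i]]]] hi] //.
- by rewrite (_ : Ordinal hi = 0)//; apply: val_inj.
- by rewrite (_ : Ordinal hi = 1)//; apply: val_inj.
- by rewrite (_ : Ordinal hi = 2)//; apply: val_inj.
- by rewrite (_ : Ordinal hi = 3)//; apply: val_inj.
Qed.

Variable K : realType.
Notation vec := (K * K * K * K)%type.

(** Orthonormal coordinates adapted to the four circles.  The common
    perpendicular of [C 0] and [C 2] is spanned by [fN] (timelike) and [fe1],
    that of [C fs] and [C ft] by [fN2] and [fe2]; the hyperbolic functions of
    half the distances of the opposite planes are [(fcw, fsw)] and [(fcu, fsu)], those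
    of the distance of the two perpendiculars are [(fct, fst_)]. *)
Record frame (C : 'I_4 -> circle K) (c : K) := Frame {
  fN : vec; fk : vec; fe1 : vec; fe2 : vec;
  fcw : K; fsw : K; fcu : K; fsu : K; fct : K; fst_ : K;
  fs : 'I_4; ft : 'I_4;
  f_ftl : ftl fN;
  f_NN : lf fN fN = -1; f_kk : lf fk fk = 1; f_11 : lf fe1 fe1 = 1; f_22 : lf fe2 fe2 = 1;
  f_Nk : lf fN fk = 0; f_N1 : lf fN fe1 = 0; f_N2 : lf fN fe2 = 0;
  f_k1 : lf fk fe1 = 0; f_k2 : lf fk fe2 = 0; f_12 : lf fe1 fe2 = 0;
  f_w : fcw ^+ 2 = 1 + fsw ^+ 2; f_u : fcu ^+ 2 = 1 + fsu ^+ 2; f_t : fct ^+ 2 = 1 + fst_ ^+ 2;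
  f_cw0 : 0 < fcw; f_sw0 : 0 < fsw; f_cu0 : 0 < fcu; f_su0 : 0 < fsu;
  f_ct0 : 0 < fct; f_st0 : 0 < fst_;
  f_c : fsw * fsu * fct = c;
  f_complete : forall x : vec, x = - lf x fN *: fN + lf x fk *: fk + lf x fe1 *: fe1 + lf x fe2 *: fe2;
  f_st : (fs = 1 /\ ft = 3) \/ (fs = 3 /\ ft = 1);
  f_v0 : nv C 0 = fcw *: fe1 - fsw *: fN;
  f_v2 : nv C 2 = - fcw *: fe1 - fsw *: fN;
  f_vs : nv C fs = fcu *: fe2 - fsu *: (fct *: fN + fst_ *: fk);
  f_vt : nv C ft = - fcu *: fe2 - fsu *: (fct *: fN + fst_ *: fk)
}.

Variables (C : 'I_4 -> circle K) (n : nat) (n_gt1 : (1 < n)%N).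
Variable F : frame C (cos (pi / n%:R)).

Notation act := (actv (@lf K) (nv C)).
Notation N := (fN F). Notation k := (fk F). Notation e1 := (fe1 F). Notation e2 := (fe2 F).
Notation cw := (fcw F). Notation sw := (fsw F). Notation cu := (fcu F). Notation su := (fsu F).
Notation ct := (fct F). Notation st := (fst_ F). Notation s := (fs F). Notation t := (ft F).

(** [fb] is normal to the plane of the theorem; [fp] represents the point [p], and
    [fN + fe1], [fN - fe1] represent [q] and [q']. *)
Definition fN2 : vec := ct *: N + st *: k.
Definition fg : vec := - (st *: N + ct *: k).
Definition fp : vec := fN2 + e2.
Definition fb : vec := st *: e2 - k.

Let lin := (bfDl (@lfP K), bfBl (@lfP K), bfZl (@lfP K), bfNl (@lfP K),
  bfDr (@lfC K) (@lfP K), bfBr (@lfC K) (@lfP K), bfZr (@lfC K) (@lfP K), bfNr (@lfC K) (@lfP K)).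
Let flip (x y : vec) z : lf x y = z -> lf y x = z. Proof. by rewrite lfC. Qed.
Let orth := (f_NN F, f_kk F, f_11 F, f_22 F, f_Nk F, f_N1 F, f_N2 F, f_k1 F, f_k2 F, f_12 F,
  flip (f_Nk F), flip (f_N1 F), flip (f_N2 F), flip (f_k1 F), flip (f_k2 F), flip (f_12 F)).
Let actZ := actvZ (nv C) (@lfP K).
Let act_revK := actv_revK (@lfP K) (lf_nv C).
Let lf_act := bf_actv (@lfC K) (@lfP K) (lf_nv C).
Let lf_actl := bf_actvl (@lfC K) (@lfP K) (lf_nv C).

Lemma frame_cases (P : 'I_4 -> Prop) : P 0 -> P 2 -> P s -> P t -> forall i, P i.
Proof.
move=> P0 P2; case: (f_st F) => -[-> ->] P1 P3; exact: ord4_ind.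
Qed.

(** Opposite normals pair to [- cw ^+ 2 - sw ^+ 2] or [- cu ^+ 2 - su ^+ 2], adjacent ones to
    [- (sw * su * ct)], which [f_c] evaluates. *)
Lemma frame_gram i j : i != j ->
  lf (nv C i) (nv C j) = - cos (pi / n%:R) \/ lf (nv C i) (nv C j) <= -1.
Proof.
have c0 := f_c F; have w := f_w F; have u := f_u F; have h := f_t F.
have sw2 : 0 < sw ^+ 2 by rewrite exprn_gt0// f_sw0.
have su2 : 0 < su ^+ 2 by rewrite exprn_gt0// f_su0.
have hs : su ^+ 2 * ct ^+ 2 = su ^+ 2 * (1 + st ^+ 2) by rewrite h.
elim/frame_cases: i; elim/frame_cases: j; rewrite ?eqxx// => _;
  rewrite ?(f_v0 F) ?(f_v2 F) ?(f_vs F) ?(f_vt F) !lin !orth;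
  try (by right; lra); left; apply: etrans (congr1 -%R c0); ring.
Qed.

(** Positive norm is included so that the vector and its translates are normals of planes, against
    which the hull can be tested. *)
Definition antidominant (lam : vec) : Prop :=
  0 < lf lam lam /\ forall i, lf lam (nv C i) <= 0.

Lemma fN_chamber i : 0 < lf N (nv C i).
Proof.
have [[w u] h] := (f_sw0 F, f_su0 F, f_ct0 F).
by move: i; apply: frame_cases; rewrite ?(f_v0 F) ?(f_v2 F) ?(f_vs F) ?(f_vt F) !lin !orth; nra.
Qed.

Lemma fg_antidominant : antidominant fg.
Proof.
have [[[w u] h] h'] := (f_sw0 F, f_su0 F, f_ct0 F, f_st0 F); split.
  by rewrite /fg !lin !orth; have := f_t F; nra.
by apply: frame_cases; rewrite /fg ?(f_v0 F) ?(f_v2 F) ?(f_vs F) ?(f_vt F) !lin !orth; nra.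
Qed.

Lemma fk_antidominant : antidominant k.
Proof.
have [[[w u] h] h'] := (f_sw0 F, f_su0 F, f_ct0 F, f_st0 F); split; first by rewrite orth.
by apply: frame_cases; rewrite ?(f_v0 F) ?(f_v2 F) ?(f_vs F) ?(f_vt F) !lin !orth; nra.
Qed.

(** The extreme multiples of [e1] that leave [fg] antidominant: [ftau 1] is orthogonal to [nv C 0]
    and [ftau (-1)] to [nv C 2]. They bound the hull in the direction of the axis of xi. *)
Definition ftau (e : K) : vec := fg + (e * (sw / cw * st)) *: e1.

Lemma ftau_antidominant e : e ^+ 2 = 1 -> antidominant (ftau e).
Proof.
move=> e21; have [[[w u] h] h'] := (f_sw0 F, f_su0 F, f_ct0 F, f_st0 F).
have cw0 := f_cw0 F; have cwn0 := lt0r_neq0 cw0.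
have el : e <= 1 by nra.
have eg : -1 <= e by nra.
rewrite /ftau; set x := sw / cw * st.
have xcw : x * cw = sw * st by rewrite /x; field.
have ws : 0 < sw * st by rewrite mulr_gt0.
have H := f_t F; split.
  rewrite /fg !lin !orth.
  have : 0 <= (e * x) ^+ 2 by rewrite sqr_ge0.
  lra.
apply: frame_cases; rewrite /fg ?(f_v0 F) ?(f_v2 F) ?(f_vs F) ?(f_vt F) !lin !orth.
- have : e * (x * cw) <= 1 * (sw * st) by rewrite xcw ler_wpM2r// ltW.
  lra.
- have : -1 * (sw * st) <= e * (x * cw) by rewrite xcw ler_wpM2r// ltW.
  lra.
- lra.
- lra.
Qed.

Lemma circle_of_vec (x : vec) : 0 < lf x x -> exists B : circle K, cvec B = x.
Proof.
case: x => [[[A b1] b2] D] xx.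
have d : 0 < (b1, b2).1 ^+ 2 + (b1, b2).2 ^+ 2 - A * D by move: xx; rewrite /lf /=; lra.
by exists (Circle d).
Qed.

Lemma act_antidominant g x lam : (forall i, 0 <= lf x (nv C i)) ->
  antidominant lam -> lf x lam <= lf (act g x) lam.
Proof.
move=> xv [_ lamv].
exact: (bf_act_antidominant (@lfC K) (@lfP K) (lf_nv C) n_gt1 frame_gram).
Qed.

Lemma fN_act_fg g : st <= lf (act g N) fg.
Proof.
apply: le_trans (act_antidominant g (fun i => ltW (fN_chamber i)) fg_antidominant).
by rewrite /fg !lin !orth; lra.
Qed.

(** * Discreteness *)

Lemma act_growth : exists2 d, 0 < d & forall w, reduced (@lf K) (nv C) w ->
  lf (act w N) N <= -1 - d * (size w)%:R.
Proof.
pose m := \big[Num.min/1]_i lf N (nv C i).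
pose M := \big[Num.max/1]_(ij : 'I_4 * 'I_4) lf (nv C ij.1) (nv C ij.2).
have m0 : 0 < m by rewrite /m; elim/big_ind: _ => // [x y x0 y0|i _]; rewrite ?lt_min ?x0 ?fN_chamber.
have mle i : m <= lf N (nv C i) by rewrite /m; exact: bigmin_le_cond.
have M1 : 1 <= M by rewrite /M; exact: bigmax_ge_id.
have leM i j : lf (nv C i) (nv C j) <= M.
  exact: (le_bigmax 1 (fun ij : 'I_4 * 'I_4 => lf (nv C ij.1) (nv C ij.2)) (i, j)).
exists (2 * m * (m / M)).
  by rewrite !mulr_gt0// invr_gt0; lra.
move=> w rw; rewrite -(f_NN F).
exact: (bf_act_growth (@lfC K) (@lfP K) (lf_nv C) n_gt1 frame_gram m0 M1 mle leM rw).
Qed.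

(** As [y] is [kap *: N] plus a future vector, the growth for [N] passes to [y]. The constant
    depends on [kap] alone and therefore serves a whole neighbourhood. *)
Lemma size_bound (kap : K) : 0 < kap -> exists2 d, 0 < d & forall y w D,
  ftl (y - kap *: N) -> reduced (@lf K) (nv C) w -> - D <= lf (act w y) N ->
  (size w)%:R <= d * D.
Proof.
move=> kap0; have [d d0 dw] := act_growth.
exists (kap * d)^-1 => [|y w D yf rw Dw]; first by rewrite invr_gt0 mulr_gt0.
have rrw : reduced (@lf K) (nv C) (rev w).
  exact: (reduced_rev (@lfP K) (lf_nv C)).
have := lf_ftl_lt0 yf (ftl_act C (rev w) (f_ftl F)).
have := dw _ rrw; rewrite size_rev => gr.
rewrite !lin (lfC N) => yN; rewrite mulrC ler_pdivlMr ?mulr_gt0//.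
have kk : kap * (lf (act (rev w) N) N) <= kap * (-1 - d * (size w)%:R).
  by rewrite ler_wpM2l// ltW.
rewrite lf_actl in Dw.
lra.
Qed.

(** If the first coordinate [A] were positive, then completing the square would make [A] times the
    pairing with a point of the half-space positive. *)
Lemma future_le0 (x y : vec) : ftl y -> lf x x <= 0 -> lf x y < 0 -> x.1.1.1 <= 0.
Proof.
move=> yf xx xy; have [a a0 yE] := pvec_hpt yf; have := H3_gt0 (hpt y).
have {xy} : lf x (pvec (set_val (hpt y))) < 0 by rewrite yE !lin pmulr_rlt0.
case: (set_val _) => [[u v] r] /= + r0.
case: x xx => [[[A b1] b2] D]; rewrite /lf /= => xx xy; rewrite leNgt; apply/negP => A0.
have := sqr_ge0 (A * u + b1); have := sqr_ge0 (A * v + b2).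
have : 0 < (A * r) ^+ 2 by rewrite exprn_gt0// mulr_gt0.
have : A * (A * (u ^+ 2 + v ^+ 2 + r ^+ 2) + 2 * (b1 * u + b2 * v) + D) < 0.
  rewrite pmulr_rlt0//; lra.
lra.
Qed.

Lemma ftl_future (x y : vec) : ftl y -> lf x x < 0 -> lf x y < 0 -> ftl x.
Proof.
move=> yf xx xy; split=> //; rewrite lt_neqAle (future_le0 yf (ltW xx) xy) andbT.
move: xx; case: x xy => [[[A b1] b2] D] _; rewrite /lf /= => xx; apply/eqP => A0.
move: xx; rewrite A0 mul0r mulr0 add0r mul0r subr0; have := sqr_ge0 b1; have := sqr_ge0 b2.
lra.
Qed.

Lemma shrink_ftl (y : vec) (kap : K) : 0 < kap -> lf y N + kap < 0 ->
  lf y y - 2 * kap * lf y N < 0 -> ftl (y - kap *: N).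
Proof.
move=> kap0 yN yy; apply: (ftl_future (f_ftl F)); rewrite !lin !orth; last lra.
have : 0 < kap ^+ 2 by rewrite exprn_gt0.
rewrite (lfC N); lra.
Qed.

Lemma archi_le (x : K) : exists m : nat, x <= m%:R.
Proof.
by exists (Num.bound `|x|); rewrite (le_trans (ler_norm x))// ltW// archi_boundP.
Qed.

Lemma shrink_ex (y : vec) : ftl y -> exists2 kap, 0 < kap & ftl (y - kap *: N).
Proof.
move=> yf; have yN := lf_ftl_lt0 yf (f_ftl F); have [_ yy] := yf.
have p0 : 0 < lf y y / (4 * lf y N) by rewrite nmulr_rgt0// invr_lt0; lra.
exists (Num.min (- lf y N / 2) (lf y y / (4 * lf y N))).
  by rewrite lt_min p0 andbT; lra.
set kap := Num.min _ _.
have k1 : kap <= - lf y N / 2 by rewrite ge_min lexx.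
have k2 : kap <= lf y y / (4 * lf y N) by rewrite ge_min lexx orbT.
have k0 : 0 < kap by rewrite lt_min p0 andbT; lra.
apply: shrink_ftl => //; first lra.
have : kap * (4 * lf y N) >= lf y y by rewrite -ler_ndivlMr//; lra.
lra.
Qed.

Lemma fold_frame (J : pred 'I_4) (w : H3 K) :
  exists2 g, all J g & forall j, J j -> 0 <= lf (act g (pvec (set_val w))) (nv C j).
Proof.
apply: (fold_chamber (@lfC K) (@lfP K) J fN_chamber) => D.
have [kap k0 kf] := shrink_ex (ftl_pvec w).
have [d d0 dw] := size_bound k0; have [m mle] := archi_le (d * - D).
exists m => g rg Dg; rewrite -(ler_nat K); apply: le_trans mle.
by apply: dw kf rg _; rewrite opprK.
Qed.

(** * The limit set and the convex hull *)

Lemma limit_antidominant (z : Chat K) g lam :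
  limit_set C z -> antidominant lam -> 0 <= lf (cpvec z) (act g lam).
Proof.
move=> [w clz] lam_anti; have [h _ hv] := fold_frame predT w.
(* [c] may be negative, as [w] is arbitrary. A translate satisfies the bound [a * c], where [a] is
   the ratio of its height to that of [w]; so the deficit is proportional to the height and
   disappears on the sphere. *)
pose c := lf (act h (pvec (set_val w))) lam; have w0 := H3_gt0 w.
apply: (@closure_lf_ge0 _ (Gamma_orbit C w) _ (- c / (set_val w).2)) clz.
move=> _ [g' _ <-]; have [a a0 E] := pvec_act C g' w.
have -> : (set_val (act_H3 C g' w)).2 = a * (set_val w).2.
  have : lf (pvec (set_val (act_H3 C g' w))) (pvec (set_val (act_H3 C g' w))) =
      a ^+ 2 * lf (pvec (set_val w)) (pvec (set_val w)) by rewrite E !lin lf_act; ring.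
  rewrite !lf_pvec => sq; apply/eqP; rewrite -(@eqrXn2 _ 2)// ?ltW ?mulr_gt0 ?H3_gt0//.
  apply/eqP; rewrite exprMn; lra.
have -> : - (- c / (set_val w).2 * (a * (set_val w).2)) = a * c.
  by field; rewrite lt0r_neq0.
rewrite E !lin ler_wpM2l ?(ltW a0)// lfC lf_actl lfC -actv_cat.
have -> : act (rev g ++ g') (pvec (set_val w)) =
    act ((rev g ++ g') ++ rev h) (act h (pvec (set_val w))).
  by rewrite [RHS]actv_cat act_revK.
have {}hv i : 0 <= lf (act h (pvec (set_val w))) (nv C i) by exact: hv.
exact: (act_antidominant).
Qed.

(** The points satisfying all inequalities that [limit_antidominant] gives for
    the convex hull. *)
Definition ahull (w : H3 K) : Prop := forall lam g, antidominant lam ->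
  0 <= lf (act g (pvec (set_val w))) lam.

Lemma hull_ahull w : hull C w -> ahull w.
Proof.
move=> hw lam g lam_anti.
have [B BE] : exists B : circle K, cvec B = act (rev g) lam.
  by apply: circle_of_vec; rewrite lf_act; case: lam_anti.
rewrite lf_actl -BE lf_cform; apply: hw => z zL.
by rewrite -lf_cform_Chat BE; exact: limit_antidominant.
Qed.

Lemma ahull_act g w : ahull w -> ahull (act_H3 C g w).
Proof.
move=> aw lam h lam_anti; have [a a0 ->] := pvec_act C g w.
by rewrite actZ -actv_cat !lin mulr_ge0 ?(ltW a0)//; exact: aw.
Qed.

Lemma Nstar_ahull w : Nstar (to_orbifold C w) -> ahull w.
Proof.
move=> /interior_subset[w' hw' /to_orbifold_eq[g _ ->]].
exact/ahull_act/hull_ahull.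
Qed.

Lemma near_Nstar w : Nstar (to_orbifold C w) ->
  \forall w' \near w, Nstar (to_orbifold C w').
Proof.
move=> Nw; have : open (to_orbifold C @^-1` @Nstar K C).
  by apply: open_comp (@open_interior _ _) => x _; exact: to_orbifold_continuous.
by rewrite openE => /(_ _ Nw).
Qed.

(** * Limit points *)

Lemma chat_of_null (x : vec) : lf x x = 0 -> lf x N < 0 ->
  exists z : Chat K, exists2 a, 0 < a & cpvec z = a *: x.
Proof.
move=> xx xN; have xx0 : lf x x <= 0 by rewrite xx.
have := future_le0 (f_ftl F) xx0 xN.
rewrite le_eqVlt => /orP[/eqP A0|A0]; last first.
  exists (Some (- x.1.1.2 / x.1.1.1, - x.1.2 / x.1.1.1)), (- 2 / x.1.1.1).
    by rewrite mulNr -mulrN -invrN divr_gt0// oppr_gt0.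
  have An0 := ltr0_neq0 A0; move: xx; rewrite vecZE /pvec /lf /= => xx.
  have xD : x.2 = (x.1.1.2 ^+ 2 + x.1.2 ^+ 2) / x.1.1.1.
    by apply: (mulfI An0); rewrite (mulrC _ (_ / _)) divfK//; lra.
  by rewrite xD; congr (_, _, _, _); rewrite /=; field.
have [N0 _] := f_ftl F.
move: xx xN; case: x {xx0} A0 => [[[A b1] b2] D] /= ->; rewrite /lf /= => xx xN.
have /eqP : b1 ^+ 2 + b2 ^+ 2 = 0 by lra.
rewrite paddr_eq0 ?sqr_ge0// !sqrf_eq0 => /andP[/eqP b10 /eqP b20].
have D0 : D < 0.
  by move: xN; rewrite b10 b20 !mul0r; nra.
exists None, (- 2 / D); first by rewrite mulNr -mulrN -invrN divr_gt0// oppr_gt0.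
by rewrite vecZE /= b10 b20 !mulr0 divfK// ltr0_neq0.
Qed.

Lemma limit_point (y : vec) (g : nat -> seq 'I_4) (a : nat -> K) (x : vec) :
  ftl y -> (forall j, ~~ odd (size (g j))) -> (forall j, 0 < a j) ->
  a j *: act (g j) y @[j --> \oo] --> x -> lf x x = 0 -> lf x N < 0 ->
  exists2 z, limit_set C z & exists2 b, 0 < b & cpvec z = b *: x.
Proof.
move=> yf ge a0 gx xx xN; have [z [b b0 zE]] := chat_of_null xx xN.
exists z; last by exists b.
exists (hpt y) => A zA.
have lim : b *: (a j *: act (g j) y) @[j --> \oo] --> cpvec z.
  by rewrite zE; apply: cvg_scale_vec; [exact: cvg_cst|exact: gx].
have fj j : ftl (b *: (a j *: act (g j) y)).
  by do 2!apply: ftlZ => //; exact: ftl_act.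
have /lim [j _ /(_ j (leqnn j)) /= Aj] := cvg_S3 zA.
exists (H3_in_S3 (act_H3 C (g j) (hpt y))); split.
  by exists (act_H3 C (g j) (hpt y)) => //; exists (g j) => //; exact: Gamma_even.
by have := Aj (fj j); rewrite !hptZ// -act_hpt.
Qed.

(** * The plane meets the interior of the convex core *)

Notation N2 := fN2. Notation g0 := fg. Notation p := fp. Notation b0 := fb.
Notation tau := ftau.

Definition loop (j i : 'I_4) (m : nat) : seq 'I_4 := iter m (cat [:: j; i]) [::].

Lemma loop_even j i m : ~~ odd (size (loop j i m)).
Proof. by elim: m => //= m ->. Qed.

(** The product of the reflections across two opposite planes is a boost along their
    common perpendicular, whose end points are represented by [T + e] and [T - e]. *)
Lemma boost_refl i (T e : vec) (c d : K) : lf T T = -1 -> lf e e = 1 -> lf T e = 0 ->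
  c ^+ 2 = 1 + d ^+ 2 -> nv C i = c *: e - d *: T ->
  reflv (@lf K) (nv C) i (T + e) = (c + d) ^+ 2 *: (T - e).
Proof.
move=> TT ee Te cd vE; rewrite /reflv vE !lin TT ee Te (lfC e T) Te.
move: T e {TT ee Te vE} => [[[T1 T2] T3] T4] [[[x1 x2] x3] x4].
have c2 : (c + d) ^+ 2 = 1 + 2 * d ^+ 2 + 2 * c * d by rewrite sqrrD cd; ring.
have E (a b : K) : (a + b) - 2 * (c * 0 - d * -1 + (c * 1 - d * 0)) * (c * b - d * a) =
   (c + d) ^+ 2 * (a - b).
  rewrite c2; have -> : (a + b) - 2 * (c * 0 - d * -1 + (c * 1 - d * 0)) * (c * b - d * a) =
    a + b - 2 * (d * c - d ^+ 2 * 1) * 0 - 2 * (c ^+ 2 * b + d * c * b - d * c * a - d ^+ 2 * a) by ring.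
  by rewrite cd; ring.
by rewrite !vecZE !vecBE !vecDE /= -!E.
Qed.

Section Boost.
Variables (i j : 'I_4) (T e : vec) (c d : K).
Hypotheses (TT : lf T T = -1) (ee : lf e e = 1) (Te : lf T e = 0).
Hypotheses (cd : c ^+ 2 = 1 + d ^+ 2) (c0 : 0 < c) (d0 : 0 < d).
Hypotheses (vi : nv C i = c *: e - d *: T) (vj : nv C j = - c *: e - d *: T).

(** Each of the two reflections contributes [(c - d) ^+ 2], the inverse of [(c + d) ^+ 2]. *)
Let mu := (c - d) ^+ 4.
Let mu_inv : mu * (c + d) ^+ 4 = 1.
Proof. by rewrite /mu -exprMn -subr_sqr cd addrK expr1n. Qed.
Let mu_gt0 : 0 < mu.
Proof. by rewrite -(pmulr_lgt0 _ (exprn_gt0 4 (addr_gt0 c0 d0))) mu_inv ltr01. Qed.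
Let mu_lt1 : mu < 1.
Proof.
have [c0' d0'] := (ltW c0, ltW d0).
have cd1 : c < 1 + d.
  have d1 : 0 <= 1 + d by lra.
  by rewrite -ltr_sqr// cd (_ : (1 + d) ^+ 2 = 1 + d ^+ 2 + 2 * d); [rewrite ltrDl mulr_gt0|ring].
have cd0 : d < c by rewrite -ltr_sqr// cd ltrDr ltr01.
rewrite /mu exprn_ilt1//; first by rewrite subr_ge0 ltW.
by rewrite ltrBlDl addrC.
Qed.

Lemma boost_contract : act [:: i; j] (T + e) = mu *: (T + e).
Proof.
have Tne : lf T (- e) = 0 by rewrite !lin Te oppr0.
have nene : lf (- e) (- e) = 1 by rewrite !lin opprK.
have vi' : nv C i = - c *: - e - d *: T by rewrite vi scaleNr scalerN opprK.
have cd' : (- c) ^+ 2 = 1 + d ^+ 2 by rewrite sqrrN.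
rewrite /= (boost_refl TT ee Te cd' vj) (reflvZ (nv C) (@lfP K)).
rewrite (boost_refl TT nene Tne cd' vi') opprK scalerA /mu; congr (_ *: _); ring.
Qed.

Lemma boost_expand : act [:: j; i] (T + e) = mu^-1 *: (T + e).
Proof.
have E := actvK_rev (@lfP K) (lf_nv C) [:: j; i] (T + e).
rewrite -[in RHS]E -[rev _]/[:: i; j] boost_contract actZ scalerA mulVf ?scale1r//.
exact: lt0r_neq0.
Qed.

Lemma boost_loop m : act (loop i j m) (T + e) = mu ^+ m *: (T + e).
Proof.
elim: m => [|m IH]; first by rewrite expr0 scale1r.
by rewrite [loop _ _ _]/= -[_ :: _]/([:: i; j] ++ loop i j m) actv_cat IH actZ
  boost_contract scalerA -exprSr.
Qed.

Lemma boost_mu : 0 < mu < 1. Proof. by rewrite mu_gt0 mu_lt1. Qed.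

End Boost.

(** [T] is half the sum of [T + e], which is contracted by [mu], and [T - e], which is expanded by
    its inverse; the scalars [2 * mu ^+ m] keep the second part constant. *)
Lemma boost_cvg i j (T e : vec) (c d : K) : lf T T = -1 -> lf e e = 1 -> lf T e = 0 ->
  c ^+ 2 = 1 + d ^+ 2 -> 0 < c -> 0 < d ->
  nv C i = c *: e - d *: T -> nv C j = - c *: e - d *: T ->
  exists2 a : nat -> K, (forall m, 0 < a m) & a m *: act (loop i j m) T @[m --> \oo] --> T - e.
Proof.
move=> TT ee Te cd c0 d0 vi vj.
have Tne : lf T (- e) = 0 by rewrite !lin Te oppr0.
have nene : lf (- e) (- e) = 1 by rewrite !lin opprK.
have vi' : nv C i = - c *: - e - d *: T by rewrite vi scaleNr scalerN opprK.
have vj' : nv C j = c *: - e - d *: T by rewrite vj scaleNr scalerN.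
pose mu := (c - d) ^+ 4.
have /andP[mu0 mu1] : 0 < mu < 1 by exact: (boost_mu cd c0 d0).
have Lm m : act (loop i j m) (T - e) = (mu^-1) ^+ m *: (T - e).
  elim: m => [|m IH]; first by rewrite expr0 scale1r.
  rewrite [loop _ _ _]/= -[_ :: _]/([:: i; j] ++ loop i j m) actv_cat IH actZ.
  by rewrite (boost_expand TT nene Tne cd c0 d0 vj' vi') scalerA -exprSr.
exists (fun m => 2 * mu ^+ m); first by move=> m /=; apply: mulr_gt0; [lra|exact: exprn_gt0].
have -> : (fun m => (2 * mu ^+ m) *: act (loop i j m) T) =
    (fun m => (T - e) + (mu ^+ m * mu ^+ m) *: (T + e)).
  apply/funext => m; have {1}-> : T = 2^-1 *: ((T + e) + (T - e)).
    have TT2 : T + T = (2 : K) *: T by rewrite scaler_nat mulr2n.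
    by rewrite addrACA subrr addr0 TT2 scalerA mulVf ?scale1r ?pnatr_eq0.
  rewrite actZ actvD; last exact: lfP.
  rewrite (boost_loop TT ee Te cd vi vj) Lm scalerA scalerDr !scalerA addrC.
  have mun : mu ^+ m != 0 by rewrite expf_neq0// lt0r_neq0.
  rewrite -[in RHS](scale1r (T - e)) -/mu exprVn; move: (mu ^+ m) mun => x x0.
  by apply: (congr2 (fun a b => a *: (T - e) + b *: (T + e))); field.
have h : mu ^+ m @[m --> \oo] --> 0 by apply: cvg_expr; rewrite gtr0_norm.
have := cvgD (cvg_cst (T - e)) (cvg_scale_vec (cvgM h h) (cvg_cst (T + e))).
by rewrite mulr0 scale0r addr0; apply.
Qed.

Lemma N2N2 : lf N2 N2 = -1.
Proof. by rewrite /fN2 !lin !orth; have := f_t F; lra. Qed.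
Lemma N2e2 : lf N2 e2 = 0.
Proof. by rewrite /fN2 !lin !orth; lra. Qed.
Lemma ftl_N2 : ftl N2.
Proof.
apply: (ftl_future (f_ftl F)); first by rewrite N2N2; lra.
by rewrite /fN2 !lin !orth; have := f_ct0 F; lra.
Qed.

Definition limq (e : K) : vec := N + e *: e1.
Definition limp : vec := N2 - e2.
(** The points [limq] lie on the plane of [fb] and [limp] strictly on its negative side; this mirror
    image is a limit point on the positive side, so the tetrahedron crosses the plane. *)
Definition limr : vec := act [:: t] (limq 1).

Definition limv (x : vec) : Prop :=
  exists2 z : Chat K, limit_set C z & exists2 b, 0 < b & cpvec z = b *: x.

Lemma limq_limit e : e = 1 \/ e = -1 -> limv (limq e).
Proof.
have [[w w'] [h h']] := ((f_cw0 F, f_sw0 F), (f_w F, f_N1 F)).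
have ee : lf (- e1) (- e1) = 1 by rewrite !lin opprK f_11.
have Ne : lf N (- e1) = 0 by rewrite !lin f_N1 oppr0.
have v0 : nv C 0 = - cw *: - e1 - sw *: N by rewrite (f_v0 F) scaleNr scalerN opprK.
have v2 : nv C 2 = cw *: - e1 - sw *: N by rewrite (f_v2 F) scaleNr scalerN.
case=> ->.
  have [a a0 lim] := boost_cvg (f_NN F) ee Ne h w w' v2 v0.
  apply: limit_point (f_ftl F) (loop_even 2 0) a0 _ _ _; rewrite /limq ?scale1r ?scaleN1r.
  - by rewrite opprK in lim; exact: lim.
  - by rewrite !lin !orth; lra.
  - by rewrite !lin !orth; lra.
have [a a0 lim] := boost_cvg (f_NN F) (f_11 F) (f_N1 F) h w w' (f_v0 F) (f_v2 F).
apply: limit_point (f_ftl F) (loop_even 0 2) a0 _ _ _; rewrite /limq ?scale1r ?scaleN1r //.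
- by rewrite !lin !orth; lra.
- by rewrite !lin !orth; lra.
Qed.

Lemma limp_limit : limv limp.
Proof.
have [a a0 lim] := boost_cvg N2N2 (f_22 F) N2e2 (f_u F) (f_cu0 F) (f_su0 F) (f_vs F) (f_vt F).
apply: limit_point ftl_N2 (loop_even s t) a0 lim _ _; rewrite /fN2.
  by rewrite !lin !orth; have := f_t F; lra.
by rewrite !lin !orth; have := f_ct0 F; lra.
Qed.

Lemma limrE : limr = limq 1 - (2 * (su * ct)) *: nv C t.
Proof.
rewrite /limr /= /reflv /limq; congr (_ - (2 * _) *: _).
by rewrite f_vt !lin !orth; lra.
Qed.

Lemma limr_limit : limv limr.
Proof.
have [[w w'] [h h']] := ((f_cw0 F, f_sw0 F), (f_w F, f_N1 F)).
have ee : lf (- e1) (- e1) = 1 by rewrite !lin opprK f_11.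
have Ne : lf N (- e1) = 0 by rewrite !lin f_N1 oppr0.
have v0 : nv C 0 = - cw *: - e1 - sw *: N by rewrite (f_v0 F) scaleNr scalerN opprK.
have v2 : nv C 2 = cw *: - e1 - sw *: N by rewrite (f_v2 F) scaleNr scalerN.
have [a a0 lim] := boost_cvg (f_NN F) ee Ne h w w' v2 v0.
(* Conjugation by [t] keeps the length even, and the base point is moved by [t] so that the last
   letter cancels. *)
have gev m : ~~ odd (size ([:: t] ++ loop 2 0 m ++ [:: t])).
  by rewrite !size_cat /= addn1 /= negbK; exact: loop_even.
apply: limit_point (ftl_act C [:: t] (f_ftl F)) gev a0 _ _ _.
- have E m : a m *: act ([:: t] ++ loop 2 0 m ++ [:: t]) (act [:: t] N) =
     act [:: t] (a m *: act (loop 2 0 m) N).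
    rewrite !actv_cat actZ; congr (_ *: act _ (act _ _)).
    exact: (act_revK [:: t]).
  rewrite (_ : (fun m => _) = (fun m => act [:: t] (a m *: act (loop 2 0 m) N))); last first.
    exact/funext.
  rewrite opprK in lim; rewrite /limr /limq scale1r.
  rewrite [act [:: t] _]/= [X in X @ _]/= /reflv.
  apply: (cvgB lim); apply: cvg_scale_vec; last exact: cvg_cst.
  by apply: cvgM; [exact: cvg_cst|exact: (cvg_lf lim (cvg_cst _))].
- by rewrite /limr lf_act /limq scale1r !lin !orth; lra.
- rewrite limrE /limq f_vt !lin !orth; have := sqr_ge0 (su * ct); lra.
Qed.

(** [uq 1], [uq (-1)], [ua] and [ub] form the basis dual to the four limit points
    [limq 1], [limq (-1)], [limp] and [limr]. *)
Definition ub : vec := (2 * su * ct * (su + cu))^-1 *: (st^-1 *: k + e2).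
Definition ua : vec := (2 * su * ct * cu) *: ub - e2.
Definition uq (e : K) : vec :=
  2^-1 *: (- N - ct *: ua - (1 + 2 * su ^+ 2 * ct ^+ 2) *: ub + e *: (e1 - ub)).

Lemma tetra_coord (y lam : vec) : lf y lam =
  lf y (uq 1) * lf (limq 1) lam + lf y (uq (-1)) * lf (limq (-1)) lam +
  lf y ua * lf limp lam + lf y ub * lf limr lam.
Proof.
have su0 := lt0r_neq0 (f_su0 F); have ct0 := lt0r_neq0 (f_ct0 F); have st0 := lt0r_neq0 (f_st0 F).
have sc0 : su + cu != 0 by rewrite lt0r_neq0// addr_gt0 ?f_su0 ?f_cu0.
rewrite {1}(f_complete F y) limrE f_vt /limq /limp /uq /ua /ub /fN2 !lin.
field.
by rewrite su0 ct0 st0 sc0.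
Qed.

(** The coefficients make this point of the tetrahedron lie on the plane [fb]. *)
Definition tetra_pt : vec :=
  limq 1 + limq (-1) + ((cu - su) * su * ct) *: limp + limr.

Lemma cu_gt_su : su < cu.
Proof.
have := f_u F; have := f_cu0 F; have := f_su0 F => a b u.
by rewrite -ltr_sqr ?nnegrE ?ltW// u ltrDr ltr01.
Qed.

Lemma tetra_pt_fb : lf tetra_pt b0 = 0.
Proof. by rewrite /tetra_pt limrE /limq /limp /fb /fN2 f_vt !lin !orth; ring. Qed.

Lemma lf_limq e e' : lf (limq e) (limq e') = e * e' - 1.
Proof. by rewrite /limq !lin !orth; ring. Qed.
Lemma lf_limq_p e : lf (limq e) limp = - ct.
Proof. by rewrite /limq /limp /fN2 !lin !orth; ring. Qed.
Lemma lf_limq_v e : lf (limq e) (nv C t) = su * ct.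
Proof. by rewrite /limq f_vt !lin !orth; ring. Qed.
Lemma lf_limp_v : lf limp (nv C t) = cu + su.
Proof.
apply: (@etrans _ _ (cu + su * (ct ^+ 2 - st ^+ 2))).
  by rewrite /limp f_vt /fN2 !lin !orth; ring.
by rewrite f_t addrK mulr1.
Qed.
Lemma lf_limp_self : lf limp limp = 0.
Proof.
apply: (@etrans _ _ (1 - (ct ^+ 2 - st ^+ 2))); last by rewrite f_t addrK subrr.
by rewrite /limp /fN2 !lin !orth; ring.
Qed.

Lemma ftl_tetra_pt : ftl tetra_pt.
Proof.
have [[a b] [c d]] := ((f_su0 F, f_cu0 F), (f_ct0 F, f_st0 F)).
pose al := (cu - su) * su * ct.
have al0 : 0 < al by rewrite !mulr_gt0// subr_gt0 cu_gt_su.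
have sc : 0 < (su * ct) ^+ 2 by rewrite exprn_gt0// mulr_gt0.
have scs : 0 < su * ct * (cu + su) by rewrite !mulr_gt0// addr_gt0.
have alc : 0 < al * ct by rewrite mulr_gt0.
have als : 0 < al * (su * ct * (cu + su)) by rewrite mulr_gt0.
have E1 : lf tetra_pt N = - (3 + al * ct + 2 * (su * ct) ^+ 2).
  by rewrite /tetra_pt limrE /limq /limp /fN2 f_vt !lin !orth /al; ring.
have E2 : lf tetra_pt tetra_pt = - (8 + 6 * (al * ct) + 8 * (su * ct) ^+ 2
    + 4 * (al * (su * ct * (cu + su)))).
  have rr : lf limr limr = 0 by rewrite /limr lf_act lf_limq; ring.
  have rq e : lf limr (limq e) = e - 1 - 2 * (su * ct) ^+ 2.
    by rewrite limrE (bfBl (@lfP K)) (bfZl (@lfP K)) lf_limq (lfC (nv C t)) lf_limq_v; ring.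
  have rp : lf limr limp = - ct - 2 * (su * ct) * (cu + su).
    by rewrite limrE (bfBl (@lfP K)) (bfZl (@lfP K)) lf_limq_p (lfC (nv C t)) lf_limp_v.
  have pq e : lf limp (limq e) = - ct by rewrite lfC lf_limq_p.
  have qr e : lf (limq e) limr = e - 1 - 2 * (su * ct) ^+ 2 by rewrite lfC rq.
  have pr : lf limp limr = - ct - 2 * (su * ct) * (cu + su) by rewrite lfC rp.
  rewrite /tetra_pt -/al; move: limr rr rq rp qr pr => r rr rq rp qr pr.
  move: limp lf_limp_self lf_limq_p rp pr pq => q pp qp rp pr pq.
  have qq e e' := lf_limq e e'; move: (limq 1) (limq (-1)) (qq 1 1) (qq 1 (-1)) (qq (-1) 1) (qq (-1) (-1))
     (qp 1) (qp (-1)) (pq 1) (pq (-1)) (rq 1) (rq (-1)) (qr 1) (qr (-1)).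
  move=> x y xx xy yx yy xp yp px py rx ry xr yr.
  by rewrite !lin rr rp pr pp xx xy yx yy xp yp px py rx ry xr yr; ring.
apply: (ftl_future (f_ftl F)); rewrite ?E1 ?E2 oppr_lt0.
  clear E1 E2; lra.
clear E1 E2; lra.
Qed.

Lemma tetra_pt_coord : [/\ 0 < lf tetra_pt (uq 1), 0 < lf tetra_pt (uq (-1)),
  0 < lf tetra_pt ua & 0 < lf tetra_pt ub].
Proof.
have [[a b] [c d]] := ((f_su0 F, f_cu0 F), (f_ct0 F, f_st0 F)); have e := cu_gt_su.
have su0 := lt0r_neq0 (f_su0 F); have ct0 := lt0r_neq0 (f_ct0 F); have st0 := lt0r_neq0 (f_st0 F).
have sc0 : su + cu != 0 by rewrite lt0r_neq0// addr_gt0 ?f_su0 ?f_cu0.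
have ubE : lf tetra_pt ub = 1.
  rewrite /tetra_pt limrE /limq /limp /ub /fN2 f_vt !lin !orth; field.
  by rewrite su0 ct0 st0 sc0.
have tE x : lf tetra_pt x = lf (limq 1) x + lf (limq (-1)) x
    + (cu - su) * su * ct * lf limp x + lf limr x by rewrite /tetra_pt 3!(bfDl (@lfP K)) (bfZl (@lfP K)).
have rE x : lf limr x = lf (limq 1) x - 2 * (su * ct) * lf (nv C t) x.
  by rewrite limrE (bfBl (@lfP K)) (bfZl (@lfP K)).
have [t2 [tN t1]] : lf tetra_pt e2 = - ((cu - su) * su * ct) + 2 * (su * ct) * cu /\
    (lf tetra_pt N = - (3 + (cu - su) * su * ct * ct + 2 * (su * ct) ^+ 2) /\ lf tetra_pt e1 = 1).
  by rewrite !tE !rE /limq /limp /fN2 f_vt !lin !orth; split; [|split]; ring.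
have uaE : lf tetra_pt ua = (cu - su) * su * ct.
  by rewrite /ua (bfBr (@lfC K) (@lfP K)) (bfZr (@lfC K) (@lfP K)) ubE t2; ring.
have uqE e' : lf tetra_pt (uq e') = 1.
  rewrite /uq; move: tN t1 uaE ubE; clear tE t2; move: tetra_pt ub ua => T x y tN t1 yE xE.
  by rewrite !lin xE yE tN t1; field.
by rewrite !uqE uaE ubE ltr01 !mulr_gt0// subr_gt0.
Qed.

(** A half-space containing the limit set pairs nonnegatively with the four limit vectors, and [y]
    is a positive combination of them. *)
Lemma hull_tetra (w : H3 K) (y : vec) : y = pvec (set_val w) ->
  0 < lf y (uq 1) -> 0 < lf y (uq (-1)) -> 0 < lf y ua -> 0 < lf y ub -> hull C w.
Proof.
move=> yE y1 y2 y3 y4 B BL; rewrite -lf_cform -yE tetra_coord.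
have lim_ge0 x : limv x -> 0 <= lf x (cvec B).
  move=> [z /BL]; rewrite -lf_cform_Chat => zB [b b0 zE].
  by move: zB; rewrite zE !lin pmulr_rge0.
have q1 := lim_ge0 _ (limq_limit (or_introl erefl)).
have q2 := lim_ge0 _ (limq_limit (or_intror erefl)).
have [q3 q4] := (lim_ge0 _ limp_limit, lim_ge0 _ limr_limit).
have M (a b : K) : 0 < a -> 0 <= b -> 0 <= a * b by move=> a0 b0; rewrite mulr_ge0// ltW.
exact: (addr_ge0 (addr_ge0 (addr_ge0 (M _ _ y1 q1) (M _ _ y2 q2)) (M _ _ y3 q3)) (M _ _ y4 q4)).
Qed.

Lemma tetra_open : exists u1 u2 u3 u4 : vec,
  [/\ 0 < lf tetra_pt u1, 0 < lf tetra_pt u2, 0 < lf tetra_pt u3 & 0 < lf tetra_pt u4] /\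
  forall w : H3 K, 0 < lf (pvec (set_val w)) u1 -> 0 < lf (pvec (set_val w)) u2 ->
    0 < lf (pvec (set_val w)) u3 -> 0 < lf (pvec (set_val w)) u4 -> hull C w.
Proof.
exists (uq 1), (uq (-1)), ua, ub; split; first exact: tetra_pt_coord.
by move=> w; exact: hull_tetra.
Qed.

Lemma plane_meets_Nstar (B : circle K) (r : K) : cvec B = r *: b0 ->
  @image_plane K C B `&` @Nstar K C !=set0.
Proof.
move=> BE; have yf := ftl_tetra_pt; set w := hpt tetra_pt.
have [a a0 wE] := pvec_hpt yf; rewrite -/w in wE.
exists (to_orbifold C w); split.
  by exists w => //; rewrite /hplane /= -lf_cform wE BE (bfZl (@lfP K)) (bfZr (@lfC K) (@lfP K)) tetra_pt_fb !mulr0.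
have pos u : 0 < lf tetra_pt u -> \forall w' \near w, 0 < lf (pvec (set_val w')) u.
  move=> u0; have lim := @cvg_lf_H3 _ w u.
  have wu : 0 < lf (pvec (set_val w)) u by rewrite wE (bfZl (@lfP K)) mulr_gt0.
  exact: (cvgr_gt _ lim _ wu).
have [u1 [u2 [u3 [u4 [[/pos n1 /pos n2 /pos n3 /pos n4] hu]]]]] := tetra_open.
have : \forall w' \near w, hull C w'.
  by near=> w'; apply: hu; near: w'.
move=> hw; have oU : open (to_orbifold C @` (hull C)°).
  by apply: to_orbifold_open; exact: open_interior.
rewrite /Nstar /interior /=; apply: (filterS _ (open_nbhs_nbhs (conj oU _))).
  by apply: image_subset; exact: interior_subset.
by exists w => //; exact: nbhs_singleton (nbhs_interior hw).
Unshelve. all: by end_near. Qed.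

(** * The plane is closed in the interior of the convex core *)

Lemma fb_v02 : lf b0 (nv C 0) = 0 /\ lf b0 (nv C 2) = 0.
Proof. by rewrite (f_v0 F) (f_v2 F) /fb !lin !orth; split; ring. Qed.

Lemma act_fb g x : all [in [:: 0; 2]] g -> lf (act g x) b0 = lf x b0.
Proof.
have [v0 v2] := fb_v02.
elim: g => //= i g IH /andP[]; rewrite !inE => /orP[]/eqP-> /IH <-;
  by rewrite /reflv (bfBl (@lfP K)) (bfZl (@lfP K)) (lfC (nv C _)) ?v0 ?v2 mulr0 subr0.
Qed.

(** As the reflection across [C 0] preserves the plane, words of odd length do no
    harm. *)
Lemma image_planeP (B : circle K) (r : K) w : r != 0 -> cvec B = r *: b0 ->
  @image_plane K C B (to_orbifold C w) <->
  exists g, lf (act g (pvec (set_val w))) b0 = 0.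
Proof.
move=> r0 BE; have planeE w' g : hplane B (act_H3 C g w') <-> lf (act g (pvec (set_val w'))) b0 = 0.
  rewrite hplane_act BE (bfZr (@lfC K) (@lfP K)); split=> [/eqP|->]; last by rewrite mulr0.
  by rewrite mulf_eq0 (negPf r0) => /eqP.
split=> [[w' Bw' /to_orbifold_eq[g _ wE]]|[g gw]].
  by exists (rev g); apply/planeE; rewrite wE act_H3_revK.
have [h hG hw] : exists2 h, Gamma C h & lf (act h (pvec (set_val w))) b0 = 0.
  have [og|og] := boolP (odd (size g)); last by exists g => //; exact: Gamma_even.
  exists ([:: 0] ++ g); first by apply: Gamma_even; rewrite /= negbK.
  by rewrite actv_cat act_fb.
exists (act_H3 C h w); first exact/planeE.
by apply/esym/to_orbifold_eq; exists h.
Qed.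

(** Factoring [x ^+ 2 - Z ^+ 2 = m + y ^+ 2] and bounding [y] by [x - Z] gives an upper bound for
    [Z], nearly [(1 - T) / (1 + T) * x]. Bounding [y] by [x] gives [Z ^+ 2 >= (1 - T) * x ^+ 2 - m].
    For large [x] the two are incompatible. *)
Lemma pentagon_bound (T eps m1 : K) : 0 < T < 1 -> 0 < eps -> 0 <= m1 ->
  exists M, forall m x Z y, m <= m1 -> 0 <= Z -> eps <= x - Z ->
    x ^+ 2 = m + Z ^+ 2 + y ^+ 2 -> T * y ^+ 2 <= (x - Z) ^+ 2 -> y ^+ 2 <= T * x ^+ 2 ->
    x <= M.
Proof.
move=> /andP[T0 T1] eps0 m10.
(* [al] is [(1 + T) ^+ 2 * (1 - T) - (1 - T) ^+ 2], the leading coefficient when the squared upper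
   bound meets the lower bound; [be] and [ga] are the remaining coefficients. *)
pose c1 := T * m1 / eps; pose al := (1 - T) * (3 * T + T ^+ 2).
pose be := 2 * (1 - T) * c1; pose ga := c1 ^+ 2 + (1 + T) ^+ 2 * m1.
have c10 : 0 <= c1 by rewrite divr_ge0 ?mulr_ge0// ltW.
have al0 : 0 < al by rewrite mulr_gt0 ?subr_gt0// addr_gt0 ?mulr_gt0 ?exprn_gt0.
have T1' : 0 <= 1 - T by lra.
have be0 : 0 <= be by apply: mulr_ge0 => //; apply: mulr_ge0.
have ga0 : 0 <= ga.
  by apply: addr_ge0; [exact: sqr_ge0|apply: mulr_ge0 => //; exact: sqr_ge0].
exists (1 + (be + ga) / al) => m x Z y mm1 Z0 xZ xE Ty yT.
pose d := x - Z; have d0 : 0 < d by rewrite (lt_le_trans eps0).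
have ec : eps * c1 = T * m1 by rewrite /c1 mulrC divfK// lt0r_neq0.
have H1 : T * (x + Z) <= c1 + d.
  rewrite -(ler_pM2r d0).
  have mE : m = x ^+ 2 - Z ^+ 2 - y ^+ 2 by rewrite xE; ring.
  have -> : T * (x + Z) * d = T * (m + y ^+ 2) by rewrite mE /d; ring.
  have : eps * c1 <= d * c1 by rewrite ler_wpM2r.
  have : T * m <= T * m1 by rewrite ler_wpM2l// ltW.
  rewrite ec; move: Ty; rewrite -/d; lra.
have H2 : (1 + T) * Z <= (1 - T) * x + c1 by move: H1; rewrite /d; lra.
have H3 : ((1 + T) * Z) ^+ 2 <= ((1 - T) * x + c1) ^+ 2.
  by rewrite lerXn2r ?nnegrE ?mulr_ge0//; [lra|apply: le_trans H2; rewrite mulr_ge0//; lra].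
have H4 : al * x ^+ 2 <= be * x + ga.
  have : (1 + T) ^+ 2 * ((1 - T) * x ^+ 2 - m1) <= (1 + T) ^+ 2 * Z ^+ 2.
    by rewrite ler_wpM2l ?sqr_ge0//; lra.
  by move: H3; rewrite /al /be /ga exprMn; lra.
rewrite leNgt; apply/negP => xM.
have q0 : 0 <= (be + ga) / al by apply: divr_ge0; [exact: addr_ge0|exact: ltW].
have x1 : 1 < x by lra.
have H5 : be + ga < al * x.
  rewrite -ltr_pdivrMl// mulrC; lra.
have : (be + ga) * x < al * x * x by rewrite ltr_pM2r//; lra.
have : ga * 1 <= ga * x by rewrite ler_wpM2l// ltW.
by rewrite mulr1; move: H4; lra.
Qed.

(** In the plane [fb], the part of the hull between [C 0] and [C 2] is unbounded only
    towards the plane [fg]. *)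
Lemma plane_bound (eps m1 : K) : 0 < eps -> 0 <= m1 -> exists M, forall z : vec,
  - m1 <= lf z z -> lf z b0 = 0 -> 0 <= lf z (nv C 0) -> 0 <= lf z (nv C 2) ->
  0 <= lf z k -> 0 <= lf z (tau 1) -> 0 <= lf z (tau (-1)) -> eps * st <= lf z g0 ->
  - M <= lf z N.
Proof.
move=> eps0 m10; have [[w0 w1] [c0 s0]] := ((f_sw0 F, f_cw0 F), (f_ct0 F, f_st0 F)).
pose q := sw / cw; have q0 : 0 < q by rewrite divr_gt0.
have qcw : q * cw = sw by rewrite /q divfK// lt0r_neq0.
have cw2 : 0 < cw ^+ 2 by rewrite exprn_gt0.
have T01 : 0 < q ^+ 2 < 1.
  rewrite exprn_gt0//= /q expr_div_n ltr_pdivrMr// mul1r (f_w F); lra.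
have [M MP] := pentagon_bound T01 eps0 m10; exists M => z.
pose x := - lf z N; pose y := lf z e1; pose z2 := lf z e2; pose zk := lf z k.
have zz : lf z z = - x ^+ 2 + zk ^+ 2 + y ^+ 2 + z2 ^+ 2.
  rewrite {1 2}(f_complete F z) -/x -/y -/z2 -/zk.
  by move: x y z2 zk => x y z2 zk; rewrite !lin !orth; ring.
have -> : lf z b0 = st * z2 - zk by rewrite /fb /z2 /zk !lin.
have -> : lf z (nv C 0) = cw * y + sw * x by rewrite (f_v0 F) /y /x !lin; ring.
have -> : lf z (nv C 2) = - cw * y + sw * x by rewrite (f_v2 F) /y /x !lin; ring.
have g0E : lf z g0 = st * x - ct * zk by rewrite /fg /x /zk !lin; ring.
have tauE e : lf z (tau e) = st * x - ct * zk + e * (q * st) * y by rewrite /ftau -g0E !lin.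
rewrite !tauE g0E zz -/zk => mz /eqP; rewrite subr_eq0 => /eqP zkE v0 v2 zk0 t1 t2 gz.
(* On the plane [zk = st * z2], so the inequality of [k] fixes the sign of [z2], and that of [fg]
   becomes one on [x - Z]. *)
have z20 : 0 <= z2 by rewrite -(pmulr_rge0 _ s0) zkE.
pose Z := ct * z2; have Z0 : 0 <= Z by rewrite mulr_ge0// ltW.
have gE : st * x - ct * zk = st * (x - Z) by rewrite /Z -zkE; ring.
have xZ : eps <= x - Z by move: gz; rewrite gE mulrC ler_pM2l.
have x0 : 0 <= x by lra.
have ZZ : Z ^+ 2 = zk ^+ 2 + z2 ^+ 2 by rewrite /Z -zkE exprMn (f_t F); ring.
have qy1 : 0 <= (x - Z) + q * y.
  by rewrite -(pmulr_rge0 _ s0); move: t1; rewrite gE; lra.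
have qy2 : 0 <= (x - Z) - q * y.
  by rewrite -(pmulr_rge0 _ s0); move: t2; rewrite gE; lra.
have y1 : 0 <= q * x + y by rewrite -(pmulr_rge0 _ w1); move: v0; rewrite -qcw; lra.
have y2 : 0 <= q * x - y by rewrite -(pmulr_rge0 _ w1); move: v2; rewrite -qcw; lra.
suff : x <= M by rewrite /x; lra.
apply: (MP (- lf z z) x Z y) => //.
- rewrite zz; lra.
- rewrite zz ZZ; ring.
- have := mulr_ge0 qy1 qy2.
  have -> : (x - Z + q * y) * (x - Z - q * y) = (x - Z) ^+ 2 - q ^+ 2 * y ^+ 2 by ring.
  lra.
- have := mulr_ge0 y1 y2.
  have -> : (q * x + y) * (q * x - y) = q ^+ 2 * x ^+ 2 - y ^+ 2 by ring.
  lra.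
Qed.

(** In the interior, a uniform multiple of [N] can be subtracted without leaving the region [ahull].
    Hence each translate of a nearby point pairs with [fg] to at least [d] times what the translate
    of [N] does; this is the local lower bound for the distance to the translates of the plane of
    [fg]. *)
Lemma near_shrink w : Nstar (to_orbifold C w) -> exists2 d, 0 < d &
  \forall w' \near w, ftl (pvec (set_val w') - d *: N) /\
    ahull (hpt (pvec (set_val w') - d *: N)).
Proof.
move=> Nw; have nU := near_Nstar Nw.
pose f (w' : H3 K) (d : K) : vec := pvec (set_val w') - d *: N.
have f_d : f w d @[d --> 0^'+] --> pvec (set_val w).
  have h : (d *: N) @[d --> 0^'+] --> (0 : K) *: N.
    by apply: cvg_scale_vec; [exact: cvg_at_right_filter|exact: cvg_cst].
  by have := cvgB (cvg_cst (pvec (set_val w))) h; rewrite scale0r subr0; apply.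
have pf := ftl_pvec w.
have n1 : \forall d \near 0^'+, ftl (f w d) by exact: (f_d _ (near_ftl pf)).
have hU : \forall x \near pvec (set_val w), Nstar (to_orbifold C (hpt x)).
  by have := cvg_hpt pf; rewrite hpt_pvec => h; exact: (h _ nU).
have n2 : \forall d \near 0^'+, Nstar (to_orbifold C (hpt (f w d))) by exact: (f_d _ hU).
have : \forall d \near (0 : K)^'+, (0 < d /\ ftl (f w d)) /\ Nstar (to_orbifold C (hpt (f w d))).
  by near=> d; split; [split|]; near: d; [exact: nbhs_right_gt|exact: n1|exact: n2].
move=> /filter_ex[d [[d0 df] dU]]; clear n1 n2.
exists d => //.
have f_w : f w' d @[w' --> w] --> f w d.
  exact: (cvgB (@cvg_pvec_H3 _ w) (cvg_cst (d *: N))).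
have n1 : \forall w' \near w, ftl (f w' d) by exact: (f_w _ (near_ftl df)).
have n2 : \forall w' \near w, Nstar (to_orbifold C (hpt (f w' d))).
  have dU' := near_Nstar dU; exact: (f_w _ (cvg_hpt df dU')).
near=> w'; split; first by near: w'; exact: n1.
by apply: (Nstar_ahull); near: w'; exact: n2.
Unshelve. all: by end_near. Qed.

Lemma near_seq (X : topologicalType) (U : eqType) (x : X) (us : seq U) (P : U -> X -> Prop) :
  (forall u, u \in us -> \forall y \near x, P u y) ->
  \forall y \near x, forall u, u \in us -> P u y.
Proof.
elim: us => [|u us IH] Pus; first exact: nearW.
have n1 : \forall y \near x, P u y by apply: Pus; rewrite mem_head.
have n2 : \forall y \near x, forall v, v \in us -> P v y.
  by apply: IH => v vus; apply: Pus; rewrite inE vus orbT.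
near=> y => v; rewrite inE => /orP[/eqP->|]; first by near: y.
by move: v; near: y.
Unshelve. all: by end_near. Qed.

Lemma orbit_plane_closed (w : H3 K) : Nstar (to_orbifold C w) ->
  (forall V, nbhs w V -> exists2 w', V w' & exists g, lf (act g (pvec (set_val w'))) b0 = 0) ->
  exists g, lf (act g (pvec (set_val w))) b0 = 0.
Proof.
move=> Nw acc; have [d d0 nd] := near_shrink Nw.
pose q := lf (pvec (set_val w)) (pvec (set_val w)); have [_ q0] := ftl_pvec w.
have m10 : 0 <= 1 - q by rewrite /q; lra.
have [M MP] := plane_bound d0 m10; have [e e0 eP] := size_bound d0.
have [L LM] := archi_le (e * M).
have [//|no_g] := pselect (exists g, lf (act g (pvec (set_val w))) b0 = 0).
(* Each of the finitely many short words misses the plane near [w]; the estimate below shows that a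
   nearby hit would produce a short word. *)
have nu u : u \in words _ L -> \forall w' \near w, lf (act u (pvec (set_val w'))) b0 != 0.
  move=> _; have u0 : lf (act u (pvec (set_val w))) b0 != 0.
    by apply/eqP => u0; apply: no_g; exists u.
  have lim : lf (act u (pvec (set_val w'))) b0 @[w' --> w] --> lf (act u (pvec (set_val w))) b0.
    rewrite lf_actl; have -> : (fun w' : H3 K => lf (act u (pvec (set_val w'))) b0) =
      (fun w' => lf (pvec (set_val w')) (act (rev u) b0)) by apply/funext => w'; rewrite lf_actl.
    exact: cvg_lf_H3.
  by move: lim => /cvgr_neq0; apply.
have nus := near_seq nu.
have nm : \forall w' \near w, q - 1 < lf (pvec (set_val w')) (pvec (set_val w')).
  have lim : lf (pvec (set_val w')) (pvec (set_val w')) @[w' --> w] -->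
      lf (pvec (set_val w)) (pvec (set_val w)).
    exact: (cvg_lf (@cvg_pvec_H3 _ w) (@cvg_pvec_H3 _ w)).
  have q1 : q - 1 < lf (pvec (set_val w)) (pvec (set_val w)) by rewrite -/q; lra.
  exact: (cvgr_gt _ lim _ q1).
have nN := near_Nstar Nw.
have : \forall w' \near w, [/\ ftl (pvec (set_val w') - d *: N) /\ ahull (hpt (pvec (set_val w') - d *: N)),
   forall u, u \in words _ L -> lf (act u (pvec (set_val w'))) b0 != 0,
   q - 1 < lf (pvec (set_val w')) (pvec (set_val w')) & Nstar (to_orbifold C w')].
  by near=> w'; split; near: w'; [exact: nd|exact: nus|exact: nm|exact: nN].
move=> /acc[w' [[sf sh] us qw' Nw'] [g gw']].
have [h hJ hv] := fold_frame [in [:: 0; 2]] (act_H3 C g w').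
have [a a0 aE] := pvec_act C g w'.
pose u := h ++ g; have aw := Nstar_ahull Nw'.
have uv i : i \in [:: 0; 2] -> 0 <= lf (act u (pvec (set_val w'))) (nv C i).
  by move/hv; rewrite aE actZ (bfZl (@lfP K)) pmulr_rge0// /u actv_cat.
have ub : lf (act u (pvec (set_val w'))) b0 = 0 by rewrite /u actv_cat act_fb.
have [u' ru' u'E] := reduced_ex (@lf K) (nv C) u.
have : - M <= lf (act u (pvec (set_val w'))) N.
  apply: MP => //.
  - by rewrite lf_act; move: qw'; lra.
  - by apply: uv; rewrite !inE eqxx.
  - by apply: uv; rewrite !inE eqxx orbT.
  - by apply: aw; exact: fk_antidominant.
  - by apply: aw; apply: ftau_antidominant; rewrite expr1n.
  - by apply: aw; apply: ftau_antidominant; rewrite sqrrN expr1n.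
  (* The translate is [d *: act u N] plus a vector pairing nonnegatively with [fg], and [act u N]
     contributes at least [st]. *)
  - have := sh _ u (fg_antidominant); have [b b0 ->] := pvec_hpt sf.
    rewrite actZ (bfZl (@lfP K)) pmulr_rge0// actvB; last exact: lfP.
    rewrite actZ (bfBl (@lfP K)) (bfZl (@lfP K)) subr_ge0; apply: le_trans.
    by rewrite ler_pM2l//; exact: fN_act_fg.
rewrite -u'E => uM; have su' := eP _ _ _ sf ru' uM.
have : u' \in words _ L by apply: mem_words; rewrite -(ler_nat K); exact: le_trans LM.
by move=> /us; rewrite u'E ub eqxx.
Unshelve. all: by end_near. Qed.

Lemma plane_closed_in_Nstar (B : circle K) (r : K) : r != 0 -> cvec B = r *: b0 ->
  relatively_closed (@Nstar K C) (@image_plane K C B `&` @Nstar K C).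
Proof.
move=> r0 BE; exists (closure (@image_plane K C B)); first exact: closed_closure.
apply/seteqP; split=> x [Bx Nx]; split=> //; first exact: subset_closure.
have [w wE] := to_orbifold_surj x; rewrite wE in Bx Nx *.
apply/(image_planeP _ r0 BE); apply: orbit_plane_closed => // V /nbhs_interior Vw.
have oV : open (to_orbifold C @` V°) by apply: to_orbifold_open; exact: open_interior.
have /Bx[y [By [w' Vw' w'y]]] : nbhs (to_orbifold C w) (to_orbifold C @` V°).
  by apply: open_nbhs_nbhs; split=> //; exists w => //; exact: nbhs_singleton.
exists w'; first exact: interior_subset.
by apply/(image_planeP _ r0 BE); rewrite w'y.
Qed.

(** * The plane is not closed *)

Lemma finite_quadratic_roots (a b c : K) : ~ (a = 0 /\ b = 0 /\ c = 0) ->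
  finite_set [set x | a + x * b + x ^+ 2 * c = 0].
Proof.
move=> abc; have [[x0 x00]|no_root] := pselect (exists x, a + x * b + x ^+ 2 * c = 0); last first.
  rewrite (_ : [set x | _] = set0)//; apply/seteqP; split=> x //= x0.
  by apply: no_root; exists x.
apply: (@sub_finite_set _ _ [set x0; - b / c - x0]); last exact: finite_set2.
move=> x /= x1; have [c0|c0] := eqVneq c 0.
  have [b0|b0] := eqVneq b 0.
    by exfalso; apply: abc; move: x00; rewrite c0 b0 !mulr0 !addr0.
  left; apply: (mulIf b0); move: x1 x00; rewrite c0 !mulr0; lra.
have : (x - x0) * (c * (x + x0) + b) = 0.
  have -> : (x - x0) * (c * (x + x0) + b) =
    (a + x * b + x ^+ 2 * c) - (a + x0 * b + x0 ^+ 2 * c) by ring.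
  by rewrite x1 x00 subrr.
move/eqP; rewrite mulf_eq0 => /orP[|/eqP E]; first by rewrite subr_eq0 => /eqP; left.
by right; apply: (mulfI c0); rewrite mulrBr (mulrC c (_ / _)) divfK//; lra.
Qed.

(** A conic in the plane [fg], so that each translate of [fb] meets it in finitely
    many points. *)
Definition curve (x : K) : vec := 2 *: N2 + x *: e1 + x ^+ 2 *: e2.

Lemma curve_g0 x : lf (curve x) g0 = 0.
Proof. by rewrite /curve /fN2 /fg !lin !orth; ring. Qed.

Lemma ftl_curve x : 0 <= x <= 1 -> ftl (curve x).
Proof.
move=> /andP[x0 x1]; apply: (ftl_future (f_ftl F)).
  have -> : lf (curve x) (curve x) = - 4 * (ct ^+ 2 - st ^+ 2) + x ^+ 2 + (x ^+ 2) ^+ 2.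
    by rewrite /curve /fN2 !lin !orth; ring.
  rewrite f_t addrK mulr1.
  have : x ^+ 2 <= 1 by rewrite exprn_ile1.
  have : (x ^+ 2) ^+ 2 <= 1 by rewrite -exprM exprn_ile1.
  lra.
by rewrite /curve /fN2 !lin !orth; have := f_ct0 F; lra.
Qed.

Lemma lf_fb_self : lf b0 b0 = ct ^+ 2.
Proof. by rewrite /fb !lin !orth f_t; ring. Qed.

(** [N2], [e1], [e2] and [g0] form an orthonormal basis, so that [x] is a multiple of [g0]. *)
Lemma complete_orth (x : vec) : lf N2 x = 0 -> lf e1 x = 0 -> lf e2 x = 0 ->
  forall y, lf y x = lf x g0 * lf y g0.
Proof.
move=> x0 x1 x2 y; rewrite {1}(f_complete F y) !lin x1 x2 !mulr0 !addr0.
have E : ct * lf N x + st * lf k x = 0 by move: x0; rewrite /fN2 !lin.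
rewrite ?/fg ?lin (lfC x N) (lfC x k).
move: (lf N x) (lf k x) (lf y N) (lf y k) E => a b u v E.
have H : ct ^+ 2 - st ^+ 2 = 1 by rewrite f_t addrK.
have bE : b = ct * (st * a + ct * b).
  transitivity (b * (ct ^+ 2 - st ^+ 2)); first by rewrite H mulr1.
  apply: (@etrans _ _ (ct * (st * a + ct * b) - st * (ct * a + st * b))).
    by ring.
  by rewrite E mulr0 subr0.
have aE : a = - st * (st * a + ct * b).
  transitivity (a * (ct ^+ 2 - st ^+ 2)); first by rewrite H mulr1.
  apply: (@etrans _ _ (- st * (st * a + ct * b) + ct * (ct * a + st * b))).
    by ring.
  by rewrite E mulr0 addr0.
have ua : u * a = u * (- st * (st * a + ct * b)) by rewrite -aE.
have vb : v * b = v * (ct * (st * a + ct * b)) by rewrite -bE.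
lra.
Qed.

Lemma curve_avoids : exists2 x, 0 <= x <= 1 & forall g, lf (act g (curve x)) b0 != 0.
Proof.
apply: contrapT => no_x.
pose S (g : seq 'I_4) : set K := [set x | lf (act g (curve x)) b0 = 0].
have finS g : finite_set (S g).
  pose l := act (rev g) b0.
  have E x : lf (act g (curve x)) b0 = 2 * lf N2 l + x * lf e1 l + x ^+ 2 * lf e2 l.
    by rewrite lf_actl -/l /curve; move: N2 (l) => T m; rewrite !lin.
  have SE : S g = [set x | 2 * lf N2 l + x * lf e1 l + x ^+ 2 * lf e2 l = 0].
    by apply/seteqP; split=> x; rewrite /S /= E.
  rewrite SE; apply: finite_quadratic_roots => -[l0 [l1 l2]].
  have {}l0 : lf N2 l = 0 by lra.
  have lE := complete_orth l0 l1 l2.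
  (* [N] lies on the plane of [fb], while every translate of [N] is strictly on one side of the
     plane of [fg]; so no translate of [fb] is proportional to [fg]. *)
  have : lf (act (rev g) N) l = 0.
    by rewrite /l lf_act /fb !lin !orth; ring.
  rewrite lE => /eqP; rewrite mulf_eq0 => /orP[/eqP lg|].
    have := lE l; rewrite lg mul0r /l lf_act lf_fb_self => /eqP.
    by rewrite sqrf_eq0 (gt_eqF (f_ct0 F)).
  have := fN_act_fg (rev g); have := f_st0 F => a b.
  by rewrite gt_eqF//; exact: lt_le_trans b.
have cS : countable (\bigcup_g S g).
  apply: bigcup_countable => // g _; exact: finite_set_countable.
have sub : `[0, 1] `<=` \bigcup_g S g.
  move=> x /=; rewrite in_itv /= => x01; apply: contrapT => xS; apply: no_x; exists x => // g.
  by apply/eqP => xg; apply: xS; exists g.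
have c01 : countable (`[0, 1] : set K) by exact: sub_countable (subset_card_le sub) cS.
have := countable_lebesgue_measure0 c01.
by rewrite lebesgue_measure_itv /= lte_fin ltr01 -EFinD subr0 => /eqP; rewrite eqe oner_eq0.
Qed.

Lemma fb_decomp : b0 = ct *: g0 + st *: p.
Proof.
have E (a b c d x y z : K) : y ^+ 2 = 1 + x ^+ 2 ->
    x * c - b = y * - (x * a + y * b) + x * (y * a + x * b + c).
  by move=> h; transitivity (x * c - (y ^+ 2 - x ^+ 2) * b); [rewrite h addrK mul1r|ring].
rewrite /fb /fg /fp /fN2.
have h := f_t F; move: (fct F) (fst_ F) h N k e2 => y x h.
move=> [[[a1 a2] a3] a4] [[[b1 b2] b3] b4] [[[c1 c2] c3] c4].
by congr (_, _, _, _); rewrite /=; exact: E.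
Qed.

(** [fg] is orthogonal to both normals, hence fixed, and [fp] is the contracted end of the boost. *)
Lemma act_loop_fb m : exists2 b, act (loop s t m) b0 = ct *: g0 + b *: p &
  b = st * ((cu - su) ^+ 4) ^+ m.
Proof.
exists (st * ((cu - su) ^+ 4) ^+ m) => //.
rewrite fb_decomp (actvP (nv C) (@lfP K)) actZ.
rewrite (boost_loop (N2N2) (f_22 F) (N2e2) (f_u F) (f_vs F) (f_vt F)) scalerA.
congr (_ *: _ + _).
have [vs vt] : lf g0 (nv C s) = 0 /\ lf g0 (nv C t) = 0.
  by rewrite f_vs f_vt /fg !lin !orth; split; ring.
elim: m => //= m ->.
by rewrite /reflv vt mulr0 scale0r subr0 vs mulr0 scale0r subr0.
Qed.

Lemma plane_not_closed (B : circle K) (r : K) : r != 0 -> cvec B = r *: b0 ->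
  ~ closed (@image_plane K C B).
Proof.
move=> r0 BE; have [x x01 xg] := curve_avoids; have xf := ftl_curve x01.
move=> clB; pose w := hpt (curve x).
have [a a0 wE] := pvec_hpt xf.
suff /(image_planeP _ r0 BE)[g] : @image_plane K C B (to_orbifold C w).
  rewrite wE actZ (bfZl (@lfP K)) => /eqP; rewrite mulf_eq0 (gt_eqF a0) => /eqP.
  by move/eqP: (xg g).
pose be m := act (loop s t m) b0.
(* The orthogonal projection to the translate with normal [be m], whose norm is [ct ^+ 2]. As [be m]
   tends to a multiple of [fg], to which [curve x] is orthogonal, the projections tend to
   [curve x]. *)
pose y m : vec := curve x - (lf (curve x) (be m) / ct ^+ 2) *: be m.
have ct2 : ct ^+ 2 != 0 by rewrite expf_neq0// lt0r_neq0// f_ct0.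
have yb m : lf (y m) (be m) = 0.
  by rewrite /y (bfBl (@lfP K)) (bfZl (@lfP K)) {3 4}/be lf_act lf_fb_self divfK// subrr.
have [d dE] : exists d : nat -> K, (forall m, be m = ct *: g0 + (st * d m) *: p) /\ d m @[m --> \oo] --> 0.
  exists (fun m => ((cu - su) ^+ 4) ^+ m); split.
    by move=> m; rewrite /be; have [b -> ->] := act_loop_fb m.
  have /andP[mu0 mu1] := boost_mu (f_u F) (f_cu0 F) (f_su0 F).
  by apply: cvg_expr; rewrite gtr0_norm.
have beE : (fun m => be m) = (fun m => ct *: g0 + (st * d m) *: p) by apply/funext => m; case: dE.
have sd : st * d m @[m --> \oo] --> 0.
  have := cvgM (cvg_cst st) dE.2; rewrite mulr0; apply.
have be_cvg : be m @[m --> \oo] --> ct *: g0.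
  rewrite beE; have := cvgD (cvg_cst (ct *: g0)) (cvg_scale_vec sd (cvg_cst p)).
  by rewrite scale0r addr0; apply.
have lf_cvg : lf (curve x) (be m) @[m --> \oo] --> 0.
  have := cvg_lf (cvg_cst (curve x)) be_cvg.
  by rewrite (bfZr (@lfC K) (@lfP K)) curve_g0 mulr0; apply.
have y_cvg : y m @[m --> \oo] --> curve x.
  have := cvgB (cvg_cst (curve x)) (cvg_scale_vec (cvgM lf_cvg (cvg_cst (ct ^+ 2)^-1)) be_cvg).
  by rewrite mul0r scale0r subr0; apply.
have hy : hpt (y m) @[m --> \oo] --> w by exact: (cvg_comp _ _ y_cvg (cvg_hpt xf)).
have py : to_orbifold C (hpt (y m)) @[m --> \oo] --> to_orbifold C w.
  by exact: (cvg_comp _ _ hy (@to_orbifold_continuous _ C w)).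
apply: (closed_cvg _ clB _ _ py).
have ny : \forall m \near \oo, ftl (y m) by exact: (y_cvg _ (near_ftl xf)).
near=> m; have yf : ftl (y m) by near: m.
apply/(image_planeP _ r0 BE); exists (rev (loop s t m)).
have [c c0 ->] := pvec_hpt yf.
by rewrite actZ (bfZl (@lfP K)) lf_actl revK yb mulr0.
Unshelve. all: by end_near. Qed.

End Frame.

(** * From the quadrilateral to the frame *)

Section Configuration.
Variable K : realType.
Notation vec := (K * K * K * K)%type.
Let lin := (bfDl (@lfP K), bfBl (@lfP K), bfZl (@lfP K), bfNl (@lfP K),
  bfDr (@lfC K) (@lfP K), bfBr (@lfC K) (@lfP K), bfZr (@lfC K) (@lfP K), bfNr (@lfC K) (@lfP K)).

(** With [T] rescaled to a point of the half-space, orthogonality turns the norm of [x] into a sum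
    of squares. *)
Lemma lf_timelike_orth (T x : vec) : ftl T -> lf x T = 0 -> x != 0 -> 0 < lf x x.
Proof.
move=> Tf xT x0; have [a a0 TE] := pvec_hpt Tf; have := H3_gt0 (hpt T).
have {xT} : lf x (pvec (set_val (hpt T))) = 0 by rewrite TE !lin xT mulr0.
case: (set_val _) => [[u v] r] /= + r0.
case: x x0 => [[[A b1] b2] D] x0; rewrite /lf /= => xT.
have E : b1 * b1 + b2 * b2 - (A * D + D * A) / 2 =
    (A * u + b1) ^+ 2 + (A * v + b2) ^+ 2 + (A * r) ^+ 2 - A * 0 by rewrite -xT; field.
rewrite E mulr0 subr0; have [A0|A0] := eqVneq A 0; last first.
  by rewrite ltr_wpDl ?addr_ge0 ?sqr_ge0// exprn_even_gt0//= mulf_neq0// gt_eqF.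
rewrite A0 !mul0r !add0r expr0n /= addr0 lt_neqAle addr_ge0 ?sqr_ge0// andbT eq_sym.
rewrite paddr_eq0 ?sqr_ge0// !sqrf_eq0; apply: contra x0 => /andP[/eqP b10 /eqP b20].
move: xT; rewrite A0 b10 b20 => xT; have -> : D = 0 by move: xT; lra.
by [].
Qed.

Lemma lf_ftl_cpvec (T : vec) (z : Chat K) : ftl T -> lf T (cpvec z) < 0.
Proof.
move=> Tf; have [a a0 TE] := pvec_hpt Tf; have := H3_gt0 (hpt T).
rewrite -(pmulr_rlt0 _ a0) -(bfZl (@lfP K)) -TE.
case: (set_val _) => [[u v] r] /= r0; case: z => [[x y]|]; last by rewrite /lf /=; lra.
have -> : lf (pvec (u, v, r)) (cpvec (Some (x, y))) =
  - 2 * ((u - x) ^+ 2 + (v - y) ^+ 2 + r ^+ 2) by rewrite /lf /=; lra.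
suff : 0 < (u - x) ^+ 2 + (v - y) ^+ 2 + r ^+ 2 by lra.
by rewrite ltr_wpDl ?exprn_gt0// !addr_ge0 ?sqr_ge0.
Qed.

Lemma timelike_ftl (x : vec) : lf x x < 0 -> ftl x \/ ftl (- x).
Proof.
move=> xx; have [A0|A0|A0] := ltrgtP x.1.1.1 0; first by left.
  by right; split; rewrite ?lin ?opprK//= oppr_lt0.
exfalso; move: xx; case: x A0 => [[[A b1] b2] D] /= ->; rewrite /lf /= mul0r mulr0 addr0 mul0r subr0.
by rewrite ltNge addr_ge0// -expr2 sqr_ge0.
Qed.

Lemma ftl_cpvec (x : vec) (z : Chat K) : lf x x < 0 -> lf x (cpvec z) < 0 -> ftl x.
Proof.
move=> /timelike_ftl[//|/(lf_ftl_cpvec z)]; rewrite lin; lra.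
Qed.

Lemma lf_cpvec (z z' : Chat K) : z != z' -> lf (cpvec z) (cpvec z') < 0.
Proof.
case: z z' => [[x y]|] [[x' y']|] //= zz'; rewrite /lf /=.
- have : 0 < (x - x') ^+ 2 + (y - y') ^+ 2.
    rewrite lt_neqAle addr_ge0 ?sqr_ge0// andbT eq_sym paddr_eq0 ?sqr_ge0// !sqrf_eq0 !subr_eq0.
    by apply: contra zz' => /andP[/eqP-> /eqP->].
  lra.
- lra.
- lra.
Qed.
Lemma lf_cpvec0 (z : Chat K) : lf (cpvec z) (cpvec z) = 0.
Proof. by case: z => [[x y]|]; rewrite /lf /=; lra. Qed.

Let coords (y : vec) : 'rV[K]_4 := \row_(i < 4) [:: y.1.1.1; y.1.1.2; y.1.2; y.2]`_i.
Let dual (d : vec) : 'rV[K]_4 :=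
  \row_(i < 4) [:: - d.2 / 2; d.1.1.2; d.1.2; - d.1.1.1 / 2]`_i.
Let lfE y d : lf y d = \sum_i coords y 0 i * dual d 0 i.
Proof. by rewrite !big_ord_recl big_ord0 !mxE /lf /=; field. Qed.
Let of_coords (u : 'rV[K]_4) : vec := (u 0 0, u 0 1, u 0 2, u 0 3).
Let coordsK u : coords (of_coords u) = u.
Proof. by apply/rowP; apply: ord4_ind; rewrite mxE. Qed.

Lemma orth3 (a b c : vec) : exists2 x, x != 0 & [/\ lf x a = 0, lf x b = 0 & lf x c = 0].
Proof.
pose M : 'M[K]_(3, 4) := \matrix_(i < 3, j < 4) dual [:: a; b; c]`_i 0 j.
have : (0 < \rank (kermx M^T))%N.
  by rewrite mxrank_ker subn_gt0; apply: leq_ltn_trans (rank_leq_col _) _.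
rewrite lt0n mxrank_eq0 => /rowV0Pn[y /sub_kermxP yM y0].
exists (of_coords y).
  by apply: contra y0 => /eqP y00; rewrite -(coordsK y) y00; apply/eqP/rowP; apply: ord4_ind; rewrite !mxE.
have yi (i : 'I_3) : lf (of_coords y) [:: a; b; c]`_i = 0.
  transitivity ((y *m M^T) 0 i); last by rewrite yM mxE.
  by rewrite lfE coordsK mxE; apply: eq_bigr => j _; rewrite !mxE.
by split; [exact: (yi (@Ordinal 3 0 isT))|exact: (yi (@Ordinal 3 1 isT))|
  exact: (yi (@Ordinal 3 2 isT))].
Qed.

Lemma orthonormal_complete (T a b c : vec) :
  lf T T = -1 -> lf a a = 1 -> lf b b = 1 -> lf c c = 1 ->
  lf T a = 0 -> lf T b = 0 -> lf T c = 0 -> lf a b = 0 -> lf a c = 0 -> lf b c = 0 ->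
  ftl T -> forall x, x = - lf x T *: T + lf x a *: a + lf x b *: b + lf x c *: c.
Proof.
move=> TT aa bb cc Ta Tb Tc ab ac bc Tf x.
apply/eqP; rewrite -subr_eq0; set y := x - _.
have [yT ya yb yc] : [/\ lf y T = 0, lf y a = 0, lf y b = 0 & lf y c = 0].
  rewrite /y !lin (lfC a T) (lfC b T) (lfC c T) (lfC b a) (lfC c a) (lfC c b).
  by rewrite TT aa bb cc Ta Tb Tc ab ac bc; split; ring.
clearbody y; pose M : 'M[K]_4 := \matrix_(i < 4, j < 4) dual [:: T; a; b; c]`_i 0 j.
have Mu : M \in unitmx.
  rewrite -row_free_unit -kermx_eq0; apply/rowV0P => u /sub_kermxP uM.
  (* A linear relation among the four vectors; pairing it with each of them kills its
     coefficients. *)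
  have comb z : u 0 0 * lf z T + u 0 1 * lf z a + u 0 2 * lf z b + u 0 3 * lf z c = 0.
    transitivity (\sum_j (u *m M) 0 j * coords z 0 j); last first.
      by rewrite uM big1// => j _; rewrite mxE mul0r.
    rewrite !lfE !mulr_sumr -!big_split /=; apply: eq_bigr => j _.
    have -> : (u *m M) 0 j = \sum_i u 0 i * M i j by rewrite mxE.
    rewrite !big_ord_recl big_ord0 !(mxE _ _ _ j) /=.
    rewrite (_ : lift ord0 ord0 = 1 :> 'I_4); last exact: val_inj.
    rewrite (_ : lift ord0 (lift ord0 ord0) = 2 :> 'I_4); last exact: val_inj.
    rewrite (_ : lift ord0 (lift ord0 (lift ord0 ord0)) = 3 :> 'I_4); last exact: val_inj.
    ring.
  have uT := comb T; have ua := comb a; have ub := comb b; have uc := comb c.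
  rewrite (lfC a T) (lfC b T) (lfC c T) (lfC b a) (lfC c a) (lfC c b) in ua ub uc.
  rewrite ?TT ?aa ?bb ?cc ?Ta ?Tb ?Tc ?ab ?ac ?bc in uT ua ub uc.
  by apply/rowP; apply: ord4_ind; rewrite mxE; lra.
have : coords y *m M^T = 0.
  apply/rowP => i; rewrite !mxE.
  have -> : \sum_j coords y 0 j * M^T j i = lf y [:: T; a; b; c]`_i.
    by rewrite lfE; apply: eq_bigr => j _; rewrite !mxE.
  by move: i; apply: ord4_ind.
move=> /(congr1 (mulmx^~ (invmx M^T))); rewrite mulmxK ?unitmx_tr// mul0mx => y0.
have yi i : coords y 0 i = 0 by rewrite y0 mxE.
move: (yi 0) (yi 1) (yi 2) (yi 3); rewrite !mxE /=.
by case: y {yT ya yb yc y0 yi} => [[[y0 y1] y2] y3] /= -> -> -> ->.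
Qed.

(** The planes perpendicular to a geodesic are those whose normals lie in the Lorentz plane of its
    two null end vectors; this replaces the tangency condition by linear algebra. *)
Lemma geodesic_perp_span (q q' : Chat K) (B : circle K) : geodesic_perp q q' B ->
  q != q' /\ exists a b : K, cvec B = a *: cpvec q + b *: cpvec q'.
Proof.
case: B => A [b1 b2] D dB [w []]; have := H3_gt0 w.
rewrite /geodesic /hplane /cform /geodesic_tangent /hplane_normal /cvec /=.
case: (set_val w) => [[x y] t] /= t0.
case: q q' => [[p1 p2]|] [[q1 q2]|] //=; last 2 first.
- move=> [-> ->] H [a [a1 a2 a3]]; split=> //.
  have an0 : a != 0 by apply: contraPneq a3 => ->; rewrite mul0r => /eqP; rewrite oner_eq0.
  have b1E : A * p1 + b1 = 0 by apply: (mulfI an0); rewrite mulr0 -a1.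
  have b2E : A * p2 + b2 = 0 by apply: (mulfI an0); rewrite mulr0 -a2.
  exists (- A / 2), (A * t ^+ 2 / 2); rewrite !vecZE vecDE /pvec /=.
  have e1 : b1 = - A * p1 by lra.
  have e2 : b2 = - A * p2 by lra.
  by congr (_, _, _, _); move: H; rewrite e1 e2; lra.
- move=> [-> ->] H [a [a1 a2 a3]]; split=> //.
  have an0 : a != 0 by apply: contraPneq a3 => ->; rewrite mul0r => /eqP; rewrite oner_eq0.
  have b1E : A * q1 + b1 = 0 by apply: (mulfI an0); rewrite mulr0 -a1.
  have b2E : A * q2 + b2 = 0 by apply: (mulfI an0); rewrite mulr0 -a2.
  exists (A * t ^+ 2 / 2), (- A / 2); rewrite !vecZE vecDE /pvec /=.
  have e1 : b1 = - A * q1 by lra.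
  have e2 : b2 = - A * q2 by lra.
  by congr (_, _, _, _); move: H; rewrite e1 e2; lra.
move=> [G1 G2] H [a [a1 a2 a3]].
pose d1 := q1 - p1; pose d2 := q2 - p2; pose L := d1 ^+ 2 + d2 ^+ 2.
have L0 : L != 0.
  rewrite /L paddr_eq0 ?sqr_ge0// !sqrf_eq0; apply/negP => /andP[/eqP e1 /eqP e2].
  have q1E : q1 = p1 by move: e1; rewrite /d1; lra.
  have q2E : q2 = p2 by move: e2; rewrite /d2; lra.
  have : 0 < t ^+ 2 by rewrite exprn_gt0.
  have := sqr_ge0 (x - p1); have := sqr_ge0 (y - p2).
  by move: G2; rewrite q1E q2E; lra.
have neq : Some (p1, p2) != Some (q1, q2) :> Chat K.
  apply/eqP => -[e1 e2]; move: L0; rewrite /L /d1 /d2 e1 e2 !subrr expr0n /= addr0.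
  by rewrite eqxx.
split=> //.
have an0 : a != 0.
  apply: contra L0 => /eqP a00; move: a1 a2; rewrite a00 !mul0r => /eqP + /eqP.
  rewrite !mulf_eq0 (gt_eqF t0) /= -/d1 -/d2 => /eqP e1 /eqP e2.
  by rewrite /L e1 e2 expr0n /= addr0.
(* [s] is the affine coordinate, on the chord, of the projection of [w]; [k] is what the horizontal
   part of the tangency condition yields. *)
pose s := ((x - p1) * d1 + (y - p2) * d2) / L; pose k := t / a.
have sL : s * L = (x - p1) * d1 + (y - p2) * d2 by rewrite /s divfK.
have xE : x = p1 + s * d1.
  apply: (mulIf L0); rewrite mulrDl -mulrA (mulrC d1) mulrA sL.
  have := G1; rewrite -/d1 -/d2 /L => G; transitivity (p1 * L + (x - p1) * L); first by rewrite /L; ring.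
  rewrite /L; congr (_ + _).
  transitivity ((x - p1) * d1 ^+ 2 + ((x - p1) * d2) * d2); first by ring.
  by rewrite G; ring.
have yE : y = p2 + s * d2.
  apply: (mulIf L0); rewrite mulrDl -mulrA (mulrC d2) mulrA sL.
  have := G1; rewrite -/d1 -/d2 /L => G; transitivity (p2 * L + (y - p2) * L); first by rewrite /L; ring.
  rewrite /L; congr (_ + _).
  transitivity (((y - p2) * d1) * d1 + (y - p2) * d2 ^+ 2); first by ring.
  by rewrite -G; ring.
have t2 : t ^+ 2 = s * (1 - s) * L.
  have q1E : q1 = p1 + d1 by rewrite /d1; ring.
  have q2E : q2 = p2 + d2 by rewrite /d2; ring.
  move: G2; rewrite q1E q2E xE yE /L => G2.
  apply/eqP; rewrite -subr_eq0; apply/eqP; rewrite -[RHS]G2; ring.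
have ak : a * k = t by rewrite /k mulrC divfK.
have b1E : b1 = k * d1 - A * x.
  apply: (mulfI an0); rewrite mulrBr mulrA ak; move: a1; rewrite -/d1 => ->; ring.
have b2E : b2 = k * d2 - A * y.
  apply: (mulfI an0); rewrite mulrBr mulrA ak; move: a2; rewrite -/d2 => ->; ring.
(* The vertical part of the tangency condition, to which the last coordinate of the claim
   reduces. *)
have kE : k * (1 - 2 * s) = 2 * A * s * (1 - s).
  apply: (mulIf L0); transitivity (2 * A * t ^+ 2); last by rewrite t2; ring.
  transitivity (k * 2 * (a * (A * t))); last first.
    by transitivity (2 * A * t * (a * k)); [ring|rewrite ak; ring].
  rewrite -a3; have q1E : q1 = p1 + d1 by rewrite /d1; ring.
  have q2E : q2 = p2 + d2 by rewrite /d2; ring.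
  by rewrite xE yE q1E q2E /L; field.
have DE : D = - A * (x ^+ 2 + y ^+ 2 + t ^+ 2) - 2 * (b1 * x + b2 * y) by move: H; lra.
exists (- (A - (A * s - k)) / 2), (- (A * s - k) / 2); rewrite !vecZE vecDE /pvec /=.
have q1E : q1 = p1 + d1 by rewrite /d1; ring.
have q2E : q2 = p2 + d2 by rewrite /d2; ring.
congr (_, _, _, _).
- by field.
- by rewrite b1E xE q1E; field.
- by rewrite b2E yE q2E; field.
rewrite DE b1E b2E t2 xE yE q1E q2E; apply/eqP; rewrite -subr_eq0; apply/eqP.
transitivity (L * (k * (1 - 2 * s) - 2 * A * s * (1 - s))); first by rewrite /L; field.
by rewrite kE subrr mulr0.
Qed.

(** Up to the normalisation, the two sides differ by a combination of the equations of the circles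
    at [z]; at infinity both leading coefficients vanish. *)
Lemma unit_normal_lf (B B' : circle K) z : on_circle B z -> on_circle B' z ->
  (unit_normal B z).1 * (unit_normal B' z).1 + (unit_normal B z).2 * (unit_normal B' z).2 =
  lf (cvec B) (cvec B') / (Num.sqrt (disc B) * Num.sqrt (disc B')).
Proof.
rewrite /on_circle /= => zB zB'.
have dn : Num.sqrt (disc B) != 0 by rewrite lt0r_neq0// sqrt_disc_gt0.
have dn' : Num.sqrt (disc B') != 0 by rewrite lt0r_neq0// sqrt_disc_gt0.
pose u : K * K := if z is Some u then u else (0, 0).
suff -> : lf (cvec B) (cvec B') =
    (cA B * u.1 + (cb B).1) * (cA B' * u.1 + (cb B').1) + (cA B * u.2 + (cb B).2) * (cA B' * u.2 + (cb B').2).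
  by rewrite /unit_normal /u; case: (z) => [[x y]|] /=; field; rewrite dn dn'.
rewrite /lf /u /cvec /=; case: z zB zB' {u} => [[x y]|] /=; last first.
  by move=> -> ->; ring.
rewrite /cform /= expr0n addr0 => zB zB'.
have E : cA B' * (cA B * (x ^+ 2 + y ^+ 2) + 2 * ((cb B).1 * x + (cb B).2 * y) + cD B) +
  cA B * (cA B' * (x ^+ 2 + y ^+ 2) + 2 * ((cb B').1 * x + (cb B').2 * y) + cD B') = 0.
  by rewrite zB zB' !mulr0 addr0.
lra.
Qed.

Lemma interior_angle_lf (C : 'I_4 -> circle K) i j (Q : set (Chat K)) z theta :
  0 <= theta <= pi -> interior_angle Q (C i) (C j) z theta ->
  lf (nv C i) (nv C j) = - cos theta.
Proof.
move=> th [zi zj _]; rewrite /sector_angle unit_normal_lf//.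
have -> : lf (cvec (C i)) (cvec (C j)) / (Num.sqrt (disc (C i)) * Num.sqrt (disc (C j))) =
    lf (nv C i) (nv C j) by rewrite /nv !lin invfM; ring.
have N1 l : on_circle (C l) z ->
  (unit_normal (C l) z).1 ^+ 2 + (unit_normal (C l) z).2 ^+ 2 = 1.
  move=> zl; rewrite !expr2 unit_normal_lf// -expr2 sqr_sqrtr ?ltW ?disc_pos// lf_disc.
  by rewrite divff// lt0r_neq0// disc_pos.
have := N1 i zi; have := N1 j zj; have : lf (nv C i) (nv C j) =
  (unit_normal (C i) z).1 * (unit_normal (C j) z).1 + (unit_normal (C i) z).2 * (unit_normal (C j) z).2.
  by rewrite unit_normal_lf// /nv !lin invfM; ring.
move: (unit_normal _ _) (unit_normal _ _) => [x y] [x' y'] /= -> n1 n2 <-.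
rewrite acosK ?opprK// in_itv /=.
have := sqr_ge0 (x - x'); have := sqr_ge0 (y - y'); have := sqr_ge0 (x + x'); have := sqr_ge0 (y + y').
lra.
Qed.

(** [lf v w ^+ 2 - 1] is the square of [l] times the coordinate determinant: if this vanishes, [v]
    and [w] are proportional, and otherwise Cramer's rule recovers [P]. *)
Lemma span_gram (P P' v w : vec) (a b c d : K) : lf P P = 0 -> lf P' P' = 0 ->
  v = a *: P + b *: P' -> w = c *: P + d *: P' -> lf v v = 1 -> lf w w = 1 ->
  (exists2 m, m ^+ 2 = 1 & w = m *: v) \/
  1 < lf v w ^+ 2 /\ exists x y : K, P = x *: v + y *: w.
Proof.
move=> PP PP' vE wE vv ww; set l := lf P P'.
have vvE : 2 * a * b * l = 1.
  by rewrite -[RHS]vv vE !lin PP PP' (lfC P' P) -/l; ring.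
have wwE : 2 * c * d * l = 1.
  by rewrite -[RHS]ww wE !lin PP PP' (lfC P' P) -/l; ring.
have vwE : lf v w = (a * d + b * c) * l.
  by rewrite vE wE !lin PP PP' (lfC P' P) -/l; ring.
have [det|det] := eqVneq (a * d - b * c) 0; [left|right].
  have a0 : a != 0.
    by apply: contra_eq_neq vvE => ->; rewrite mulr0 !mul0r eq_sym oner_eq0.
  have wv : w = (c / a) *: v.
    rewrite wE vE scalerDr !scalerA divfK//; congr (_ + _ *: _).
    by apply: (mulIf a0); rewrite mulrAC divfK//; lra.
  exists (c / a) => //; move: ww; rewrite wv !lin vv mulr1 -expr2; apply.
split.
  have -> : lf v w ^+ 2 = 2 * a * b * l * (2 * c * d * l) + (l * (a * d - b * c)) ^+ 2.
    by rewrite vwE; ring.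
  rewrite vvE wwE mulr1 ltrDl exprn_even_gt0//= mulf_neq0//.
  by apply: contra_eq_neq vvE => ->; rewrite mulr0 eq_sym oner_eq0.
exists (d / (a * d - b * c)), (- b / (a * d - b * c)).
rewrite vE wE !scalerDr !scalerA addrACA -!scalerDl.
have -> : d / (a * d - b * c) * a + - b / (a * d - b * c) * c = 1 by field.
have -> : d / (a * d - b * c) * b + - b / (a * d - b * c) * d = 0 by field.
by rewrite scale1r scale0r addr0.
Qed.

(** If [g = lf v w] exceeded 1, the points [z] and [z'] would put [g *: v - w] and [g *: w - v] in
    the future cone, although their product is [g * (g ^+ 2 - 1) > 0]. *)
Lemma not_nested (v w : vec) (z z' : Chat K) : lf v v = 1 -> lf w w = 1 ->
  lf (cpvec z) v = 0 -> 0 <= lf (cpvec z) w -> lf (cpvec z') w = 0 -> 0 <= lf (cpvec z') v ->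
  lf v w <= 1.
Proof.
move=> vv ww zv zw z'w z'v; rewrite leNgt; apply/negP; set g := lf v w => g1.
have g0 : 0 < g by lra.
have g2 : 1 < g ^+ 2 by rewrite exprn_egt1.
have past (x : vec) (u : Chat K) : lf x x < 0 -> 0 <= lf (cpvec u) x -> ftl (- x).
  move=> xx ux; case: (timelike_ftl xx) => // xf; have := lf_ftl_cpvec u xf.
  by rewrite lfC ltNge ux.
have f1 : ftl (- (w - g *: v)).
  apply: (past _ z); rewrite !lin ?vv ?ww ?(lfC w v) -/g ?zv; last by rewrite mulr0 subr0.
  have -> : 1 - g * g - g * (g - g * 1) = 1 - g ^+ 2 by ring.
  lra.
have f2 : ftl (- (v - g *: w)).
  apply: (past _ z'); rewrite !lin ?vv ?ww ?(lfC w v) -/g ?z'w; last by rewrite mulr0 subr0.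
  have -> : 1 - g * g - g * (g - g * 1) = 1 - g ^+ 2 by ring.
  lra.
have := lf_ftl_lt0 f1 f2; rewrite !lin vv ww (lfC w v) -/g.
have : 0 < g * (g ^+ 2 - 1) by rewrite mulr_gt0// subr_gt0.
lra.
Qed.

Lemma closure_side (R : set (Chat K)) (B : circle K) (u : K * K) :
  R `<=` side B -> closure R (Some u) -> 0 <= cform_Chat B (Some u).
Proof.
move=> RB clR; rewrite leNgt; apply/negP => Bu.
have lim : cform B (u', 0) @[u' --> u] --> cform B (u, 0).
  have -> : (fun u' => cform B (u', 0)) = (fun u' => lf (pvec (u', 0)) (cvec B)).
    by apply/funext => u'; rewrite lf_cform.
  rewrite -lf_cform; apply: cvg_lf; last exact: cvg_cst.
  have h : (u', 0 : K) @[u' --> u] --> (u, 0 : K).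
    by apply: cvg_pairr; [exact: cvg_id|exact: cvg_cst].
  exact: (cvg_comp _ _ h (@cvg_pvec _ (u, 0))).
have nu : \forall u' \near u, cform B (u', 0) < 0 by exact: (cvgr_lt _ lim _ Bu).
have [z [/RB zB [u' u'B zE]]] := clR _ (@one_point_compactification_some_nbhs _ u _ nu).
by move: zB; rewrite -zE /side /= ltNge ltW.
Qed.

(** For the disjoint planes with unit normals [v] and [w], [axis_t v w] is the midpoint
    of their common perpendicular and [axis_s v w] its direction there. *)
Definition axis_t (v w : vec) : vec := - (2 * Num.sqrt ((- lf v w - 1) / 2))^-1 *: (v + w).
Definition axis_s (v w : vec) : vec := (2 * Num.sqrt ((- lf v w + 1) / 2))^-1 *: (v - w).

Section Axis.
Variables (v w : vec).
Hypotheses (vv : lf v v = 1) (ww : lf w w = 1) (vw : lf v w < -1).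
Let d := Num.sqrt ((- lf v w - 1) / 2).
Let c := Num.sqrt ((- lf v w + 1) / 2).
Let d2 : d ^+ 2 = (- lf v w - 1) / 2.
Proof. by rewrite sqr_sqrtr//; move: vw; lra. Qed.
Let c2 : c ^+ 2 = (- lf v w + 1) / 2.
Proof. by rewrite sqr_sqrtr//; move: vw; lra. Qed.

Lemma axis_d_gt0 : 0 < d. Proof. by rewrite sqrtr_gt0; move: vw; lra. Qed.
Lemma axis_c_gt0 : 0 < c. Proof. by rewrite sqrtr_gt0; move: vw; lra. Qed.
Lemma axis_cd : c ^+ 2 = 1 + d ^+ 2. Proof. by rewrite c2 d2; field. Qed.
Let dn : d != 0. Proof. exact: lt0r_neq0 axis_d_gt0. Qed.
Let cn : c != 0. Proof. exact: lt0r_neq0 axis_c_gt0. Qed.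

Lemma axis_tt : lf (axis_t v w) (axis_t v w) = -1.
Proof.
have vwE : lf v w = - 2 * d ^+ 2 - 1 by rewrite d2; field.
by rewrite /axis_t -/d !lin vv ww (lfC w v) vwE; field.
Qed.
Lemma axis_ss : lf (axis_s v w) (axis_s v w) = 1.
Proof.
have vwE : lf v w = - 2 * c ^+ 2 + 1 by rewrite c2; field.
by rewrite /axis_s -/c !lin vv ww (lfC w v) vwE; field.
Qed.
Lemma axis_ts : lf (axis_t v w) (axis_s v w) = 0.
Proof. by rewrite /axis_t /axis_s !lin vv ww (lfC w v); ring. Qed.
Lemma axis_l : v = c *: axis_s v w - d *: axis_t v w.
Proof.
rewrite /axis_s /axis_t -/c -/d; move: (c) (d) cn dn => x y xn yn.
case: v w => [[[a1 a2] a3] a4] [[[b1 b2] b3] b4].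
rewrite ?vecBE ?vecZE ?vecDE /=.
by congr (_, _, _, _); field; rewrite xn yn.
Qed.
Lemma axis_r : w = - c *: axis_s v w - d *: axis_t v w.
Proof.
rewrite /axis_s /axis_t -/c -/d; move: (c) (d) cn dn => x y xn yn.
case: v w => [[[a1 a2] a3] a4] [[[b1 b2] b3] b4].
rewrite ?vecBE ?vecZE ?vecDE /=.
by congr (_, _, _, _); field; rewrite xn yn.
Qed.
End Axis.

(** Since the four angles are equal, all products between the two axes cancel except that of the
    midpoints, [- c / (sw * su)]. The part of [N2] orthogonal to [N] then supplies [k]. The sign [e]
    records which end of the axis of eta lies on [B], and [s], [t] are ordered accordingly. *)
Lemma frame_exists (C : 'I_4 -> circle K) (c : K) (z : Chat K) (B : circle K) (e : K) :
  0 < c -> lf (nv C 0) (nv C 1) = - c -> lf (nv C 1) (nv C 2) = - c ->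
  lf (nv C 2) (nv C 3) = - c -> lf (nv C 3) (nv C 0) = - c ->
  lf (nv C 0) (nv C 2) < -1 -> lf (nv C 1) (nv C 3) < -1 ->
  (forall i, 0 < lf (cpvec z) (nv C i)) ->
  (forall x, 0 < lf x x -> ~ forall i, lf x (nv C i) = 0) ->
  lf (cvec B) (nv C 0) = 0 -> lf (cvec B) (nv C 2) = 0 -> e = 1 \/ e = -1 ->
  lf (cvec B) (axis_t (nv C 1) (nv C 3)) + e * lf (cvec B) (axis_s (nv C 1) (nv C 3)) = 0 ->
  exists (F : frame C c) (r : K), r != 0 /\ cvec B = r *: (fst_ F *: fe2 F - fk F).
Proof.
move=> c0 v01 v12 v23 v30 v02 v13 z0v nf B0 B2 ee BP.
have n0 := lf_nv C 0; have n1 := lf_nv C 1; have n2 := lf_nv C 2; have n3 := lf_nv C 3.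
have z0 := z0v 0; have z1 := z0v 1; have z2 := z0v 2; have z3 := z0v 3.
have [v0 v0E] : {v | v = nv C 0} by exists (nv C 0).
have [v1 v1E] : {v | v = nv C 1} by exists (nv C 1).
have [v2 v2E] : {v | v = nv C 2} by exists (nv C 2).
have [v3 v3E] : {v | v = nv C 3} by exists (nv C 3).
rewrite -?v0E -?v1E -?v2E -?v3E in v01 v12 v23 v30 v02 v13 B0 B2 BP n0 n1 n2 n3 z0 z1 z2 z3.
pose sw := Num.sqrt ((- lf v0 v2 - 1) / 2); pose cw := Num.sqrt ((- lf v0 v2 + 1) / 2).
pose su := Num.sqrt ((- lf v1 v3 - 1) / 2); pose cu := Num.sqrt ((- lf v1 v3 + 1) / 2).
have sw0 : 0 < sw := axis_d_gt0 v02. have cw0 : 0 < cw := axis_c_gt0 v02.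
have su0 : 0 < su := axis_d_gt0 v13. have cu0 : 0 < cu := axis_c_gt0 v13.
have cw2 : cw ^+ 2 = 1 + sw ^+ 2 := axis_cd v02.
have cu2 : cu ^+ 2 = 1 + su ^+ 2 := axis_cd v13.
have [swn sun] := (lt0r_neq0 sw0, lt0r_neq0 su0).
have E0 : v0 = cw *: axis_s v0 v2 - sw *: axis_t v0 v2 := axis_l v02.
have E2 : v2 = - cw *: axis_s v0 v2 - sw *: axis_t v0 v2 := axis_r v02.
have E1 : v1 = cu *: axis_s v1 v3 - su *: axis_t v1 v3 := axis_l v13.
have E3 : v3 = - cu *: axis_s v1 v3 - su *: axis_t v1 v3 := axis_r v13.
pose ct := c / (sw * su).
have ct0 : 0 < ct by rewrite divr_gt0// mulr_gt0.
have NN2 : lf (axis_t v0 v2) (axis_t v1 v3) = - ct.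
  by rewrite /axis_t -/sw -/su !lin v01 (lfC v0 v3) v30 (lfC v2 v1) v12 v23 /ct; field; rewrite swn sun.
have Ne2 : lf (axis_t v0 v2) (axis_s v1 v3) = 0.
  by rewrite /axis_t /axis_s !lin v01 (lfC v0 v3) v30 (lfC v2 v1) v12 v23; ring.
have e1N2 : lf (axis_s v0 v2) (axis_t v1 v3) = 0.
  by rewrite /axis_t /axis_s !lin v01 (lfC v0 v3) v30 (lfC v2 v1) v12 v23; ring.
have e1e2 : lf (axis_s v0 v2) (axis_s v1 v3) = 0.
  by rewrite /axis_s !lin v01 (lfC v0 v3) v30 (lfC v2 v1) v12 v23; ring.
have NN := axis_tt n0 n2 v02; have N2N2 := axis_tt n1 n3 v13.
have e11 := axis_ss n0 n2 v02; have e22 := axis_ss n1 n3 v13.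
have Ne1 := axis_ts n0 n2; have N2e2 := axis_ts n1 n3.
have Nf : ftl (axis_t v0 v2).
  apply: (@ftl_cpvec _ z); first by rewrite NN; lra.
  rewrite /axis_t -/sw !lin !(lfC _ (cpvec z)) mulNr oppr_lt0 mulr_gt0//.
    by rewrite invr_gt0 mulr_gt0.
  by rewrite addr_gt0.
have BN : lf (cvec B) (axis_t v0 v2) = 0 by rewrite /axis_t !lin B0 B2; ring.
have Be1 : lf (cvec B) (axis_s v0 v2) = 0 by rewrite /axis_s !lin B0 B2; ring.
have BB : lf (cvec B) (cvec B) != 0 by rewrite lf_disc lt0r_neq0// disc_pos.
move: (axis_t v0 v2) (axis_s v0 v2) (axis_t v1 v3) (axis_s v1 v3) E0 E1 E2 E3
  NN2 Ne2 e1N2 e1e2 NN N2N2 e11 e22 Ne1 N2e2 Nf BN Be1 BP => N e1 N2 E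
  E0 E1 E2 E3 NN2 NE e1N2 e1E NN N2N2 e11 EE Ne1 N2E Nf BN Be1 BP.
have cE : sw * su * ct = c by rewrite /ct mulrC divfK// mulf_neq0.
clearbody ct; clearbody sw cw su cu.
have [k' N2E'] : {k' | N2 = ct *: N + k'} by exists (N2 - ct *: N); rewrite subrKC.
have k'N : lf k' N = 0.
  by move: NN2; rewrite N2E' !lin NN (lfC N k') => h; lra.
have k'k' : lf k' k' = ct ^+ 2 - 1.
  by move: N2N2; rewrite N2E' !lin NN (lfC N k') k'N => h; lra.
have k'e1 : lf k' e1 = 0.
  by move: e1N2; rewrite N2E' !lin (lfC e1 N) Ne1 (lfC e1 k') => h; lra.
have k'E : lf k' E = 0.
  by move: N2E; rewrite N2E' !lin NE => h; lra.
(* Otherwise the four normals lie in the span of [N], [e1] and [E], and a vector orthogonal to these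
   three contradicts [nf]. *)
have k'0 : k' != 0.
  apply/eqP => k'0; have N2_ct : N2 = ct *: N by rewrite N2E' k'0 addr0.
  have [x x0 [xN xe1 xE]] := orth3 N e1 E.
  apply: (nf x); first exact: lf_timelike_orth Nf xN x0.
  by apply: ord4_ind; rewrite -?v0E -?v1E -?v2E -?v3E ?E0 ?E1 ?E2 ?E3 ?N2_ct !lin xN ?xe1 ?xE; ring.
have ct1 : 0 < ct ^+ 2 - 1 by rewrite -k'k'; exact: lf_timelike_orth Nf k'N k'0.
pose st := Num.sqrt (ct ^+ 2 - 1); have st0 : 0 < st by rewrite sqrtr_gt0.
have st2 : st ^+ 2 = ct ^+ 2 - 1 by rewrite sqr_sqrtr// ltW.
have stn := lt0r_neq0 st0; clearbody st.
have [k k'k] : {k | k' = st *: k} by exists (st^-1 *: k'); rewrite scalerA divff// scale1r.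
move: k'N k'k' k'e1 k'E; rewrite k'k !lin => k'N k'k' k'e1 k'E.
have N2k : N2 = ct *: N + st *: k by rewrite N2E' k'k.
have kk : lf k k = 1.
  by apply: (mulfI stn); apply: (mulfI stn); rewrite k'k' -st2 mulr1 expr2.
have Nk : lf N k = 0 by apply: (mulfI stn); rewrite (lfC N k) k'N mulr0.
have ke1 : lf k e1 = 0 by apply: (mulfI stn); rewrite k'e1 mulr0.
have kE : lf k E = 0 by apply: (mulfI stn); rewrite k'E mulr0.
have ee1 : e * e = 1 by case: ee => ->; ring.
have e22 : lf (e *: E) (e *: E) = 1 by rewrite !lin EE mulr1.
have NE' : lf N (e *: E) = 0 by rewrite !lin NE mulr0.
have kE' : lf k (e *: E) = 0 by rewrite !lin kE mulr0.
have e1E' : lf e1 (e *: E) = 0 by rewrite !lin e1E mulr0.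
have comp := orthonormal_complete NN kk e11 e22 Nk Ne1 NE' ke1 kE' e1E' Nf.
have ct2 : ct ^+ 2 = 1 + st ^+ 2 by rewrite st2; ring.
pose s : 'I_4 := if e == 1 then 1 else 3; pose t : 'I_4 := if e == 1 then 3 else 1.
have e_neq : (-1 == 1 :> K) = false by rewrite lt_eqF// (lt_trans (ltrN10 K)) ?ltr01.
have sth : (s = 1 /\ t = 3) \/ (s = 3 /\ t = 1).
  by rewrite /s /t; case: ee => ->; rewrite ?eqxx ?e_neq; [left|right].
have vs : nv C s = cu *: (e *: E) - su *: (ct *: N + st *: k).
  rewrite -N2k /s; case: ee => ->; rewrite ?eqxx ?e_neq -?v1E -?v3E ?E1 ?E3 ?scale1r//.
  by rewrite scaleN1r scalerN scaleNr.
have vt : nv C t = - cu *: (e *: E) - su *: (ct *: N + st *: k).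
  rewrite -N2k /t; case: ee => ->; rewrite ?eqxx ?e_neq -?v1E -?v3E ?E1 ?E3 ?scale1r//.
  by rewrite scaleN1r scalerN scaleNr opprK.
exists (@Frame K C c N k e1 (e *: E) cw sw cu su ct st s t Nf NN kk e11 e22 Nk Ne1 NE' ke1 kE' e1E'
  cw2 cu2 ct2 cw0 sw0 cu0 su0 ct0 st0 cE comp sth (etrans (esym v0E) E0) (etrans (esym v2E) E2) vs vt).
exists (- lf (cvec B) k); rewrite /=.
have BE : lf (cvec B) (e *: E) = - st * lf (cvec B) k.
  by apply/eqP; rewrite mulNr -addr_eq0 addrC -BP N2k !lin BN mulr0 add0r.
have Bk : cvec B = - lf (cvec B) k *: (st *: (e *: E) - k).
  rewrite {1}(comp (cvec B)) BN Be1 BE oppr0 !scale0r add0r addr0 scalerBr scalerA !scaleNr opprK.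
  rewrite addrC !scalerA -scaleNr; apply: (congr1 (fun a => a *: E + _)).
  by ring.
split=> //; rewrite oppr_eq0; apply: contra BB => /eqP Bk0.
by rewrite Bk Bk0 oppr0 scale0r bf0l//; exact: lfP.
Qed.

Lemma lf_cpvec_nv (C : 'I_4 -> circle K) i z :
  lf (cpvec z) (nv C i) = (Num.sqrt (disc (C i)))^-1 * cform_Chat (C i) z.
Proof. by rewrite /nv !lin lf_cform_Chat. Qed.

Lemma geodesic_perp_nv (C : 'I_4 -> circle K) i q q' : geodesic_perp q q' (C i) ->
  exists a b, nv C i = a *: cpvec q + b *: cpvec q'.
Proof.
move=> /geodesic_perp_span[_ [a [b E]]].
exists ((Num.sqrt (disc (C i)))^-1 * a), ((Num.sqrt (disc (C i)))^-1 * b).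
by rewrite /nv E scalerDr !scalerA.
Qed.

(** By [span_gram] the circles are equal or disjoint. Equality up to sign becomes equality because
    both make the same nonzero product [- k] with [y]; disjoint circles have product below -1 once
    nesting is excluded. *)
Lemma opposite_sides (q q' p p' : Chat K) (v w y y' : vec) (k : K) : p != p' ->
  (exists a b, v = a *: cpvec q + b *: cpvec q') ->
  (exists a b, w = a *: cpvec q + b *: cpvec q') ->
  (exists a b, y = a *: cpvec p + b *: cpvec p') ->
  (exists a b, y' = a *: cpvec p + b *: cpvec p') ->
  lf v v = 1 -> lf w w = 1 -> 0 < k -> lf v y = - k -> lf y w = - k ->
  (forall x, 0 < lf x x -> lf x v = 0 -> lf x w = 0 -> lf x y = 0 -> lf x y' = 0 -> False) ->
  lf v w <= 1 -> lf v w < -1 /\ exists a b, cpvec q = a *: v + b *: w.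
Proof.
move=> pp' [a [b vE]] [c [d wE]] [a1 [b1 yE]] [c1 [d1 y'E]] vv ww k0 vy yw nf vw.
have [[m m2 wm]|[g2 qE]] := span_gram (lf_cpvec0 q) (lf_cpvec0 q') vE wE vv ww.
  have wv : w = v.
    move: yw; rewrite wm !lin lfC vy => mk.
    have -> : m = 1 by apply: (mulIf (lt0r_neq0 k0)); lra.
    by rewrite scale1r.
  (* Otherwise the four normals span only three dimensions. *)
  exfalso; have [x x0 [xp xp' xv]] := orth3 (cpvec p) (cpvec p') v.
  have TT : lf (cpvec p + cpvec p') (cpvec p + cpvec p') < 0.
    rewrite !lin !lf_cpvec0 (lfC (cpvec p')); have := lf_cpvec pp'; lra.
  have xx : 0 < lf x x.
    by case: (timelike_ftl TT) => Tf; apply: (lf_timelike_orth Tf _ x0);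
      rewrite !lin xp xp'; ring.
  by apply: (nf x xx); rewrite ?wv ?yE ?y'E ?lin ?xp ?xp' ?mulr0 ?addr0.
split=> //; rewrite ltNge; apply/negP => g1.
have : 0 <= (1 - lf v w) * (lf v w + 1).
  by apply: mulr_ge0; [rewrite subr_ge0|rewrite -lerBlDr sub0r].
have -> : (1 - lf v w) * (lf v w + 1) = 1 - lf v w ^+ 2 by ring.
by rewrite subr_ge0 leNgt g2.
Qed.

Lemma null_axis (v w P : vec) (x y : K) : lf v v = 1 -> lf w w = 1 -> lf v w < -1 ->
  P = x *: v + y *: w -> lf P P = 0 -> P != 0 ->
  exists e m, [/\ e = 1 \/ e = -1, m != 0 & P = m *: (axis_t v w + e *: axis_s v w)].
Proof.
move=> vv ww vw PE PP P0.
have tt := axis_tt vv ww vw; have ss := axis_ss vv ww vw; have ts := axis_ts vv ww.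
have vE := axis_l vw; have wE := axis_r vw.
move: (axis_t v w) (axis_s v w) tt ss ts vE wE => T S tt ss ts vE wE.
have [m [m' PE']] : exists m m', P = m *: T + m' *: S.
  move: (Num.sqrt _) (Num.sqrt _) vE wE => d c vE wE; rewrite PE vE wE.
  exists (- (x + y) * d), ((x - y) * c).
  move: S T {tt ss ts vE wE} => [[[a1 a2] a3] a4] [[[b1 b2] b3] b4].
  by rewrite !(vecZE, vecBE, vecDE); congr (_, _, _, _) => /=; ring.
have {}PP : m' ^+ 2 = m ^+ 2.
  by move: PP; rewrite PE' !lin tt ss (lfC S T) ts => h; lra.
have m0 : m != 0.
  apply: contra P0 => /eqP m0; move: PP; rewrite m0 expr0n /= => /eqP; rewrite sqrf_eq0 => /eqP m'0.
  by rewrite PE' m0 m'0 !scale0r addr0.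
move: PP => /eqP; rewrite eqf_sqr => /orP[]/eqP m'E; [exists 1, m|exists (-1), m]; split=> //.
- by left.
- by rewrite PE' m'E scale1r scalerDr.
- by right.
- by rewrite PE' m'E scaleN1r scalerDr scalerN scaleNr.
Qed.

Section Sides.
Variables (C : 'I_4 -> circle K) (R : set (Chat K)) (theta : K).
Hypotheses (quad : is_quadrilateral R C theta) (R_side : forall i, R `<=` side (C i)).

(** [closure_side] handles finite points only; as the arc is injective, one of its two ends is
    finite. *)
Lemma side_point i : exists z, on_circle (C i) z /\ forall j, 0 <= cform_Chat (C j) z.
Proof.
have [v [s [_ _ bd sides]]] := quad; have [[_ s_inj s_on _] _] := sides i.
have pt t : 0 <= t <= 1 -> s i t != None ->
    exists z, on_circle (C i) z /\ forall j, 0 <= cform_Chat (C j) z.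
  move=> t01 sN; have ti : (s i @` `[0, 1]) (s i t) by exists t => //; rewrite /= in_itv.
  exists (s i t); split; first exact: s_on.
  have : (closure R `\` R) (s i t) by rewrite bd; exists i.
  by case: (s i t) sN => [u _ [clR _] j|//]; exact: closure_side (R_side j) clR.
have [s0|] := eqVneq (s i 0) None; last by apply: pt; rewrite lexx ler01.
apply: (pt 1); first by rewrite ler01 lexx.
rewrite -s0; apply/eqP => s10; move: (@oner_neq0 K); apply/negP; rewrite negbK; apply/eqP.
by apply: s_inj => //; rewrite in_itv /= ?lexx ler01.
Qed.

Lemma opposite_le1 i j : lf (nv C i) (nv C j) <= 1.
Proof.
have [[z [zi zp]] [z' [zj z'p]]] := (side_point i, side_point j).
have c0 l x : 0 <= cform_Chat (C l) x -> 0 <= lf (cpvec x) (nv C l).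
  by move=> h; rewrite lf_cpvec_nv mulr_ge0// invr_ge0 sqrtr_ge0.
apply: (@not_nested _ _ z z'); rewrite ?lf_nv ?c0// lf_cpvec_nv ?zi ?zj ?mulr0//.
Qed.

Lemma interior_point : exists z, forall i, 0 < lf (cpvec z) (nv C i).
Proof.
have [v [s [_ _ bd sides]]] := quad.
have [z Rz] : R !=set0.
  have : (closure R `\` R) (s 0 0).
    by rewrite bd; exists 0 => //; exists 0 => //; rewrite /= bound_itvE.
  by case=> clR _; have [z [Rz _]] := clR setT filterT; exists z.
by exists z => i; rewrite lf_cpvec_nv mulr_gt0 ?invr_gt0 ?sqrt_disc_gt0//; exact: R_side.
Qed.

Lemma adjacent_lf i : 0 <= theta <= pi -> lf (nv C i) (nv C (i + 1)) = - cos theta.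
Proof.
move=> th; have [v [s [_ _ _ sides]]] := quad; have [_ [_ _ ang]] := sides i.
exact: interior_angle_lf th ang.
Qed.

End Sides.

End Configuration.

(* C 0, C 1, C 2, C 3 are the circles C_1, C_2, C_3, C_4. *)
Theorem theorem2p2 (K : realType) (n : nat) (n_ge3 : (3 <= n)%N)
    (R : set (Chat K)) (C : 'I_4 -> circle K)
    (R_quad : is_quadrilateral R C (pi / n%:R))
    (R_side : forall i, R `<=` side (C i))
    (not_fuchsian : ~ fuchsian C)
    (q q' p p' : Chat K)
    (xi_perp1 : geodesic_perp q q' (C 0)) (xi_perp3 : geodesic_perp q q' (C 2))
    (eta_perp2 : geodesic_perp p p' (C 1)) (eta_perp4 : geodesic_perp p p' (C 3))
    (p_repelling :
      repelling_fixpoint (fun z => refl_Chat (C 3) (refl_Chat (C 1) z)) p)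
    (B : circle K)
    (Bq : on_circle B q) (Bq' : on_circle B q') (Bp : on_circle B p) :
  exotic C B.
Proof.
have n_gt0 : 0 < n%:R :> K by rewrite ltr0n; exact: leq_trans n_ge3.
have pin : 0 <= (pi / n%:R : K) <= pi.
  rewrite divr_ge0 ?pi_ge0 ?(ltW n_gt0)//= ler_pdivrMr// ler_peMr ?pi_ge0// ler1n.
  exact: leq_trans n_ge3.
(* As [n] is at least 3, the angle is less than pi/2. The positive cosine rules out coincident
   opposite circles of opposite orientation, and makes [fct] positive. *)
have c0 : 0 < cos (pi / n%:R : K).
  have pi0 := pi_gt0 K; apply: cos_gt0_pihalf; apply/andP; split.
    by apply: (@lt_le_trans _ _ 0); [lra|case/andP: pin].
  by rewrite ltr_pM2l// ltf_pV2 ?posrE// ltr_nat.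
have adj i j : i + 1 = j -> lf (nv C i) (nv C j) = - cos (pi / n%:R).
  by move=> <-; exact: (adjacent_lf R_quad i pin).
have v01 : lf (nv C 0) (nv C 1) = - cos (pi / n%:R) by apply: adj; exact: val_inj.
have v12 : lf (nv C 1) (nv C 2) = - cos (pi / n%:R) by apply: adj; exact: val_inj.
have v23 : lf (nv C 2) (nv C 3) = - cos (pi / n%:R) by apply: adj; exact: val_inj.
have v30 : lf (nv C 3) (nv C 0) = - cos (pi / n%:R) by apply: adj; exact: val_inj.
have nf (x : K * K * K * K) : 0 < lf x x -> ~ forall i, lf x (nv C i) = 0.
  move=> /circle_of_vec[B' <-] orth; exact/not_fuchsian/(fuchsian_orth orth).
have [[qq' _] [pp' _]] := (geodesic_perp_span xi_perp1, geodesic_perp_span eta_perp2).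
have {xi_perp1} x0 := geodesic_perp_nv xi_perp1.
have {xi_perp3} x2 := geodesic_perp_nv xi_perp3.
have {eta_perp2} e1 := geodesic_perp_nv eta_perp2.
have {eta_perp4} e3 := geodesic_perp_nv eta_perp4.
have [|v02 _] := opposite_sides pp' x0 x2 e1 e3 (lf_nv C 0) (lf_nv C 2) c0 v01 v12 _
  (opposite_le1 R_quad R_side 0 2).
  by move=> x xx ? ? ? ?; apply: (nf x xx); exact: ord4_ind.
have [|v13 [a [b pE]]] := opposite_sides qq' e1 e3 x2 x0 (lf_nv C 1) (lf_nv C 3) c0 v12 v23 _
  (opposite_le1 R_quad R_side 1 3).
  by move=> x xx ? ? ? ?; apply: (nf x xx); exact: ord4_ind.
have on_lf z : on_circle B z -> lf (cvec B) (cpvec z) = 0 by rewrite lfC lf_cform_Chat.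
have [B0 B2] : lf (cvec B) (nv C 0) = 0 /\ lf (cvec B) (nv C 2) = 0.
  have [[a0 [b0 ->]] [a2 [b2 ->]]] := (x0, x2).
  by rewrite !(bfDr (@lfC K) (@lfP K), bfZr (@lfC K) (@lfP K)) !on_lf// !mulr0 addr0.
have p0 : cpvec p != 0.
  by apply/eqP => p0; have := lf_cpvec pp'; rewrite p0 bf0l ?ltxx//; exact: lfP.
have [e [m [ee m0 pm]]] := null_axis (lf_nv C 1) (lf_nv C 3) v13 pE (lf_cpvec0 p) p0.
have Bpe : lf (cvec B) (axis_t (nv C 1) (nv C 3)) + e * lf (cvec B) (axis_s (nv C 1) (nv C 3)) = 0.
  apply: (mulfI m0); rewrite mulr0 -(on_lf p Bp) pm.
  by rewrite !(bfDr (@lfC K) (@lfP K), bfZr (@lfC K) (@lfP K)).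
have [z z0] := interior_point R_quad R_side.
have [F [r [r0 BE]]] := frame_exists c0 v01 v12 v23 v30 v02 v13 z0 nf B0 B2 ee Bpe.
have n_gt1 : (1 < n)%N by exact: leq_trans n_ge3.
by split; [exact: (plane_meets_Nstar BE)|exact: (plane_closed_in_Nstar n_gt1 r0 BE)|
  exact: (plane_not_closed n_gt1 r0 BE)].
Qed.
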